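(* Let $\tau_{\mathcal{O}}: T_0^*P^2\mathcal{O}\to\mathfrak{J}^{\mathbb{C}}$ be the map $$\tau_{\mathcal{O}}(X,Y)=(\|Y\|^2X-Y\circ Y)\otimes 1+\frac{1}{\sqrt{2}}\|Y\|\,Y\otimes\sqrt{-1}$$ on the punctured cotangent bundle $T_0^*P^2\mathcal{O}\cong\{(X,Y)\in TP^2\mathcal{O} : Y\neq 0\}$ of the Cayley projective plane. Then $\tau_{\mathcal{O}}$ gives an isomorphism between $T_0^*P^2\mathcal{O}$ and $$\mathbb{E}=\{A\in\mathfrak{J}^{\mathbb{C}} : A\circ A=0,\ A\neq 0\}$$ (i.e. $\tau_{\mathcal{O}}$ is a diffeomorphism of $T_0^*P^2\mathcal{O}$ onto the complex submanifold $\mathbb{E}$ of $\mathfrak{J}^{\mathbb{C}}\setminus\{0\}$). Moreover $$\tau_{\mathcal{O}}^*\bigl(\sqrt{-1}\,\overline{\partial}\partial\|A\|^{\frac12}\bigr)=\frac{1}{\sqrt{2}}\,\omega_{\mathcal{O}},$$ where $\|A\|^{\frac12}$ denotes the function $A\mapsto\|A\|^{1/2}$ on $\mathfrak{J}^{\mathbb{C}}\setminus\{0\}$ and $\omega_{\mathcal{O}}$ is the natural symplectic form of the cotangent bundle.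
   Context: Octonions: $\mathbb{H}$ is the quaternion algebra over $\mathbb{R}$ with basis $e_0=1,e_1,e_2,e_3$ ($e_i^2=-1$, $e_1e_2=-e_2e_1=e_3$ and cyclic permutations), $\theta$ is quaternion conjugation. The Cayley algebra is $\mathcal{O}=\mathbb{H}\oplus\mathbb{H}e_4$ with product $(a+be_4)(h+ke_4)=ah-\theta(k)b+\{ka+b\theta(h)\}e_4$; $e_5=e_1e_4$, $e_6=e_2e_4$, $e_7=e_3e_4$. The basis $e_0,\dots,e_7$ is orthonormal for the inner product $\langle\cdot,\cdot\rangle$ on $\mathcal{O}$, and $\theta(\sum_{i=0}^7h_ie_i)=h_0e_0-\sum_{i=1}^7h_ie_i$. Jordan algebra: $\mathfrak{J}=\{X\in M(3,\mathcal{O}) : \theta({}^tX)=X\}$ (with $\theta$ applied entrywise), a real vector space of dimension 27, with Jordan product $X\circ Y=\frac12(XY+YX)$. $\operatorname{tr}X$ is the sum of the diagonal entries. The inner product is $(X,Y)=\operatorname{tr}(X\circ Y)$; for $$X=\begin{pmatrix}\xi_1&x_3&\theta(x_2)\\ \theta(x_3)&\xi_2&x_1\\ x_2&\theta(x_1)&\xi_3\end{pmatrix},\quad Y=\begin{pmatrix}\eta_1&y_3&\theta(y_2)\\ \theta(y_3)&\eta_2&y_1\\ y_2&\theta(y_1)&\eta_3\end{pmatrix}$$ ($\xi_i,\eta_i\in\mathbb{R}$, $x_i,y_i\in\mathcal{O}$) it equals $\sum_{i=1}^3(\xi_i\eta_i+2\langle x_i,y_i\rangle)$. Norm: $\|Y\|^2=(Y,Y)$.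 Complexification: $\mathfrak{J}^{\mathbb{C}}=\mathfrak{J}\otimes_{\mathbb{R}}\mathbb{C}$, with $\circ$, $\operatorname{tr}$, $(\cdot,\cdot)$ extended complex (bi)linearly; $\overline{A}$ is complex conjugation in the factor $\mathbb{C}$; the Hermitian inner product is $\langle A,B\rangle=(A,\overline{B})$ and $\|A\|^2=(A,\overline{A})$. $\partial,\overline{\partial}$ are the Dolbeault operators of the complex vector space $\mathfrak{J}^{\mathbb{C}}$. Cayley projective plane: $P^2\mathcal{O}=\{X\in\mathfrak{J} : X\circ X=X,\ \operatorname{tr}X=1\}$, and $TP^2\mathcal{O}=\{(X,Y)\in\mathfrak{J}\times\mathfrak{J} : X\circ X=X,\ \operatorname{tr}X=1,\ X\circ Y=\frac12Y\}$. The Riemannian metric is $(Y_1,Y_2)_{\mathbb{P}}=\frac12(Y_1,Y_2)$; the cotangent bundle is identified with the tangent bundle through this metric, and $T_0^*P^2\mathcal{O}$ is the cotangent bundle with the zero section removed. Under this identification the natural symplectic form is $\omega_{\mathcal{O}}=-\frac12(dX,dY)$, meaning the restriction to $TP^2\mathcal{O}\subset\mathfrak{J}\times\mathfrak{J}$ of $\frac12\bigl(\sum_{i=1}^3d\eta_i\wedge d\xi_i+2\sum_{i=1}^3\sum_{\alpha=0}^7dy^i_\alpha\wedge dx^i_\alpha\bigr)$, where $\xi_i,x_i=\sum_\alpha x^i_\alpha e_\alpha$ are the coordinates of $X$ and $\eta_i,y_i=\sum_\alpha y^i_\alpha e_\alpha$ those of $Y$. *)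

(* Defs.v *)
From HB Require Import structures.
From mathcomp Require Import all_boot all_order all_algebra.
From mathcomp Require Import ring.
From mathcomp Require Import complex.
From mathcomp Require Import all_classical all_reals all_analysis.

Set Implicit Arguments.
Unset Strict Implicit.
Unset Printing Implicit Defensive.

Import Order.TTheory GRing.Theory Num.Theory.
Import numFieldNormedType.Exports.

Local Open Scope classical_set_scope.
Local Open Scope ring_scope.

Section Smooth.
Context {R : realType} {V W : normedModType R}.

Fixpoint Ck (n : nat) (U : set V) (f : V -> W) : Prop :=
  match n with
  | 0 => forall x, U x -> {for x, continuous f}
  | n'.+1 => (forall x, U x -> differentiable f x) /\
             (forall v, Ck n' U ('D_v f))
  end.

(* Meant for open [U] only; see [smooth_on] for arbitrary subsets. *)
Definition smooth (U : set V) (f : V -> W) : Prop := forall n, Ck n U f.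

(* Smoothness on an arbitrary subset of a normed space: [f] locally extends to
   a smooth map on an open subset of the ambient space.  On an embedded
   submanifold this is the usual notion. *)
Definition smooth_on (S : set V) (f : V -> W) : Prop :=
  forall x, S x -> exists (U : set V) (g : V -> W),
    [/\ open U, U x, smooth U g & forall y, S y -> U y -> f y = g y].

End Smooth.

Section Manifold.
Context {R : realType}.

Definition diffeomorphism {V W : normedModType R}
    (S : set V) (T : set W) (f : V -> W) : Prop :=
  [/\ set_bij S T f, smooth_on S f &
      exists g : W -> V,
        (forall x, S x -> g (f x) = x) /\ smooth_on T g].

(* Tangent vectors at [x] to a submanifold [S] of [V]: the velocities at
   time 0 of the smooth curves of [V] that lie in [S] and start at [x]. *)
Definition tangent {V : normedModType R} (S : set V) (x v : V) : Prop :=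
  exists (I : set R) (c : R -> V),
    [/\ open I, I 0, smooth I c, (forall t, I t -> S (c t)) &
        c 0 = x /\ derive1 c 0 = v].

(* ['d f x] is the differential of [f] on the ambient space; the pullback to a
   submanifold is obtained by evaluating at tangent vectors. *)
Definition pullback2 {V W : normedModType R} {K : Type}
    (f : V -> W) (Theta : W -> W -> W -> K) (x u v : V) : K :=
  Theta (f x) ('d f x u) ('d f x v).

End Manifold.

(* [V * V] stands for the complexification of [V]: the pair [(a, b)] is
   a (x) 1 + b (x) sqrt(-1).  In particular ['rV[R]_n * 'rV[R]_n] is C^n. *)

Section Complexification.
Context {R : realType}.

Definition mulI {V : normedModType R} (A : V * V) : V * V := (- A.2, A.1).

Definition conjV {V : normedModType R} (A : V * V) : V * V := (A.1, - A.2).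

Definition bilinC {V W : normedModType R} (b : V -> V -> W)
    (A B : V * V) : W * W :=
  (b A.1 B.1 - b A.2 B.2, b A.1 B.2 + b A.2 B.1).

Definition formC {V : normedModType R} (b : V -> V -> R)
    (A B : V * V) : R[i] :=
  ((b A.1 B.1 - b A.2 B.2) +i* (b A.1 B.2 + b A.2 B.1))%C.

Definition holomorphic {V W : normedModType R}
    (U : set (V * V)) (f : V * V -> W * W) : Prop :=
  forall A, U A -> differentiable f A /\
    forall H, 'd f A (mulI H) = mulI ('d f A H).

(* [M] is a complex submanifold of dimension [k] of a complex vector space of
   dimension [n]: around each of its points there is a holomorphic chart to C^n
   carrying [M] to the subspace C^k x 0. *)
Definition complex_submanifold {V : normedModType R} (n k : nat)
    (M : set (V * V)) : Prop :=
  (k <= n)%N /\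
  forall A, M A -> exists (U : set (V * V))
      (phi : V * V -> 'rV[R]_n * 'rV[R]_n)
      (psi : 'rV[R]_n * 'rV[R]_n -> V * V),
    [/\ open U /\ U A, open (phi @` U),
        holomorphic U phi /\ holomorphic (phi @` U) psi,
        (forall B, U B -> psi (phi B) = B) &
        forall B, U B -> (M B <->
          forall j : 'I_n, (k <= j)%N ->
            (phi B).1 0 j = 0 /\ (phi B).2 0 j = 0)].

Section Dolbeault.
Context {V : normedModType R}.
Implicit Types (f : V * V -> R[i]) (alpha : V * V -> V * V -> R[i]).

Definition derivC f (A H : V * V) : R[i] :=
  ('D_H (fun B => complex.Re (f B)) A +i*
   'D_H (fun B => complex.Im (f B)) A)%C.

Definition del f (A H : V * V) : R[i] :=
  (derivC f A H - 'i%C * derivC f A (mulI H)) / 2%:R.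

Definition delbar f (A H : V * V) : R[i] :=
  (derivC f A H + 'i%C * derivC f A (mulI H)) / 2%:R.

(* [delbar] on 1-forms.  In complex coordinates z_k, a 1-form is
   alpha = sum_k f_k dz_k + g_k d(bar z_k) and
   delbar alpha = sum_k (delbar f_k) /\ dz_k + (delbar g_k) /\ d(bar z_k);
   since dz_k and d(bar z_k) are constant this is the formula below, with the
   convention (beta /\ gamma)(H, K) = beta H * gamma K - beta K * gamma H. *)
Definition delbar1 alpha (A H K : V * V) : R[i] :=
  delbar (alpha ^~ K) A H - delbar (alpha ^~ H) A K.

End Dolbeault.
End Complexification.

Notation quat R := 'rV[R]_4.
Notation octo R := 'rV[R]_(4 + 4).

(* An element of the Jordan algebra is given by its coordinates
   (xi_1, xi_2, xi_3) in R^3 and x_1, x_2, x_3 in O, the rows of a 3 x 8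
   matrix; [jmx] below is the associated Hermitian matrix, and [mxj] inverts
   it.  Indices start at 0. *)
Notation jordan R := ('rV[R]_3 * 'M[R]_(3, 4 + 4))%type.

Section Octonions.
Context {R : realType}.

Local Notation H := (quat R).
Local Notation O := (octo R).
Local Notation J := (jordan R).
Local Notation JC := (J * J)%type.

(* Coordinates in the basis e_0 = 1, e_1, e_2, e_3, with e_1 e_2 = e_3. *)
Definition hmul (a b : H) : H :=
  \row_(i < 4) [:: a 0 0 * b 0 0 - a 0 1 * b 0 1 - a 0 2 * b 0 2 - a 0 3 * b 0 3;
                   a 0 0 * b 0 1 + a 0 1 * b 0 0 + a 0 2 * b 0 3 - a 0 3 * b 0 2;
                   a 0 0 * b 0 2 + a 0 2 * b 0 0 + a 0 3 * b 0 1 - a 0 1 * b 0 3;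
                   a 0 0 * b 0 3 + a 0 3 * b 0 0 + a 0 1 * b 0 2 - a 0 2 * b 0 1]`_i.

Definition hconj (a : H) : H := \row_(i < 4) (if i == 0 then a 0 i else - a 0 i).

(* [row_mx a b] is the octonion a + b e_4, so that coordinate 4 + i is the one
   on e_i e_4. *)
Definition omul (x y : O) : O :=
  let a := lsubmx x in let b := rsubmx x in
  let h := lsubmx y in let k := rsubmx y in
  row_mx (hmul a h - hmul (hconj k) b) (hmul k a + hmul b (hconj h)).

Definition oconj (x : O) : O :=
  \row_(i < 4 + 4) (if i == 0 then x 0 i else - x 0 i).

Definition oreal (r : R) : O := \row_(i < 4 + 4) (if i == 0 then r else 0).

Definition oip (x y : O) : R := \sum_(i < 4 + 4) x 0 i * y 0 i.

Definition omulmx (M N : 'M[O]_3) : 'M[O]_3 :=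
  \matrix_(i, j) \sum_(k < 3) omul (M i k) (N k j).

Definition hermitian (M : 'M[O]_3) : Prop := map_mx oconj M^T = M.

Definition jxi (X : J) (i : 'I_3) : R := X.1 0 i.
Definition jx (X : J) (i : 'I_3) : O := row i X.2.

Definition jmx (X : J) : 'M[O]_3 :=
  let xi := fun i => oreal (jxi X i) in
  let x := jx X in
  \matrix_(i < 3, j < 3) (nth [::]
    [:: [:: xi 0;          x 2;          oconj (x 1)];
        [:: oconj (x 2);   xi 1;         x 0        ];
        [:: x 1;           oconj (x 0);  xi 2       ]] i)`_j.

Definition mxj (M : 'M[O]_3) : J :=
  (\row_(i < 3) M i i 0 0,
   \matrix_(i < 3) [:: M 1 2; M 2 0; M 0 1]`_i).

Definition jmul (X Y : J) : J :=
  mxj (map_mx ( *:%R 2^-1) (omulmx (jmx X) (jmx Y) + omulmx (jmx Y) (jmx X))).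

Lemma oconjK : involutive oconj.
Proof.
by move=> x; apply/rowP=> i; rewrite !mxE; case: (i == 0); rewrite ?opprK.
Qed.

Lemma I3P (P : 'I_3 -> Prop) : P 0 -> P 1 -> P 2 -> forall i, P i.
Proof.
move=> P0 P1 P2 [[|[|[|//]]] i3].
- by rewrite (_ : Ordinal _ = 0)//; apply: val_inj.
- by rewrite (_ : Ordinal _ = 1)//; apply: val_inj.
- by rewrite (_ : Ordinal _ = 2)//; apply: val_inj.
Qed.

Lemma jmx_hermitian (X : J) : hermitian (jmx X).
Proof.
have oconj_real r : oconj (oreal r) = oreal r.
  by apply/rowP=> i; rewrite !mxE; case: (i == 0); rewrite ?oppr0.
by apply/matrixP; elim/I3P; elim/I3P; rewrite !mxE //= ?oconjK ?oconj_real.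
Qed.

Lemma jmxK (X : J) : mxj (jmx X) = X.
Proof.
case: X => xi x; congr (_, _).
  by apply/rowP; elim/I3P; rewrite !mxE /= ?mxE.
apply/row_matrixP; elim/I3P; apply/rowP=> a;
  by rewrite !mxE /= ?mxE /= /jx ?mxE.
Qed.

Lemma mxjK (M : 'M[O]_3) : hermitian M -> jmx (mxj M) = M.
Proof.
move=> hM; have cE i j : oconj (M i j) = M j i by rewrite -[in RHS]hM !mxE.
have dE i : oreal (M i i 0 0) = M i i.
  apply/rowP=> a; rewrite mxE; case: ifP => [/eqP->//|a0].
  have /rowP/(_ a) := cE i i; rewrite mxE a0 => /eqP.
  by rewrite eq_sym -addr_eq0 -mulr2n mulrn_eq0 /= => /eqP.
have xE i : jx (mxj M) i = [:: M 1 2; M 2 0; M 0 1]`_i.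
  by apply/rowP=> a; rewrite !mxE.
apply/matrixP; elim/I3P; elim/I3P;
  by rewrite mxE /= /jxi ?xE /= ?cE ?mxE ?dE.
Qed.

Lemma I4P (P : 'I_4 -> Prop) : P 0 -> P 1 -> P 2 -> P 3 -> forall i, P i.
Proof.
move=> P0 P1 P2 P3 [[|[|[|[|//]]]] i4].
- by rewrite (_ : Ordinal _ = 0)//; apply: val_inj.
- by rewrite (_ : Ordinal _ = 1)//; apply: val_inj.
- by rewrite (_ : Ordinal _ = 2)//; apply: val_inj.
- by rewrite (_ : Ordinal _ = 3)//; apply: val_inj.
Qed.

Lemma oconj_row_mx (a b : H) : oconj (row_mx a b) = row_mx (hconj a) (- b).
Proof.
apply/rowP=> i; rewrite !mxE; case: splitP => j ij; rewrite !mxE.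
  by rewrite -!val_eqE /= ij.
by rewrite -val_eqE /= ij.
Qed.

Lemma hconj_mul (a b : H) : hconj (hmul a b) = hmul (hconj b) (hconj a).
Proof. by apply/rowP; elim/I4P; rewrite !mxE /= ?mxE /=; ring. Qed.

Lemma hconjB (a b : H) : hconj (a - b) = hconj a - hconj b.
Proof. by apply/rowP; elim/I4P; rewrite !mxE /= ?mxE /=; ring. Qed.

Lemma hconjK (a : H) : hconj (hconj a) = a.
Proof. by apply/rowP; elim/I4P; rewrite !mxE /= ?mxE /=; ring. Qed.

Lemma hmulNl (a b : H) : hmul (- a) b = - hmul a b.
Proof. by apply/rowP; elim/I4P; rewrite !mxE /= ?mxE /=; ring. Qed.

Lemma hmul_conjNN (a b : H) : hmul (hconj (- a)) (- b) = hmul (hconj a) b.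
Proof. by apply/rowP; elim/I4P; rewrite !mxE /= ?mxE /=; ring. Qed.

Lemma oconj_mul (x y : O) : oconj (omul x y) = omul (oconj y) (oconj x).
Proof.
rewrite -[x]hsubmxK -[y]hsubmxK !oconj_row_mx /omul /=.
rewrite !row_mxKl !row_mxKr hconjB !hconj_mul !hconjK.
by rewrite hmul_conjNN !hmulNl opprD [- _ - _]addrC.
Qed.

Lemma oconjZ (r : R) (x : O) : oconj (r *: x) = r *: oconj x.
Proof. by apply/rowP=> i; rewrite !mxE; case: (i == 0); rewrite ?mulrN. Qed.

Lemma oconjD (x y : O) : oconj (x + y) = oconj x + oconj y.
Proof. by apply/rowP=> i; rewrite !mxE; case: (i == 0); rewrite ?opprD. Qed.

Lemma oconj_sum (n : nat) (F : 'I_n -> O) :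
  oconj (\sum_i F i) = \sum_i oconj (F i).
Proof.
apply: (big_morph oconj oconjD); apply/rowP=> i.
by rewrite !mxE oppr0; case: (i == 0).
Qed.

Lemma oconj_jmx (X : J) i j : oconj (jmx X i j) = jmx X j i.
Proof. by have /matrixP/(_ j i) := jmx_hermitian X; rewrite [LHS]mxE [_^T _ _]mxE. Qed.

Lemma omul_re (x y : O) : omul x (oconj y) 0 0 = oip x y.
Proof.
rewrite -[x]hsubmxK -[y]hsubmxK oconj_row_mx /omul /oip big_split_ord /=.
rewrite !row_mxKl !row_mxKr [LHS]mxE; case: splitP => //= j j0.
rewrite -(_ : 0 = j); last by apply: val_inj.
have sum4 (F : 'I_4 -> R) : \sum_(i < 4) F i = F 0 + F 1 + F 2 + F 3.
  rewrite !big_ord_recr big_ord0 /= add0r.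
  by congr (_ + _ + _ + _); congr F; apply: val_inj.
rewrite !sum4 !row_mxEl !row_mxEr.
by rewrite !mxE /= ?mxE /=; ring.
Qed.

(* The symmetrised product of Hermitian matrices is Hermitian, so [mxj] loses
   nothing in [jmul]. *)
Lemma jmx_mul (X Y : J) :
  jmx (jmul X Y) =
  map_mx ( *:%R 2^-1) (omulmx (jmx X) (jmx Y) + omulmx (jmx Y) (jmx X)).
Proof.
apply: mxjK; apply/matrixP=> i j; rewrite !mxE oconjZ oconjD !oconj_sum.
rewrite addrC; congr (_ *: (_ + _)); apply: eq_bigr => k _.
  by rewrite oconj_mul !oconj_jmx.
by rewrite oconj_mul !oconj_jmx.
Qed.

Definition jtr (X : J) : R := \sum_(i < 3) jxi X i.

Definition jip (X Y : J) : R := jtr (jmul X Y).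

Lemma jipE (X Y : J) :
  jip X Y =
  \sum_(i < 3) (jxi X i * jxi Y i + 2 * oip (jx X i) (jx Y i)).
Proof.
have oip_mul (x y : O) : omul x (oconj y) 0 0 = oip x y by exact: omul_re.
have oipC (x y : O) : oip x y = oip y x.
  by apply: eq_bigr => i _; rewrite mulrC.
have oip_conj (x y : O) : oip (oconj x) (oconj y) = oip x y.
  by apply: eq_bigr => i _; rewrite !mxE; case: (i == 0); rewrite ?mulrNN.
have oip_real (a b : R) : oip (oreal a) (oreal b) = a * b.
  rewrite /oip (bigD1 0) //= !mxE eqxx big1 ?addr0 // => i /negPf i0.
  by rewrite !mxE i0 mulr0.
have -> : jip X Y = \sum_(i < 3) \sum_(k < 3) oip (jmx X i k) (jmx Y i k).
  apply: eq_bigr => i _; rewrite /jxi !mxE !summxE -big_split /= mulr_sumr.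
  apply: eq_bigr => k _; rewrite -!(oconj_jmx _ i k) !oip_mul [oip (jmx Y _ _) _]oipC.
  by field.
have sum3 (F : 'I_3 -> R) : \sum_(i < 3) F i = F 0 + F 1 + F 2.
  rewrite !big_ord_recr big_ord0 /= add0r.
  by congr (_ + _ + _); congr F; apply: val_inj.
by rewrite !sum3 !mxE /= !oip_conj !oip_real; ring.
Qed.

Definition jnorm (X : J) : R := Num.sqrt (jip X X).

Definition jmulC : JC -> JC -> JC := bilinC jmul.

Definition jhermC (A B : JC) : R[i] := formC jip A (conjV B).

Definition jnormC (A : JC) : R := Num.sqrt (complex.Re (jhermC A A)).

Definition P2O : set J := [set X | jmul X X = X /\ jtr X = 1].

Definition TP2O : set (J * J) :=
  [set p | P2O p.1 /\ jmul p.1 p.2 = 2^-1 *: p.2].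

Definition T0P2O : set (J * J) := [set p | TP2O p /\ p.2 <> 0].

Definition wedge (a b : J * J -> R) (u v : J * J) : R := a u * b v - a v * b u.

(* Canonical symplectic form of the cotangent bundle, transported to the tangent
   bundle by the metric (Y_1, Y_2)/2 of the projective plane (whence the factor
   1/2); the eta's and y's are the coordinates of the second component. *)
Definition omegaO (u v : J * J) : R :=
  2^-1 * (\sum_(i < 3)
            wedge (fun p => jxi p.2 i) (fun p => jxi p.1 i) u v
          + 2 * \sum_(i < 3) \sum_(a < 4 + 4)
            wedge (fun p => jx p.2 i 0 a) (fun p => jx p.1 i 0 a) u v).

Definition tauO (p : J * J) : JC :=
  let: (X, Y) := p in
  ((jnorm Y) ^+ 2 *: X - jmul Y Y, ((Num.sqrt 2)^-1 * jnorm Y) *: Y).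

Definition EO : set JC := [set A | jmulC A A = 0 /\ A <> 0].

End Octonions.

(* Main.v *)
Require Import Defs.
From HB Require Import structures.
From mathcomp Require Import all_boot all_order all_algebra.
From mathcomp Require Import ring lra zify.
From mathcomp Require Import complex.
From mathcomp Require Import all_classical all_reals all_analysis.

(** Two facts about the Jordan algebra carry the proof: its trace form is
    associative, [(X o Y, Z) = (X, Y o Z)] ([kip_assoc]), and every element
    satisfies its cubic characteristic equation ([cayley_hamilton]).  The latter
    is a consequence of the alternative laws of the octonions, and it is used
    mostly in polarised form ([cayley_hamilton_polar]).

    The diffeomorphism.  Let [X] be an idempotent of trace 1 and
    [X o Y = Y / 2].  The polarised equation at [(X, Y, Y)], the equation at [Y]
    and the polarised equation at [(Y^2, Y, Y)] become
    [X o Y^2 = |Y|^2/2 X], [Y o Y^2 = |Y|^2/2 Y] and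
    [Y^2 o Y^2 = |Y|^2/2 Y^2].  They express that [a = |Y|^2 X - Y^2] and
    [b = |Y| Y / sqrt 2] satisfy [a o a = b o b] and [a o b = 0], and that
    [a + i b] has norm [N = |Y|^2].  Conversely, if [A = a + i b] has square
    zero, then its trace vanishes ([kmul_sq0_tr]), and the polarised equation at
    [(a, b, b)] gives [a o a^2 = |a|^2/2 a] ([cone_cube]).  This is what is
    needed to see that [X = a / N + 2 b^2 / N^2] and [Y = sqrt 2 b / sqrt N]
    define a point of the bundle; they provide the inverse map.

    The complex structure.  An automorphism of the real algebra brings any
    nonzero element to one with a nonzero first diagonal entry ([exists_jaut]).
    Where [xi_0 <> 0], the equation [A o A = 0] determines [xi_1], [xi_2] and
    [x_0] from [(xi_0, x_1, x_2)] and constrains the latter to the quadric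
    [xi_0^2 + |x_1|^2 + |x_2|^2 = 0] ([kmul_sq0_chart]).  Splitting
    [xi_0^2 + y^2 = (xi_0 + i y) (xi_0 - i y)] for one coordinate [y] of [x_1]
    displays this quadric as a graph wherever one of the two factors is nonzero,
    so there is a rational chart with [1 + 7 + 8 = 16] free coordinates.

    The symplectic form.  For any Euclidean space the form [i delbar del] of
    the square root of the norm of its complexification is elementary
    ([delbar1_del_potential]).  On the bundle the quantities [(X, Y)], [(X, X)],
    [(Y^2, Y)] and [2 (X, Y^2) - (Y, Y)] are constant, so that their
    differentials vanish on tangent vectors ([tangent_T0P2O]).  Modulo these
    relations the terms involving the differential of [|Y|] cancel
    ([pullback_scalar]), and the canonical form is what remains. *)

Set Implicit Arguments.
Unset Strict Implicit.
Unset Printing Implicit Defensive.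

Import Order.TTheory GRing.Theory Num.Theory.
Import numFieldNormedType.Exports.

Local Open Scope classical_set_scope.
Local Open Scope ring_scope.

(** * Octonions over a commutative ring *)

Section GenericOctonions.
Context {K : comNzRingType}.
Local Notation O := 'rV[K]_(4 + 4).

Local Notation "x !! k" := (x 0 (@Ordinal (4 + 4) k isT)) (at level 2, k at level 0, format "x !! k").

(** The Cayley product in coordinates.  It is used over R for the Jordan
    algebra and over R[i] for the equations of the cone. *)
Definition gmul (x y : O) : O :=
  \row_(i < 4 + 4) [::
    x !!0 * y !!0 - x !!1 * y !!1 - x !!2 * y !!2 - x !!3 * y !!3
    - x !!4 * y !!4 - x !!5 * y !!5 - x !!6 * y !!6 - x !!7 * y !!7;
    x !!0 * y !!1 + x !!1 * y !!0 + x !!2 * y !!3 - x !!3 * y !!2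
    - y !!4 * x !!5 + y !!5 * x !!4 + y !!6 * x !!7 - y !!7 * x !!6;
    x !!0 * y !!2 + x !!2 * y !!0 + x !!3 * y !!1 - x !!1 * y !!3
    - y !!4 * x !!6 + y !!6 * x !!4 + y !!7 * x !!5 - y !!5 * x !!7;
    x !!0 * y !!3 + x !!3 * y !!0 + x !!1 * y !!2 - x !!2 * y !!1
    - y !!4 * x !!7 + y !!7 * x !!4 + y !!5 * x !!6 - y !!6 * x !!5;
    y !!4 * x !!0 - y !!5 * x !!1 - y !!6 * x !!2 - y !!7 * x !!3
    + x !!4 * y !!0 + x !!5 * y !!1 + x !!6 * y !!2 + x !!7 * y !!3;
    y !!4 * x !!1 + y !!5 * x !!0 + y !!6 * x !!3 - y !!7 * x !!2
    - x !!4 * y !!1 + x !!5 * y !!0 - x !!6 * y !!3 + x !!7 * y !!2;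
    y !!4 * x !!2 + y !!6 * x !!0 + y !!7 * x !!1 - y !!5 * x !!3
    - x !!4 * y !!2 + x !!6 * y !!0 - x !!7 * y !!1 + x !!5 * y !!3;
    y !!4 * x !!3 + y !!7 * x !!0 + y !!5 * x !!2 - y !!6 * x !!1
    - x !!4 * y !!3 + x !!7 * y !!0 - x !!5 * y !!2 + x !!6 * y !!1]`_i.

Definition gconj (x : O) : O :=
  \row_(i < 4 + 4) (if i == 0 then x 0 i else - x 0 i).

Definition gip (x y : O) : K := \sum_(i < 4 + 4) x 0 i * y 0 i.

Lemma sum8 (F : 'I_(4 + 4) -> K) :
  \sum_i F i = F (@Ordinal (4 + 4) 0 isT) + F (@Ordinal (4 + 4) 1 isT)
    + F (@Ordinal (4 + 4) 2 isT) + F (@Ordinal (4 + 4) 3 isT)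
    + F (@Ordinal (4 + 4) 4 isT) + F (@Ordinal (4 + 4) 5 isT)
    + F (@Ordinal (4 + 4) 6 isT) + F (@Ordinal (4 + 4) 7 isT).
Proof.
rewrite !big_ord_recr big_ord0 /= add0r.
by do ?congr (_ + _); congr F; apply: val_inj.
Qed.

(** Identities between octonions are checked after replacing each factor by
    its eight coordinates, where they become polynomial identities. *)
Definition oct8 (a0 a1 a2 a3 a4 a5 a6 a7 : K) : O :=
  \row_(i < 4 + 4) [:: a0; a1; a2; a3; a4; a5; a6; a7]`_i.

Lemma oext (x y : O) :
  [/\ x !!0 = y !!0, x !!1 = y !!1, x !!2 = y !!2 & x !!3 = y !!3] ->
  [/\ x !!4 = y !!4, x !!5 = y !!5, x !!6 = y !!6 & x !!7 = y !!7] -> x = y.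
Proof.
move=> [h0 h1 h2 h3] [h4 h5 h6 h7]; apply/rowP => -[k hk].
do 8?[case: k hk => [|k] hk]; last by []; by rewrite (eq_irrelevance hk isT).
Qed.

Lemma octP (x : O) : exists a0 a1 a2 a3 a4 a5 a6 a7, x = oct8 a0 a1 a2 a3 a4 a5 a6 a7.
Proof.
exists (x !!0), (x !!1), (x !!2), (x !!3), (x !!4), (x !!5), (x !!6), (x !!7).
by apply: oext; split; rewrite mxE.
Qed.

Lemma oct8D a0 a1 a2 a3 a4 a5 a6 a7 b0 b1 b2 b3 b4 b5 b6 b7 :
  oct8 a0 a1 a2 a3 a4 a5 a6 a7 + oct8 b0 b1 b2 b3 b4 b5 b6 b7 =
  oct8 (a0 + b0) (a1 + b1) (a2 + b2) (a3 + b3) (a4 + b4) (a5 + b5) (a6 + b6) (a7 + b7).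
Proof. by apply: oext; split; rewrite !mxE. Qed.
Lemma oct8Z c a0 a1 a2 a3 a4 a5 a6 a7 :
  c *: oct8 a0 a1 a2 a3 a4 a5 a6 a7 =
  oct8 (c * a0) (c * a1) (c * a2) (c * a3) (c * a4) (c * a5) (c * a6) (c * a7).
Proof. by apply: oext; split; rewrite !mxE. Qed.
Lemma oct8C a0 a1 a2 a3 a4 a5 a6 a7 :
  gconj (oct8 a0 a1 a2 a3 a4 a5 a6 a7) =
  oct8 a0 (- a1) (- a2) (- a3) (- a4) (- a5) (- a6) (- a7).
Proof. by apply: oext; split; rewrite !mxE. Qed.
Lemma oct8M x0 x1 x2 x3 x4 x5 x6 x7 y0 y1 y2 y3 y4 y5 y6 y7 :
  gmul (oct8 x0 x1 x2 x3 x4 x5 x6 x7) (oct8 y0 y1 y2 y3 y4 y5 y6 y7) =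
  oct8
   (x0*y0 - x1*y1 - x2*y2 - x3*y3 - x4*y4 - x5*y5 - x6*y6 - x7*y7)
   (x0*y1 + x1*y0 + x2*y3 - x3*y2 - y4*x5 + y5*x4 + y6*x7 - y7*x6)
   (x0*y2 + x2*y0 + x3*y1 - x1*y3 - y4*x6 + y6*x4 + y7*x5 - y5*x7)
   (x0*y3 + x3*y0 + x1*y2 - x2*y1 - y4*x7 + y7*x4 + y5*x6 - y6*x5)
   (y4*x0 - y5*x1 - y6*x2 - y7*x3 + x4*y0 + x5*y1 + x6*y2 + x7*y3)
   (y4*x1 + y5*x0 + y6*x3 - y7*x2 - x4*y1 + x5*y0 - x6*y3 + x7*y2)
   (y4*x2 + y6*x0 + y7*x1 - y5*x3 - x4*y2 + x6*y0 - x7*y1 + x5*y3)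
   (y4*x3 + y7*x0 + y5*x2 - y6*x1 - x4*y3 + x7*y0 - x5*y2 + x6*y1).
Proof. by apply: oext; split; rewrite mxE /= !mxE. Qed.
Lemma oct8_ip x0 x1 x2 x3 x4 x5 x6 x7 y0 y1 y2 y3 y4 y5 y6 y7 :
  gip (oct8 x0 x1 x2 x3 x4 x5 x6 x7) (oct8 y0 y1 y2 y3 y4 y5 y6 y7) =
  x0 * y0 + x1 * y1 + x2 * y2 + x3 * y3 + x4 * y4 + x5 * y5 + x6 * y6 + x7 * y7.
Proof. by rewrite /gip sum8 !mxE. Qed.
Definition octE := (oct8M, oct8C, oct8D, oct8Z, oct8_ip).

Ltac octo1 x :=
  let H := fresh in
  have := octP x; do 8![case=> ?]; move=> H; rewrite ?{x}H.
Ltac octring := rewrite !octE; f_equal; ring.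

Lemma gconjK x : gconj (gconj x) = x.
Proof. octo1 x; octring. Qed.
Lemma gconjM x y : gconj (gmul x y) = gmul (gconj y) (gconj x).
Proof. octo1 x; octo1 y; octring. Qed.
Lemma gconjD x y : gconj (x + y) = gconj x + gconj y.
Proof. octo1 x; octo1 y; octring. Qed.
Lemma gconjZ c x : gconj (c *: x) = c *: gconj x.
Proof. octo1 x; octring. Qed.
Lemma gmulDl x y z : gmul (x + y) z = gmul x z + gmul y z.
Proof. octo1 x; octo1 y; octo1 z; octring. Qed.
Lemma gmulDr x y z : gmul z (x + y) = gmul z x + gmul z y.
Proof. octo1 x; octo1 y; octo1 z; octring. Qed.
Lemma gmulZl c x y : gmul (c *: x) y = c *: gmul x y.
Proof. octo1 x; octo1 y; octring. Qed.
Lemma gmulZr c x y : gmul x (c *: y) = c *: gmul x y.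
Proof. octo1 x; octo1 y; octring. Qed.
Lemma gipC x y : gip x y = gip y x.
Proof. by apply: eq_bigr => i _; rewrite mulrC. Qed.
Lemma gipDl x y z : gip (x + y) z = gip x z + gip y z.
Proof. by rewrite /gip -big_split /=; apply: eq_bigr => i _; rewrite mxE mulrDl. Qed.
Lemma gipZl c x y : gip (c *: x) y = c * gip x y.
Proof. by rewrite /gip mulr_sumr; apply: eq_bigr => i _; rewrite mxE mulrA. Qed.
Lemma gipDr x y z : gip z (x + y) = gip z x + gip z y.
Proof. by rewrite !(gipC z) gipDl. Qed.
Lemma gipZr c x y : gip x (c *: y) = c * gip x y.
Proof. by rewrite !(gipC x) gipZl. Qed.
Lemma gip_conj x y : gip (gconj x) (gconj y) = gip x y.
Proof. octo1 x; octo1 y; rewrite !octE; ring. Qed.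

(** Alternativity, the substitute for associativity behind the cubic equation
    of the Jordan algebra. *)
Lemma gmulKl x y : gmul (gconj x) (gmul x y) = gip x x *: y.
Proof. octo1 x; octo1 y; octring. Qed.
Lemma gmulKr x y : gmul (gmul y x) (gconj x) = gip x x *: y.
Proof. by apply: (can_inj gconjK); rewrite !gconjM gmulKl gip_conj gconjZ. Qed.
Lemma gmulVKl x y : gmul x (gmul (gconj x) y) = gip x x *: y.
Proof. by rewrite -{1}(gconjK x) gmulKl gip_conj. Qed.
Lemma gmulVKr x y : gmul (gmul y (gconj x)) x = gip x x *: y.
Proof. by rewrite -{2}(gconjK x) gmulKr gip_conj. Qed.
(** Cyclic invariance of the real part of [x y z]. *)
Lemma gtri x y z : gip (gconj (gmul x y)) z = gip (gconj (gmul y z)) x.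
Proof. octo1 x; octo1 y; octo1 z; rewrite !octE; ring. Qed.
(** This identity makes [jreflect] multiplicative on the entry [x_2]. *)
Lemma moufang u x y : gmul (gmul u (gmul x y)) u = gmul (gmul u x) (gmul y u).
Proof. octo1 x; octo1 y; octo1 u; octring. Qed.
(** Polarisation of [gmulKl]. *)
Lemma gmul_polar x y z :
  gmul (gconj x) (gmul y z) + gmul (gconj y) (gmul x z) = (2 * gip x y) *: z.
Proof. octo1 x; octo1 y; octo1 z; octring. Qed.
(** Up to the factor [|u|^2], the map [x |-> (u x) u] is the reflection of
    [gconj x] through the line of [u]. *)
Lemma gmul_sandwich u x :
  gmul (gmul u x) u + gip u u *: gconj x = (2 * gip u (gconj x)) *: u.
Proof. octo1 x; octo1 u; octring. Qed.
Lemma gip_gmul x y : gip (gmul x y) (gmul x y) = gip x x * gip y y.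
Proof. octo1 x; octo1 y; rewrite !octE; ring. Qed.
End GenericOctonions.

(** * The exceptional Jordan algebra and its cubic equation *)

Section GenericJordan.
Context {K : numFieldType}.
Local Notation O := 'rV[K]_(4 + 4).
Local Notation JK := ('rV[K]_3 * 'M[K]_(3, 4 + 4))%type.

Definition kxi (X : JK) (i : 'I_3) : K := X.1 0 i.
Definition kx (X : JK) (i : 'I_3) : O := row i X.2.

Definition kpair (xi : 'I_3 -> K) (x : 'I_3 -> O) : JK :=
  (\row_i xi i, \matrix_i x i).

Lemma kpair_xi xi x i : kxi (kpair xi x) i = xi i.
Proof. by rewrite /kxi mxE. Qed.
Lemma kpair_x xi x i : kx (kpair xi x) i = x i.
Proof. by rewrite /kx rowK. Qed.

Lemma kext (X Y : JK) : kxi X =1 kxi Y -> kx X =1 kx Y -> X = Y.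
Proof.
case: X Y => [a b] [c d] h1 h2; congr (_, _); first by apply/rowP.
by apply/row_matrixP.
Qed.

(** The indices live in Z/3, so that one formula covers the three cyclic
    cases; [jmulE] identifies this product with the one of Hermitian
    matrices. *)
Definition kmul (X Y : JK) : JK :=
  kpair (fun i => kxi X i * kxi Y i + gip (kx X (i + 1)) (kx Y (i + 1))
                  + gip (kx X (i + 2)) (kx Y (i + 2)))
        (fun i => 2^-1 *: ((kxi X (i + 1) + kxi X (i + 2)) *: kx Y i
                   + (kxi Y (i + 1) + kxi Y (i + 2)) *: kx X i
                   + gconj (gmul (kx X (i + 1)) (kx Y (i + 2))
                            + gmul (kx Y (i + 1)) (kx X (i + 2))))).

Lemma I3add (i : 'I_3) :
  [/\ i + 1 + 1 = i + 2, i + 1 + 2 = i, i + 2 + 1 = i & i + 2 + 2 = i + 1].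
Proof. by elim/I3P: i; split; apply/eqP. Qed.

Lemma sum3 (F : 'I_3 -> K) (i : 'I_3) : \sum_j F j = F i + F (i + 1) + F (i + 2).
Proof.
have -> : \sum_j F j = F 0 + F 1 + F 2.
  rewrite !big_ord_recr big_ord0 /= add0r.
  by congr (_ + _ + _); congr F; apply: val_inj.
have e4 : (0 + 1 = 1 :> 'I_3) /\ (0 + 2 = 2 :> 'I_3) by split; apply/eqP.
have e5 : (1 + 1 = 2 :> 'I_3) /\ (1 + 2 = 0 :> 'I_3) by split; apply/eqP.
have e6 : (2 + 1 = 0 :> 'I_3) /\ (2 + 2 = 1 :> 'I_3) by split; apply/eqP.
elim/I3P: i; rewrite ?(e4.1, e4.2, e5.1, e5.2, e6.1, e6.2) //; ring.
Qed.

Lemma eqK2 (x y : K) : 2 * x = 2 * y -> x = y.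
Proof. by apply: mulfI; rewrite pnatr_eq0. Qed.

Definition ktr (X : JK) : K := \sum_i kxi X i.
Definition kip (X Y : JK) : K := \sum_i (kxi X i * kxi Y i + 2 * gip (kx X i) (kx Y i)).
Definition kone : JK := kpair (fun=> 1) (fun=> 0).

Lemma kmulC (X Y : JK) : kmul X Y = kmul Y X.
Proof.
apply: kext => i; rewrite !(kpair_xi, kpair_x).
  by rewrite mulrC 2![gip (kx X _) _]gipC.
by rewrite [gmul (kx X _) _ + _]addrC [_ *: kx Y i + _]addrC.
Qed.

Lemma kipC (X Y : JK) : kip X Y = kip Y X.
Proof. by apply: eq_bigr => i _; rewrite mulrC gipC. Qed.

Lemma kip_assoc (X Y Z : JK) : kip (kmul X Y) Z = kip X (kmul Y Z).
Proof.
rewrite /kip !(sum3 _ 0) !kpair_xi !kpair_x.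
have [e1 e2 e3 e4] := I3add 0; rewrite !(e1, e2, e3, e4).
rewrite !add0r -?[in X in X = _]/(0 : 'I_3).
move: (kxi X 0) (kxi X 1) (kxi X 2) (kxi Y 0) (kxi Y 1) (kxi Y 2).
move: (kxi Z 0) (kxi Z 1) (kxi Z 2) => z0 z1 z2 x0 x1 x2 y0 y1 y2.
move: (kx X 0) (kx X 1) (kx X 2) (kx Y 0) (kx Y 1) (kx Y 2).
move: (kx Z 0) (kx Z 1) (kx Z 2) => c0 c1 c2 a0 a1 a2 b0 b1 b2.
rewrite !(gconjD, gipZl, gipDl, gipZr, gipDr).
rewrite !(gipC a0 (gconj _)) !(gipC a1 (gconj _)) !(gipC a2 (gconj _)).
rewrite (gtri b1 c2) (gtri c2 a0) (gtri c1 b2) (gtri b2 a0).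
rewrite (gtri b2 c0) (gtri c0 a1) (gtri c2 b0) (gtri b0 a1).
rewrite (gtri b0 c1) (gtri c1 a2) (gtri c0 b1) (gtri b1 a2).
by field.
Qed.

(** [ksig] and [kdet] are the coefficients of [X] and [1] in [cayley_hamilton];
    the trace gives the remaining one. *)
Definition ksig (X : JK) : K := 2^-1 * (ktr X ^+ 2 - kip X X).
Definition kdet (X : JK) : K :=
  kxi X 0 * kxi X 1 * kxi X 2 - \sum_i kxi X i * gip (kx X i) (kx X i)
  + 2 * gip (gconj (gmul (kx X 0) (kx X 1))) (kx X 2).

Lemma kmul_sq_x (X : JK) i : kx (kmul X X) i =
  (kxi X (i + 1) + kxi X (i + 2)) *: kx X i + gconj (gmul (kx X (i + 1)) (kx X (i + 2))).
Proof.
rewrite kpair_x gconjD; move: (gconj _) => w; apply/rowP => a.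
move: (kx X i) => x; rewrite !mxE; by field.
Qed.

Lemma kdetE (X : JK) i : kdet X =
  kxi X i * kxi X (i + 1) * kxi X (i + 2)
  - (kxi X i * gip (kx X i) (kx X i) + kxi X (i + 1) * gip (kx X (i + 1)) (kx X (i + 1))
     + kxi X (i + 2) * gip (kx X (i + 2)) (kx X (i + 2)))
  + 2 * gip (gconj (gmul (kx X i) (kx X (i + 1)))) (kx X (i + 2)).
Proof.
have e5 : (0 + 1 = 1 :> 'I_3) /\ (0 + 2 = 2 :> 'I_3) by split; apply/eqP.
have e6 : (1 + 1 = 2 :> 'I_3) /\ (1 + 2 = 0 :> 'I_3) by split; apply/eqP.
have e7 : (2 + 1 = 0 :> 'I_3) /\ (2 + 2 = 1 :> 'I_3) by split; apply/eqP.
rewrite /kdet (sum3 _ 0) (e5.1) (e5.2).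
elim/I3P: i; rewrite ?(e5.1, e5.2, e6.1, e6.2, e7.1, e7.2).
- ring.
- rewrite [in LHS]gtri; ring.
- rewrite -[in LHS]gtri; ring.
Qed.

(** With [w = conj (x_(i+1) x_(i+2))], alternativity turns the octonion entries
    of [X^3] into combinations of [x_i] and [w]; the three diagonal entries
    agree because the real part of [x_0 x_1 x_2] is cyclically invariant. *)
Lemma cayley_hamilton (X : JK) :
  kmul X (kmul X X) - ktr X *: kmul X X + ksig X *: X = kdet X *: kone.
Proof.
have xiE (Y Z : JK) c i : kxi (Y + c *: Z) i = kxi Y i + c * kxi Z i by rewrite /kxi !mxE.
have xE (Y Z : JK) c i : kx (Y + c *: Z) i = kx Y i + c *: kx Z i.
  by apply/rowP => a; rewrite /kx !mxE.
apply: kext => i; rewrite -scaleNr !(xiE, xE).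
  have -> c : kxi (c *: kone) i = c by rewrite /kxi !mxE mulr1.
  rewrite (kdetE X i) !kpair_xi.
  rewrite !kmul_sq_x /ksig /ktr /kip !(sum3 _ i).
  have [-> -> -> ->] := I3add i.
  rewrite !(gipZr, gipDr).
  rewrite [gip (kx X (i + 1)) (gconj _)]gipC [gip (kx X (i + 2)) (gconj _)]gipC.
  rewrite (gtri (kx X (i + 2))).
  move: (kxi X i) (kxi X (i + 1)) (kxi X (i + 2)) => x0 x1 x2.
  move: (gip _ _) (gip _ _) (gip _ _) (gip _ _) => a b c d.
  by field.
have -> : kx (kdet X *: kone) i = 0 by apply/rowP => a; rewrite /kx !mxE mulr0.
rewrite kpair_x !kmul_sq_x !kpair_xi.
rewrite /ksig /ktr /kip !(sum3 _ i).
have [-> -> -> ->] := I3add i.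
rewrite !(gmulDr, gmulDl, gmulZl, gmulZr, gconjD, gconjZ, gconjM, gconjK, gmulKr, gmulVKl).
rewrite ?(gmulKr, gmulVKl, gmulKl, gmulVKr, gconjZ, gconjK, gip_conj).
move: (gmul _ _) => w.
move: (kx X i) (kx X (i + 1)) (kx X (i + 2)) => x y z.
move: (gip _ _) (gip _ _) (gip _ _) => a b c.
move: (kxi X i) (kxi X (i + 1)) (kxi X (i + 2)) => p q r.
apply/rowP => k; rewrite !mxE.
by field.
Qed.

End GenericJordan.

Section GenericJordanBilinear.
Context {K : numFieldType}.
Local Notation O := 'rV[K]_(4 + 4).
Local Notation JK := ('rV[K]_3 * 'M[K]_(3, 4 + 4))%type.
Implicit Types X Y Z : JK.

Lemma jext X Y : (forall i, X.1 0 i = Y.1 0 i) ->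
  (forall i a, X.2 i a = Y.2 i a) -> X = Y.
Proof.
case: X Y => [a b] [c d] h1 h2; congr (_, _); first by apply/rowP.
by apply/matrixP.
Qed.

Lemma kxiD X Y i : kxi (X + Y) i = kxi X i + kxi Y i.
Proof. by rewrite /kxi mxE. Qed.
Lemma kxiZ c X i : kxi (c *: X) i = c * kxi X i.
Proof. by rewrite /kxi mxE. Qed.
Lemma kxD X Y i : kx (X + Y) i = kx X i + kx Y i.
Proof. by apply/rowP => a; rewrite /kx !mxE. Qed.
Lemma kxZ c X i : kx (c *: X) i = c *: kx X i.
Proof. by apply/rowP => a; rewrite /kx !mxE. Qed.

Lemma kmulDl X Y Z : kmul (X + Y) Z = kmul X Z + kmul Y Z.
Proof.
apply: kext => i; rewrite !(kxiD, kxD) !(kpair_xi, kpair_x) !(kxiD, kxD).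
  by rewrite !gipDl; ring.
rewrite !(gmulDl, gmulDr, gconjD); do 4!move: (gconj _) => ?.
by apply/rowP => a; rewrite !mxE; move: (kx X i 0 a) (kx Y i 0 a) (kx Z i 0 a) => *; ring.
Qed.
Lemma kmulZl c X Z : kmul (c *: X) Z = c *: kmul X Z.
Proof.
apply: kext => i; rewrite !(kxiZ, kxZ) !(kpair_xi, kpair_x) !(kxiZ, kxZ).
  by rewrite !gipZl; ring.
rewrite !(gmulZl, gmulZr, gconjD, gconjZ); do 2!move: (gconj _) => ?.
by apply/rowP => a; rewrite !mxE; move: (kx X i 0 a) (kx Z i 0 a) => *; ring.
Qed.
Lemma kmulDr X Y Z : kmul Z (X + Y) = kmul Z X + kmul Z Y.
Proof. by rewrite !(kmulC Z) kmulDl. Qed.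
Lemma kmulZr c X Z : kmul Z (c *: X) = c *: kmul Z X.
Proof. by rewrite !(kmulC Z) kmulZl. Qed.
Lemma kipDl X Y Z : kip (X + Y) Z = kip X Z + kip Y Z.
Proof.
rewrite /kip -big_split /=; apply: eq_bigr => i _.
by rewrite kxiD kxD gipDl; ring.
Qed.
Lemma kipZl c X Z : kip (c *: X) Z = c * kip X Z.
Proof. by rewrite /kip mulr_sumr; apply: eq_bigr => i _; rewrite kxiZ kxZ gipZl; ring. Qed.
Lemma kipDr X Y Z : kip Z (X + Y) = kip Z X + kip Z Y.
Proof. by rewrite !(kipC Z) kipDl. Qed.
Lemma kipZr c X Z : kip Z (c *: X) = c * kip Z X.
Proof. by rewrite !(kipC Z) kipZl. Qed.
Lemma ktr_kmul X Y : ktr (kmul X Y) = kip X Y.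
Proof. by rewrite /ktr /kip !(sum3 _ 0) !kpair_xi; have [-> -> -> ->] := I3add 0; ring. Qed.
Lemma ktrD X Y : ktr (X + Y) = ktr X + ktr Y.
Proof. by rewrite /ktr -big_split; apply: eq_bigr => i _; rewrite kxiD. Qed.
Lemma ktrZ c X : ktr (c *: X) = c * ktr X.
Proof. by rewrite /ktr mulr_sumr; apply: eq_bigr => i _; rewrite kxiZ. Qed.
Lemma ktr1 : ktr (kone : JK) = 3.
Proof. by rewrite /ktr (eq_bigr (fun=> 1)) ?big_const_ord /= ?addr0 // => i _; rewrite kpair_xi. Qed.

(** The part of the equation of [X + t Y] that is quadratic in [t], obtained
    from the values at [X + Y], [X - Y] and [X].  The scalar [c] is a
    polarisation of the determinant; in the applications taking traces shows
    that it vanishes. *)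
Lemma cayley_hamilton_polar X Y : exists c,
  kmul X (kmul Y Y) + 2 *: kmul Y (kmul X Y) - ktr X *: kmul Y Y
   - (2 * ktr Y) *: kmul X Y + ksig Y *: X + (ktr X * ktr Y - kip X Y) *: Y = c *: kone.
Proof.
exists (2^-1 * (kdet (X + Y) + kdet (X + (-1) *: Y) - 2 * kdet X)).
have := cayley_hamilton X; have := cayley_hamilton (X + (-1) *: Y).
have := cayley_hamilton (X + Y).
move: (kdet (X + Y)) (kdet (X + (-1) *: Y)) (kdet X) => d1 d2 d3.
rewrite /ksig !(kmulDl, kmulDr, kmulZl, kmulZr, kipDl, kipDr, kipZl, kipZr, ktrD, ktrZ).
rewrite (kmulC Y X) (kipC Y X).
move: (kmul X X) (kmul X Y) (kmul Y Y) => A B C.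
move: (kmul X A) (kmul X B) (kmul X C) (kmul Y A) (kmul Y B) (kmul Y C) kone => ? ? ? ? ? ? e.
move: (ktr X) (ktr Y) (kip X X) (kip X Y) (kip Y Y) => tx ty sx sxy sy h1 h2 h3.
have -> : (2^-1 * (d1 + d2 - 2 * d3)) *: e = 2^-1 *: (d1 *: e + d2 *: e - 2 *: (d3 *: e)).
  by rewrite !scalerA -scalerDl -scalerBl scalerA.
rewrite -h1 -h2 -h3; apply: jext => [i|i a]; rewrite /= !mxE; by field.
Qed.
End GenericJordanBilinear.

(** * Elements of square zero *)

Section GenericJordan.
Context {K : numFieldType}.
Local Notation O := 'rV[K]_(4 + 4).
Local Notation JK := ('rV[K]_3 * 'M[K]_(3, 4 + 4))%type.

Lemma kmul_sq0P (X : JK) : kmul X X = 0 <->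
  forall i, kxi X i ^+ 2 + gip (kx X (i + 1)) (kx X (i + 1))
              + gip (kx X (i + 2)) (kx X (i + 2)) = 0 /\
            (kxi X (i + 1) + kxi X (i + 2)) *: kx X i
              + gconj (gmul (kx X (i + 1)) (kx X (i + 2))) = 0.
Proof.
have xi0 i : kxi (0 : JK) i = 0 by rewrite /kxi mxE.
have x0 i : kx (0 : JK) i = 0 by apply/rowP => a; rewrite /kx !mxE.
split=> [XX0 i|H].
  by rewrite -kmul_sq_x XX0 expr2 x0 -[in X in _ = X /\ _](xi0 i) -[in X in _ = X /\ _]XX0 kpair_xi.
apply: kext => i; have [h1 h2] := H i; last by rewrite kmul_sq_x x0.
by rewrite kpair_xi -expr2 xi0.
Qed.

(** If [X^2 = 0] then [(tr X)^2 x_i = 0]: multiply the conjugate of the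
    off-diagonal equation of index [i+1] by [conj x_(i+2)] on the left, the one
    of index [i+2] by [conj x_(i+1)] on the right, and use alternativity.  So a
    nonzero trace would make [X] diagonal, hence zero. *)
Lemma kmul_sq0_tr (X : JK) : kmul X X = 0 -> ktr X = 0.
Proof.
move=> /kmul_sq0P XX0; apply/eqP/negPn/negP => T0.
suff x0 i : kx X i = 0.
  case/negP: T0; rewrite /ktr big1// => i _.
  have [+ _] := XX0 i; rewrite !x0 => /eqP.
  have -> : gip 0 0 = 0 :> K by rewrite /gip big1// => a _; rewrite mxE mul0r.
  by rewrite !addr0 sqrf_eq0 => /eqP.
have [d o] := XX0 i; have [_ oj] := XX0 (i + 1); have [_ ok] := XX0 (i + 2).
move: T0 d o oj ok; rewrite /ktr (sum3 _ i); have [-> -> -> ->] := I3add i.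
move: (kx X i) (kx X (i + 1)) (kx X (i + 2)) => x y z.
move: (kxi X i) (kxi X (i + 1)) (kxi X (i + 2)) => p q r T0 d o oj ok.
have conj0 : gconj 0 = 0 :> O by apply/rowP => a; rewrite !mxE oppr0 if_same.
have mul0 (u : O) : gmul u 0 = 0 by rewrite -[X in gmul u X](scale0r 0) gmulZr scale0r.
have mul0l (u : O) : gmul 0 u = 0 by rewrite -[X in gmul X u](scale0r 0) gmulZl scale0r.
have /(congr1 (gmul (gconj z) \o gconj)) /= := oj.
rewrite gconjD gconjK conj0 mul0 gmulDr gconjZ gmulZr -gconjM gmulKl => hj.
have /(congr1 ((@gmul K)^~ (gconj y) \o gconj)) /= := ok.
rewrite gconjD gconjK conj0 mul0l gmulDl gconjZ gmulZl -gconjM gmulKr => hk.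
have : (p + q + r) ^+ 2 *: x = 0.
  move: o hj hk d; move: (gconj _) (gip y y) (gip z z) => w b c o hj hk d.
  apply/rowP => a; move/rowP/(_ a): o; move/rowP/(_ a): hj; move/rowP/(_ a): hk.
  rewrite !mxE; move: (x 0 a) (w 0 a) => X1 W hk hj o.
  have WE : W = - ((q + r) * X1) by apply/eqP; rewrite -addr_eq0 addrC o.
  have cE : c = - (p ^+ 2 + b) by apply/eqP; rewrite -addr_eq0 addrC d.
  move: hj hk; rewrite WE cE => hj hk.
  have -> : (p + q + r) ^+ 2 * X1 =
     - ((r + p) * - ((q + r) * X1) + - (p ^+ 2 + b) * X1
        + ((p + q) * - ((q + r) * X1) + b * X1)) by ring.
  by rewrite hj hk addr0 oppr0.
by move/eqP; rewrite scaler_eq0 sqrf_eq0 (negPf T0) /= => /eqP.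
Qed.

(** Since the trace vanishes, [xi_1 + xi_2] may be replaced by [- xi_0], which
    puts the equations of [kmul_sq0P] in a form solved for [xi_1], [xi_2] and
    [x_0]. *)
Lemma kmul_sq0_chart (X : JK) : kxi X 0 != 0 ->
  kmul X X = 0 <->
  [/\ kxi X 0 ^+ 2 + gip (kx X 1) (kx X 1) + gip (kx X 2) (kx X 2) = 0,
      kxi X 0 * kxi X 1 - gip (kx X 2) (kx X 2) = 0,
      kxi X 0 * kxi X 2 - gip (kx X 1) (kx X 1) = 0 &
      kxi X 0 *: kx X 0 - gconj (gmul (kx X 1) (kx X 2)) = 0].
Proof.
have I1 : (0 + 1 = 1 :> 'I_3) /\ (0 + 2 = 2 :> 'I_3) by split; apply/eqP.
have I2 : (1 + 1 = 2 :> 'I_3) /\ (1 + 2 = 0 :> 'I_3) by split; apply/eqP.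
have I3 : (2 + 1 = 0 :> 'I_3) /\ (2 + 2 = 1 :> 'I_3) by split; apply/eqP.
move=> x0; split=> [XX0|[h0 h1 h2 h3]].
  have T0 := kmul_sq0_tr XX0; move/kmul_sq0P in XX0.
  have [d0 o0] := XX0 0; have [d1 o1] := XX0 1; have [d2 o2] := XX0 2.
  move: d0 o0 d1 o1 d2 o2 T0; rewrite /ktr (sum3 _ 0).
  rewrite ?(I1.1, I1.2, I2.1, I2.2, I3.1, I3.2).
  move: (kxi X 0) (kxi X 1) (kxi X 2) (gip _ _) (gip _ _) (gip _ _) => p q r a b c.
  move=> d0 o0 d1 o1 d2 o2 T0.
  have rE : r = - (p + q) by apply/eqP; rewrite -addr_eq0 addrC T0.
  subst r; split=> //.
  - apply: eqK2; rewrite mulr0 -[RHS]oppr0 -[in RHS](addr0 0) -{1}d0 -d1 -[RHS]addr0 -d2.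
    by ring.
  - apply: eqK2; rewrite mulr0 -[RHS]oppr0 -[in RHS](addr0 0) -{1}d0 -d2 -[RHS]addr0 -d1.
    by ring.
  - move: o0; have -> : q - (p + q) = - p by ring.
    rewrite scaleNr => /eqP.
    by rewrite addrC subr_eq0 => /eqP ->; rewrite subrr.
apply/kmul_sq0P; elim/I3P; rewrite ?(I1.1, I1.2, I2.1, I2.2, I3.1, I3.2);
move: h0 h1 h2 h3 x0; move: (kxi X 0) (kxi X 1) (kxi X 2) (kx X 0) (kx X 1) (kx X 2);
move=> p q r x y z h0 h1 h2 h3 p0;
have {h1} q0 : q = gip z z / p
  by apply: (mulfI p0); rewrite mulrCA mulfV// mulr1; apply/eqP; rewrite -subr_eq0 h1.
all: have {h2} r0 : r = gip y y / p
  by apply: (mulfI p0); rewrite mulrCA mulfV// mulr1; apply/eqP; rewrite -subr_eq0 h2.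
all: have {h3} a0 : x = p^-1 *: gconj (gmul y z)
  by move/eqP: h3; rewrite subr_eq0 => /eqP <-; rewrite scalerA mulVf// scale1r.
all: have A0 : gip x x = gip y y * gip z z / p ^+ 2
  by rewrite a0 gipZl gipZr gip_conj gip_gmul; move: (gip _ _) (gip _ _) => b c; field.
all: have cE : gip z z = - (p ^+ 2 + gip y y) by apply/eqP; rewrite -addr_eq0 addrC h0.
- split=> //; rewrite q0 r0 -mulrDl [X in X / _]addrC.
  have -> : gip y y + gip z z = - p ^+ 2 by rewrite cE; move: (gip _ _) => b; ring.
  have -> : - p ^+ 2 / p = - p by field.
  by rewrite a0 scaleNr scalerA divff// scale1r addrC subrr.
- rewrite A0 q0 r0; split; first by rewrite cE; move: (gip _ _) => b; field.
  rewrite a0 gmulZr !gconjZ gconjM gconjK gmulKr scalerA -scalerDl.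
  rewrite cE; apply/eqP; rewrite scaler_eq0; apply/orP; left; apply/eqP.
  by move: (gip _ _) => b; field.
- rewrite A0 q0 r0; split; first by rewrite cE; move: (gip _ _) => b; field.
  rewrite a0 gmulZl !gconjZ gconjM gconjK gmulKl scalerA -scalerDl.
  rewrite cE; apply/eqP; rewrite scaler_eq0; apply/orP; left; apply/eqP.
  by move: (gip _ _) => b; field.
Qed.
End GenericJordan.

(** * Tangent vectors and null elements *)

Ltac jlin := apply: jext => [?|? ?]; rewrite /= !mxE; by field.
Section Consequences.
Context {K : numFieldType}.
Local Notation JK := ('rV[K]_3 * 'M[K]_(3, 4 + 4))%type.
Implicit Types X Y : JK.

Lemma kmul0r X : kmul X 0 = 0.
Proof. by rewrite -[X in kmul _ X](scale0r 0) kmulZr scale0r. Qed.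
Lemma kip0l X : kip 0 X = 0.
Proof. by rewrite -[X in kip X _](scale0r 0) kipZl mul0r. Qed.
Lemma ktr0 : ktr (0 : JK) = 0.
Proof. by rewrite -(scale0r 0) ktrZ mul0r. Qed.

Definition khalf X : K := 2^-1 * kip X X.

Lemma kip1 X : kip X kone = ktr X.
Proof.
rewrite /ktr; apply: eq_bigr => i _; rewrite kpair_xi kpair_x mulr1.
by rewrite -[X in gip _ X](scale0r 0) gipZr mul0r mulr0 addr0.
Qed.

(** This removes the multiple of the unit left by the polarised equation. *)
Lemma scalar_tr0 X (c : K) : X = c *: kone -> ktr X = 0 -> X = 0.
Proof.
move=> ->; rewrite ktrZ ktr1 => /eqP; rewrite mulf_eq0 pnatr_eq0 orbF => /eqP ->.
by rewrite scale0r.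
Qed.

(** Power associativity in degree four, from the polarised equation at
    [(Y^2, Y, Y)]. *)
Lemma kmul_sq_sq Y s : ktr Y = 0 -> kip Y Y = 2 * s -> kmul Y (kmul Y Y) = s *: Y ->
  kmul (kmul Y Y) (kmul Y Y) = s *: kmul Y Y.
Proof.
move=> T0 Ys Y3; have [c] := cayley_hamilton_polar (kmul Y Y) Y.
have Y2Y : kip (kmul Y Y) Y = 0.
  by rewrite -ktr_kmul kmulC Y3 ktrZ T0 mulr0.
rewrite Y2Y T0 /ksig T0 Ys ktr_kmul Ys [kmul (kmul Y Y) Y]kmulC Y3 !kmulZr.
have -> : 2^-1 * (0 ^+ 2 - 2 * s) = - s by field.
set Y2 := kmul Y Y; set Y4 := kmul Y2 Y2 => E.
have {}E : Y4 - s *: Y2 = c *: kone.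
  by rewrite -E {E}; clearbody Y4; clearbody Y2; jlin.
apply/eqP; rewrite -subr_eq0; apply/eqP/(scalar_tr0 E).
rewrite -scaleNr ktrD ktrZ ktr_kmul ktr_kmul Ys /Y2 kip_assoc Y3 kipZr Ys; ring.
Qed.

Section Tangent.
Variables X Y : JK.
Hypotheses (XX : kmul X X = X) (TX : ktr X = 1) (XY : kmul X Y = 2^-1 *: Y).

Lemma tan_ip : kip X Y = 0.
Proof.
have : kip X Y = 2^-1 * kip X Y by rewrite -[in LHS]XX kip_assoc XY kipZr.
move/eqP; rewrite -subr_eq0 -{1}[kip X Y]mul1r -mulrBl mulf_eq0 => /orP[|/eqP//].
have -> : 1 - 2^-1 = 2^-1 :> K by field.
by rewrite invr_eq0 pnatr_eq0.
Qed.

Lemma tan_tr : ktr Y = 0.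
Proof.
have : ktr (kmul X Y) = 0 by rewrite ktr_kmul tan_ip.
by rewrite XY ktrZ => /eqP; rewrite mulf_eq0 invr_eq0 pnatr_eq0 => /eqP.
Qed.

Lemma tan_ipX : kip X X = 1. Proof. by rewrite -ktr_kmul XX. Qed.

Lemma tan_ipXY2 : kip X (kmul Y Y) = khalf Y.
Proof. by rewrite -kip_assoc XY kipZl. Qed.

(** This is the polarised equation at [(X, Y, Y)], whose scalar term vanishes
    because both sides have the same trace by [tan_ipXY2]. *)
Lemma tan_mulXY2 : kmul X (kmul Y Y) = khalf Y *: X.
Proof.
have [c] := cayley_hamilton_polar X Y.
rewrite /ksig TX tan_tr tan_ip XY kmulZr scalerA mulfV ?pnatr_eq0// scale1r.
move=> E0; have E : kmul X (kmul Y Y) - khalf Y *: X = c *: kone.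
  rewrite -E0 /khalf; move: (kmul _ _) (kmul _ _) (kip _ _) => A B n; jlin.
have c0 : c = 0.
  have := congr1 ktr E; rewrite -scaleNr ktrD !ktrZ ktr_kmul tan_ipXY2 TX ktr1.
  rewrite mulr1 subrr => /esym/eqP; rewrite mulf_eq0 pnatr_eq0 orbF => /eqP //.
by apply/eqP; rewrite -subr_eq0 E c0 scale0r.
Qed.

(** The characteristic equation gives this up to [det Y] times the unit; its
    trace and its inner product with [X] show that [3/2 det Y = det Y]. *)
Lemma tan_cube : kmul Y (kmul Y Y) = khalf Y *: Y.
Proof.
have := cayley_hamilton Y; move: (kdet Y) => d.
rewrite /ksig tan_tr scale0r subr0 expr0n /= sub0r mulrN scaleNr => E.
have h1 := congr1 ktr E; have h2 := congr1 (kip X) E.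
rewrite -scaleNr ktrD !ktrZ ktr_kmul tan_tr ktr1 mulr0 addr0 in h1.
rewrite -scaleNr kipDr !kipZr tan_ip mulr0 addr0 kip1 TX in h2.
rewrite -kip_assoc XY kipZl h1 in h2.
have d0 : d = 0.
  move/eqP: h2; rewrite -subr_eq0.
  have -> : 2^-1 * (d * 3) - d * 1 = 2^-1 * d by field.
  by rewrite mulf_eq0 invr_eq0 pnatr_eq0 => /eqP.
by apply/eqP; rewrite -subr_eq0 E d0 scale0r.
Qed.

Lemma tan_Y2Y : kip (kmul Y Y) Y = 0.
Proof. by rewrite -ktr_kmul kmulC tan_cube ktrZ tan_tr mulr0. Qed.

Lemma tan_Y4 : kmul (kmul Y Y) (kmul Y Y) = khalf Y *: kmul Y Y.
Proof.
apply: kmul_sq_sq; [exact: tan_tr| |exact: tan_cube].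
by rewrite /khalf mulrA mulfV ?mul1r ?pnatr_eq0.
Qed.

End Tangent.

Section Cone.
Variables a b : JK.
Hypotheses (aabb : kmul a a = kmul b b) (ab : kmul a b = 0)
  (Ta : ktr a = 0) (Tb : ktr b = 0).

Lemma cone_ip : kip a b = 0. Proof. by rewrite -ktr_kmul ab ktr0. Qed.
Lemma cone_norm : kip a a = kip b b. Proof. by rewrite -!ktr_kmul aabb. Qed.

(** Since [a o b = 0] and [b^2 = a^2], the polarised equation at [(a, b, b)]
    gives this up to a multiple of the unit, which has trace zero. *)
Lemma cone_cube : kmul a (kmul a a) = khalf a *: a.
Proof.
have [c] := cayley_hamilton_polar a b.
rewrite /ksig ab Ta Tb cone_ip -cone_norm -aabb kmul0r.
move=> E0; have E : kmul a (kmul a a) - khalf a *: a = c *: kone.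
  rewrite -E0 /khalf {E0}; move: (kmul a a) (kip _ _) => B n.
  by move: (kmul a B) => A; jlin.
apply/eqP; rewrite -subr_eq0; apply/eqP/(scalar_tr0 E).
by rewrite -scaleNr ktrD ktrZ Ta ktr_kmul aabb -kip_assoc ab mulr0 addr0 kip0l.
Qed.
End Cone.
End Consequences.

(** * Automorphisms of the Jordan algebra *)

Lemma polar_inj (K : numFieldType) (V : lmodType K) (a b c d : V) :
  c + a + (a + d) = c + b + (b + d) -> a = b.
Proof.
have dbl (x : V) : x + x = 2 *: x by rewrite scaler_nat mulr2n.
rewrite -!addrA => /addrI; rewrite !addrA => /addIr; rewrite !dbl => h.
by have := congr1 (fun Z => 2^-1 *: Z) h; rewrite !scalerA mulVf ?pnatr_eq0// !scale1r.
Qed.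

Section Automorphisms.
Context {K : numFieldType}.
Local Notation O := 'rV[K]_(4 + 4).
Local Notation JK := ('rV[K]_3 * 'M[K]_(3, 4 + 4))%type.

Record jaut (g gi : JK -> JK) : Prop := Jaut {
  jaut_lin : linear g;
  jaut_inv_lin : linear gi;
  jautK : cancel g gi;
  jautVK : cancel gi g;
  jaut_sq : forall X, kmul (g X) (g X) = g (kmul X X) }.

Lemma jaut_mul g gi : jaut g gi -> forall X Y, kmul (g X) (g Y) = g (kmul X Y).
Proof.
case=> gl _ _ _ gs X Y.
have gD A B : g (A + B) = g A + g B by have := gl 1 A B; rewrite !scale1r.
have := gs (X + Y); rewrite !(gD, kmulDl, kmulDr) !gs.
rewrite (kmulC Y X) (kmulC (g Y)).
exact: polar_inj.
Qed.

Lemma jaut_inv g gi : jaut g gi -> jaut gi g.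
Proof.
by case=> gl gil gK giK gs; split=> // X; apply: (can_inj gK); rewrite -gs !giK.
Qed.

Lemma jaut_comp g gi h hi : jaut g gi -> jaut h hi -> jaut (g \o h) (hi \o gi).
Proof.
case=> gl gil gK giK gs [hl hil hK hiK hs]; split=> /=.
- by move=> a x y; rewrite /= hl gl.
- by move=> a x y; rewrite /= gil hil.
- by move=> X /=; rewrite gK hK.
- by move=> X /=; rewrite hiK giK.
- by move=> X; rewrite gs hs.
Qed.

Definition jshift (k : 'I_3) (X : JK) : JK :=
  kpair (fun i => kxi X (i + k)) (fun i => kx X (i + k)).

Lemma jshift_linear k : linear (jshift k).
Proof.
move=> a X Y; apply: kext => i; first by rewrite kxiD kxiZ !kpair_xi kxiD kxiZ.
by rewrite kxD kxZ !kpair_x kxD kxZ.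
Qed.

Lemma jaut_shift k : jaut (jshift k) (jshift (- k)).
Proof.
have sK l l' X : l + l' = 0 -> jshift l (jshift l' X) = X.
  move=> ll; apply: kext => i; first by rewrite !kpair_xi -addrA ll addr0.
  by rewrite !kpair_x -addrA ll addr0.
split; [exact: jshift_linear|exact: jshift_linear| | |] => X.
- by apply: sK; rewrite addNr.
- by apply: sK; rewrite addrN.
by apply: kext => i; rewrite !(kpair_xi, kpair_x) ![i + _ + k]addrAC.
Qed.

Section Reflection.
Variables (u : O) (c : K).
Hypotheses (uu : gip u u = 1) (cc : c * c = 2^-1).

(** For [u] of norm 1 and [c = 1 / sqrt 2] this is the operator
    [X |-> 2 w o (w o X) - X] of the element [w = E_2 + c (E_0 - E_1) + c F_2(u)],
    for which [w o w = 1].  It acts on [(xi_0 - xi_1, x_2)] as a reflection of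
    a nine-dimensional space and on [(x_0, x_1)] as the matching spinor map. *)
Definition jreflect (X : JK) : JK :=
  let m := (kxi X 0 + kxi X 1) / 2 in let t := (kxi X 0 - kxi X 1) / 2 in
  let s := gip (kx X 2) u in
  kpair (fun i => [:: m + s; m - s; kxi X 2]`_i)
    (fun i => [:: c *: (gconj (gmul (kx X 1) u) - kx X 0);
                  c *: (kx X 1 + gconj (gmul u (kx X 0)));
                  (t + s) *: u - kx X 2]`_i).

Lemma jext3 (X Y : JK) :
  [/\ kxi X 0 = kxi Y 0, kxi X 1 = kxi Y 1 & kxi X 2 = kxi Y 2] ->
  [/\ kx X 0 = kx Y 0, kx X 1 = kx Y 1 & kx X 2 = kx Y 2] -> X = Y.
Proof.
by move=> [h0 h1 h2] [k0 k1 k2]; apply: kext; elim/I3P.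
Qed.

Lemma jreflect_xi X :
  [/\ kxi (jreflect X) 0 = (kxi X 0 + kxi X 1) / 2 + gip (kx X 2) u,
      kxi (jreflect X) 1 = (kxi X 0 + kxi X 1) / 2 - gip (kx X 2) u &
      kxi (jreflect X) 2 = kxi X 2].
Proof. by rewrite !kpair_xi. Qed.

Lemma jreflect_x X :
  [/\ kx (jreflect X) 0 = c *: (gconj (gmul (kx X 1) u) - kx X 0),
      kx (jreflect X) 1 = c *: (kx X 1 + gconj (gmul u (kx X 0))) &
      kx (jreflect X) 2 = ((kxi X 0 - kxi X 1) / 2 + gip (kx X 2) u) *: u - kx X 2].
Proof. by rewrite !kpair_x. Qed.

Lemma jreflect_linear : linear jreflect.
Proof.
move=> a X Y; have [x0 x1 x2] := jreflect_xi X; have [y0 y1 y2] := jreflect_xi Y.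
have [z0 z1 z2] := jreflect_xi (a *: X + Y).
have [X0 X1 X2] := jreflect_x X; have [Y0 Y1 Y2] := jreflect_x Y.
have [Z0 Z1 Z2] := jreflect_x (a *: X + Y).
apply: jext3; split; rewrite ?kxiD ?kxiZ ?kxD ?kxZ.
- by rewrite z0 x0 y0 !(kxiD, kxiZ, kxD, kxZ, gipDl, gipZl); ring.
- by rewrite z1 x1 y1 !(kxiD, kxiZ, kxD, kxZ, gipDl, gipZl); ring.
- by rewrite z2 x2 y2 kxiD kxiZ.
- rewrite Z0 X0 Y0 !(kxiD, kxiZ, kxD, kxZ) !(gmulDl, gmulZl, gconjD, gconjZ).
  by move: (gconj _) (gconj _) (kx X 0) (kx Y 0) => ? ? ? ?; apply/rowP => k; rewrite !mxE; ring.
- rewrite Z1 X1 Y1 !(kxiD, kxiZ, kxD, kxZ) !(gmulDr, gmulZr, gconjD, gconjZ).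
  by move: (gconj _) (gconj _) (kx X 1) (kx Y 1) => ? ? ? ?; apply/rowP => k; rewrite !mxE; ring.
- rewrite Z2 X2 Y2 !(kxiD, kxiZ, kxD, kxZ, gipDl, gipZl).
  move: (kx X 2) (kx Y 2) (gip _ _) (gip _ _) (kxi X 0) (kxi X 1) (kxi Y 0) (kxi Y 1) => *.
  by apply/rowP => k; rewrite !mxE; ring.
Qed.

Lemma jreflectK X : jreflect (jreflect X) = X.
Proof.
have [x0 x1 x2] := jreflect_xi X; have [y0 y1 y2] := jreflect_xi (jreflect X).
have [X0 X1 X2] := jreflect_x X; have [Y0 Y1 Y2] := jreflect_x (jreflect X).
have gipNl (v w : O) : gip (- v) w = - gip v w by rewrite -scaleN1r gipZl mulN1r.
have s' : gip (kx (jreflect X) 2) u = (kxi X 0 - kxi X 1) / 2.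
  by rewrite X2 gipDl gipZl uu gipNl; ring.
apply: jext3; split.
- by rewrite y0 s' x0 x1; field.
- by rewrite y1 s' x0 x1; field.
- by rewrite y2 x2.
- rewrite Y0 X0 X1 gmulZl gmulDl gconjZ gconjD [gconj (gmul u _)]gconjM gmulVKr uu scale1r gconjK.
  move: (gconj _) (kx X 0) => a b.
  apply/rowP => k; rewrite !mxE; move: (a 0 k) (b 0 k) => a' b'.
  transitivity ((c * c) * (2 * b')); first by ring.
  by rewrite cc mulrA mulVf ?mul1r// pnatr_eq0.
- rewrite Y1 X0 X1 gmulZr gmulDr gconjZ gconjD [gconj (gmul _ u)]gconjM gmulVKl uu scale1r gconjK.
  have -> : gmul u (- kx X 0) = - gmul u (kx X 0) by rewrite -scaleN1r gmulZr scaleN1r.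
  have -> : gconj (- gmul u (kx X 0)) = - gconj (gmul u (kx X 0)) by rewrite -scaleN1r gconjZ scaleN1r.
  move: (gconj _) (kx X 1) => a b.
  apply/rowP => k; rewrite !mxE; move: (a 0 k) (b 0 k) => a' b'.
  transitivity ((c * c) * (2 * b')); first by ring.
  by rewrite cc mulrA mulVf ?mul1r// pnatr_eq0.
- rewrite Y2 s' x0 x1 X2.
  move: (kx X 2) (gip _ _) (kxi X 0) (kxi X 1) => b s p q.
  by apply/rowP => k; rewrite !mxE; field.
Qed.

Lemma kmul_sq3_xi (X : JK) :
  [/\ kxi (kmul X X) 0 = kxi X 0 ^+ 2 + gip (kx X 1) (kx X 1) + gip (kx X 2) (kx X 2),
      kxi (kmul X X) 1 = kxi X 1 ^+ 2 + gip (kx X 2) (kx X 2) + gip (kx X 0) (kx X 0) &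
      kxi (kmul X X) 2 = kxi X 2 ^+ 2 + gip (kx X 0) (kx X 0) + gip (kx X 1) (kx X 1)].
Proof. by rewrite !kpair_xi !expr2; split; congr (_ + gip (kx X _) (kx X _) + gip (kx X _) (kx X _)); apply/eqP. Qed.

Lemma kmul_sq3_x (X : JK) :
  [/\ kx (kmul X X) 0 = (kxi X 1 + kxi X 2) *: kx X 0 + gconj (gmul (kx X 1) (kx X 2)),
      kx (kmul X X) 1 = (kxi X 2 + kxi X 0) *: kx X 1 + gconj (gmul (kx X 2) (kx X 0)) &
      kx (kmul X X) 2 = (kxi X 0 + kxi X 1) *: kx X 2 + gconj (gmul (kx X 0) (kx X 1))].
Proof.
by rewrite !kmul_sq_x; split; congr ((kxi X _ + kxi X _) *: _ + gconj (gmul (kx X _) (kx X _))); apply/eqP.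
Qed.

Let gipNl (v w : O) : gip (- v) w = - gip v w.
Proof. by rewrite -scaleN1r gipZl mulN1r. Qed.
Let gipNr (v w : O) : gip w (- v) = - gip w v.
Proof. by rewrite gipC gipNl gipC. Qed.
Let gmulNl (v w : O) : gmul (- v) w = - gmul v w.
Proof. by rewrite -scaleN1r gmulZl scaleN1r. Qed.
Let gmulNr (v w : O) : gmul w (- v) = - gmul w v.
Proof. by rewrite -scaleN1r gmulZr scaleN1r. Qed.
Let gconjN (v : O) : gconj (- v) = - gconj v.
Proof. by rewrite -scaleN1r gconjZ scaleN1r. Qed.

(** The entries [x_0] and [x_1] reduce to [gmul_polar] and the entry [x_2] to
    [moufang] and [gmul_sandwich]. *)
Lemma jreflect_sq X : kmul (jreflect X) (jreflect X) = jreflect (kmul X X).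
Proof.
have [x0 x1 x2] := jreflect_xi X; have [X0 X1 X2] := jreflect_x X.
have [y0 y1 y2] := jreflect_xi (kmul X X); have [Y0 Y1 Y2] := jreflect_x (kmul X X).
have [s0 s1 s2] := kmul_sq3_xi X; have [S0 S1 S2] := kmul_sq3_x X.
have [r0 r1 r2] := kmul_sq3_xi (jreflect X); have [R0 R1 R2] := kmul_sq3_x (jreflect X).
apply: jext3; rewrite ?r0 ?r1 ?r2 ?R0 ?R1 ?R2 ?y0 ?y1 ?y2 ?Y0 ?Y1 ?Y2.
  rewrite ?x0 ?x1 ?x2 ?X0 ?X1 ?X2 ?s0 ?s1 ?s2 ?S0 ?S1 ?S2.
  move: (kxi X 0) (kxi X 1) (kxi X 2) (kx X 0) (kx X 1) (kx X 2) => p q r x y z.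
  have tau1 : gip y (gconj (gmul u x)) = gip u (gconj (gmul x y)).
    by rewrite gipC gtri gipC.
  have tau2 : gip (gconj (gmul y u)) x = gip u (gconj (gmul x y)).
    by rewrite gtri -tau1 gipC.
  have nx : gip (c *: (gconj (gmul y u) - x)) (c *: (gconj (gmul y u) - x)) =
      2^-1 * (gip y y + gip x x - 2 * gip u (gconj (gmul x y))).
    rewrite gipZl gipZr mulrA cc !(gipDl, gipDr, gipNl, gipNr) gip_conj gip_gmul uu.
    by rewrite [gip x (gconj _)]gipC tau2; ring.
  have ny : gip (c *: (y + gconj (gmul u x))) (c *: (y + gconj (gmul u x))) =
      2^-1 * (gip y y + gip x x + 2 * gip u (gconj (gmul x y))).
    rewrite gipZl gipZr mulrA cc !(gipDl, gipDr) gip_conj gip_gmul uu.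
    by rewrite [gip (gconj _) y]gipC tau1; ring.
  have nz T : gip (T *: u - z) (T *: u - z) = T ^+ 2 - 2 * T * gip z u + gip z z.
    by rewrite !(gipDl, gipDr, gipNl, gipNr, gipZl, gipZr) uu (gipC u z); ring.
  rewrite nx ny nz gipDl gipZl [gip (gconj _) u]gipC.
  move: (gip y y) (gip x x) (gip z z) (gip z u) (gip u _) => *.
  by split; field.
rewrite ?x0 ?x1 ?x2 ?X0 ?X1 ?X2 ?s0 ?s1 ?s2 ?S0 ?S1 ?S2.
move: (kxi X 0) (kxi X 1) (kxi X 2) (kx X 0) (kx X 1) (kx X 2) => p q r x y z.
clear -uu cc gipNl gipNr gmulNl gmulNr gconjN; split.
- rewrite !(gmulDl, gmulDr, gmulZl, gmulZr, gmulNl, gmulNr, gconjD, gconjZ, gconjN).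
  rewrite [gconj (gmul (gconj (gmul u x)) u)]gconjM [gconj (gmul (gconj (gmul u x)) z)]gconjM.
  rewrite [gconj (gmul (gconj (gmul z x)) u)]gconjM !gconjK gmulKl uu scale1r.
  have -> : gmul (gconj u) (gmul z x) = (2 * gip z u) *: x - gmul (gconj z) (gmul u x).
    by rewrite -gmul_polar addrAC subrr add0r.
  move: (gmul (gconj z) _) (gconj (gmul y u)) (gconj (gmul y z)) (gip z u) => A B C s.
  by apply/rowP => k; rewrite !mxE; field.
- rewrite !(gmulDl, gmulDr, gmulZl, gmulZr, gmulNl, gmulNr, gconjD, gconjZ, gconjN).
  rewrite [gconj (gmul u (gconj (gmul y u)))]gconjM [gconj (gmul z (gconj (gmul y u)))]gconjM.
  rewrite [gconj (gmul u (gconj (gmul y z)))]gconjM !gconjK gmulKr uu scale1r.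
  have -> : gmul (gmul y z) (gconj u) = (2 * gip z u) *: y - gmul (gmul y u) (gconj z).
    apply: (can_inj gconjK); rewrite gconjD gconjN gconjZ !gconjM !gconjK.
    have := gmul_polar (gconj z) (gconj u) (gconj y); rewrite !gconjK gip_conj => <-.
    by rewrite addrAC subrr add0r.
  move: (gmul _ (gconj z)) (gconj (gmul u x)) (gconj (gmul z x)) (gip z u) => A B C s.
  by apply/rowP => k; rewrite !mxE; field.
- rewrite gmulZl gmulZr gconjZ gconjZ scalerA cc.
  rewrite !(gmulDl, gmulDr, gmulNl, gmulNr, gconjD, gconjN).
  have -> : gconj (gmul (gconj (gmul y u)) y) = gip y y *: u.
    by rewrite gconjM gconjK gmulKl.
  have -> : gconj (gmul x (gconj (gmul u x))) = gip x x *: u.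
    by rewrite gconjM gconjK gmulKr.
  have -> : gconj (gmul (gconj (gmul y u)) (gconj (gmul u x))) =
      (2 * gip u (gconj (gmul x y))) *: u - gconj (gmul x y).
    rewrite -gmul_sandwich uu scale1r addrK gconjM !gconjK moufang //.
  rewrite gipDl gipZl [gip (gconj _) u]gipC.
  move: (gconj _) (gip x x) (gip y y) (gip z u) (gip z z) (gip u _) => w b d e f a.
  by apply/rowP => k; rewrite !mxE; field.
Qed.

Lemma jaut_reflect : jaut jreflect jreflect.
Proof.
split; [exact: jreflect_linear|exact: jreflect_linear|exact: jreflectK|exact: jreflectK|].
exact: jreflect_sq.
Qed.

End Reflection.
End Automorphisms.

Section Transitivity.
Context {R : realType}.
Local Notation J := (jordan R).

Lemma gip_delta (x : octo R) a : gip x (delta_mx 0 a) = x 0 a.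
Proof.
rewrite /gip (bigD1 a) //= mxE !eqxx mulr1 big1 ?addr0// => i /negPf ia.
by rewrite mxE ia andbF mulr0.
Qed.

(** A nonzero diagonal entry is shifted to the first place.  If the diagonal
    vanishes, some [x_i] with a nonzero coordinate [a] is shifted to [x_2], and
    the reflection with [u = e_a] brings that coordinate to the diagonal. *)
Lemma exists_jaut (X : J) : X <> 0 -> exists g gi, jaut g gi /\ kxi (g X) 0 <> 0.
Proof.
move=> X0; have [[i Xi]|Xi] := pselect (exists i, kxi X i <> 0).
  exists (jshift i), (jshift (- i)); split; first exact: jaut_shift.
  by rewrite kpair_xi add0r.
have {}Xi i : kxi X i = 0 by apply: contrapT => h; apply: Xi; exists i.
have [[i [a xa]]|x0] := pselect (exists i a, kx X i 0 a <> 0); last first.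
  case: X0; apply: kext => i; first by rewrite Xi /kxi mxE.
  apply/rowP => a; rewrite [RHS](_ : _ = 0); last by rewrite /kx !mxE.
  by apply: contrapT => h; apply: x0; exists i, a.
have uu : gip (delta_mx 0 a : octo R) (delta_mx 0 a) = 1 by rewrite gip_delta mxE !eqxx.
have cc : (Num.sqrt (2^-1 : R)) * Num.sqrt 2^-1 = 2^-1.
  by rewrite -expr2 sqr_sqrtr// invr_ge0.
exists (jreflect (delta_mx 0 a) (Num.sqrt 2^-1) \o jshift (i - 2)),
       (jshift (- (i - 2)) \o jreflect (delta_mx 0 a) (Num.sqrt 2^-1)).
split; first by apply: jaut_comp; [exact: jaut_reflect|exact: jaut_shift].
rewrite /=; have [-> _ _] := jreflect_xi (delta_mx 0 a) (Num.sqrt 2^-1) (jshift (i - 2) X).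
by rewrite !kpair_xi kpair_x !Xi addr0 mul0r add0r gip_delta addrC subrK.
Qed.
End Transitivity.

(** * The real algebra and its complexification *)

Section RealJordan.
Context {R : realType}.
Local Notation J := (jordan R).
Implicit Types X Y Z : J.

Lemma I3num : (0 + 1 = 1 :> 'I_3) * (0 + 2 = 2 :> 'I_3) * (1 + 1 = 2 :> 'I_3) *
  (1 + 2 = 0 :> 'I_3) * (2 + 1 = 0 :> 'I_3) * (2 + 2 = 1 :> 'I_3).
Proof. by do !split; apply/eqP. Qed.

Lemma row_mx_oct8 (a b : quat R) : row_mx a b =
  oct8 (a 0 0) (a 0 1) (a 0 2) (a 0 3) (b 0 0) (b 0 1) (b 0 2) (b 0 3).
Proof.
apply/rowP => i; case: (split_ordP i) => j ->.
  by rewrite row_mxEl mxE; elim/I4P: j.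
by rewrite row_mxEr mxE; elim/I4P: j.
Qed.

Lemma omulE (x y : octo R) : omul x y = gmul x y.
Proof.
rewrite -[x]hsubmxK -[y]hsubmxK; move: (lsubmx x) (rsubmx x) (lsubmx y) (rsubmx y).
move=> a b h k; rewrite /omul !row_mxKl !row_mxKr !row_mx_oct8 oct8M.
by f_equal; rewrite !mxE /= ?mxE /=; ring.
Qed.

Lemma omul_real r (x : octo R) : gmul (oreal r) x = r *: x.
Proof.
have -> : oreal r = oct8 r 0 0 0 0 0 0 0 by apply: oext; split; rewrite !mxE.
have := octP x; do 8![case=> ?] => ->; rewrite !octE; f_equal; ring.
Qed.
Lemma omul_realr r (x : octo R) : gmul x (oreal r) = r *: x.
Proof.
have -> : oreal r = oct8 r 0 0 0 0 0 0 0 by apply: oext; split; rewrite !mxE.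
have := octP x; do 8![case=> ?] => ->; rewrite !octE; f_equal; ring.
Qed.

Lemma omul_re (x y : octo R) : gmul x y 0 0 = gip (gconj x) y.
Proof. by rewrite -omulE -{1}(oconjK y) Defs.omul_re -gip_conj gconjK. Qed.

Lemma jmx_diag X i : jmx X i i = oreal (kxi X i).
Proof. by rewrite mxE; elim/I3P: i. Qed.
Lemma jmx_up X i : jmx X i (i + 1) = kx X (i + 2).
Proof.
rewrite mxE; elim/I3P: i => /=; congr (kx X _); exact/eqP.
Qed.
Lemma jmx_down X i : jmx X (i + 1) i = gconj (kx X (i + 2)).
Proof. by rewrite -jmx_up -oconj_jmx. Qed.

Lemma jmulE X Y : jmul X Y = kmul X Y.
Proof.
have sumO (F : 'I_3 -> octo R) i : \sum_j F j = F i + F (i + 1) + F (i + 2).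
  by apply/rowP => a; rewrite summxE (sum3 _ i) !mxE.
have omE : @omul R = gmul by apply/funext => x; apply/funext => y; exact: omulE.
have u Z i : jmx Z i (i + 2) = gconj (kx Z (i + 1)).
  by have [_ _ e3 e4] := I3add i; rewrite -[X in jmx Z X _]e3 jmx_down e4.
have u' Z i : jmx Z (i + 2) i = kx Z (i + 1).
  by have [_ _ e3 e4] := I3add i; rewrite -[X in jmx Z _ X]e3 jmx_up e4.
have v Z i : jmx Z (i + 1) (i + 2) = kx Z i.
  by have [e1 _ e3 _] := I3add i; rewrite -e1 jmx_up [_ + 1 + 2]addrAC e3.
apply: kext => i; rewrite [RHS](kpair_xi, kpair_x).
  have -> : kxi (jmul X Y) i =
     2^-1 * ((\sum_j gmul (jmx X i j) (jmx Y j i)) 0 0 + (\sum_j gmul (jmx Y i j) (jmx X j i)) 0 0).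
    by rewrite /kxi /jmul !mxE omE.
  rewrite !(sumO _ i) !jmx_diag !jmx_up !jmx_down !u !u'.
  have addE (p q : octo R) : (p + q) 0 0 = p 0 0 + q 0 0 by rewrite mxE.
  have reE (p q : R) : (p *: oreal q) 0 0 = p * q by rewrite !mxE.
  rewrite !omul_real !addE !omul_re !reE !gconjK !gip_conj.
  rewrite ![gip (kx Y _) (kx X _)]gipC.
  move: (gip _ _) (gip _ _) => ? ?; by field.
have -> : kx (jmul X Y) i =
     2^-1 *: (\sum_j gmul (jmx X (i + 1) j) (jmx Y j (i + 2)) +
              \sum_j gmul (jmx Y (i + 1) j) (jmx X j (i + 2))).
  apply/rowP => a; rewrite /kx -omE.
  elim/I3P: i; rewrite !mxE /= ?I3num //.
rewrite !(sumO _ i) !jmx_down !jmx_diag.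
rewrite !u !v !omul_real !omul_realr -!gconjM gconjD.
move: (gconj _) (gconj _) => w w'; move: (kx X i) (kx Y i) => x y.
by congr (_ *: _); apply/rowP => a; rewrite !mxE; ring.
Qed.
End RealJordan.

Section ScalarExtension.
Context {K L : numFieldType} (f : {rmorphism K -> L}).
Local Notation JK := ('rV[K]_3 * 'M[K]_(3, 4 + 4))%type.

Definition kmap (X : JK) : 'rV[L]_3 * 'M[L]_(3, 4 + 4) := (map_mx f X.1, map_mx f X.2).

Lemma kmap_xi X i : kxi (kmap X) i = f (kxi X i).
Proof. by rewrite /kxi mxE. Qed.
Lemma kmap_x X i : kx (kmap X) i = map_mx f (kx X i).
Proof. by apply/rowP => a; rewrite /kx !mxE. Qed.

Lemma map_oct8 (a0 a1 a2 a3 a4 a5 a6 a7 : K) :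
  map_mx f (oct8 a0 a1 a2 a3 a4 a5 a6 a7) =
  oct8 (f a0) (f a1) (f a2) (f a3) (f a4) (f a5) (f a6) (f a7).
Proof. by apply: oext; split; rewrite !mxE. Qed.

Lemma map_gmul (x y : 'rV[K]_(4 + 4)) :
  map_mx f (gmul x y) = gmul (map_mx f x) (map_mx f y).
Proof.
have := octP x; do 8![case=> ?] => ->; have := octP y; do 8![case=> ?] => ->.
by rewrite oct8M !map_oct8 oct8M; congr oct8; rewrite !(rmorphB, rmorphD, rmorphM, rmorphN).
Qed.

Lemma map_gconj (x : 'rV[K]_(4 + 4)) : map_mx f (gconj x) = gconj (map_mx f x).
Proof. by apply/rowP => i; rewrite !mxE; case: ifP; rewrite ?rmorphN. Qed.

Lemma map_gip (x y : 'rV[K]_(4 + 4)) : f (gip x y) = gip (map_mx f x) (map_mx f y).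
Proof. by rewrite rmorph_sum; apply: eq_bigr => i _; rewrite !mxE rmorphM. Qed.

Lemma kmap_kmul X Y : kmap (kmul X Y) = kmul (kmap X) (kmap Y).
Proof.
apply: kext => i.
  by rewrite kmap_xi !kpair_xi !kmap_xi !kmap_x !rmorphD rmorphM !map_gip.
rewrite kmap_x !kpair_x !kmap_x !kmap_xi map_mxZ fmorphV rmorph_nat.
by rewrite !map_mxD !map_mxZ map_gconj !map_mxD !map_gmul !rmorphD.
Qed.

End ScalarExtension.

Section ComplexJordan.
Context {R : realType}.
Local Notation J := (jordan R).
Local Notation JC := (J * J)%type.
Local Notation C := R[i].

(** [A.1 + i A.2] with entries in R[i], so that what holds over any field
    applies to the complexified algebra. *)
Definition emb (A : JC) : 'rV[C]_3 * 'M[C]_(3, 4 + 4) :=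
  kmap (real_complex R) A.1 + 'i%C *: kmap (real_complex R) A.2.

Lemma emb_xi A i : kxi (emb A) i = (kxi A.1 i +i* kxi A.2 i)%C.
Proof. by rewrite /emb kxiD kxiZ !kmap_xi [RHS]complexE. Qed.

Lemma emb_x A i a : kx (emb A) i 0 a = (kx A.1 i 0 a +i* kx A.2 i 0 a)%C.
Proof. by rewrite /emb kxD kxZ !kmap_x [RHS]complexE !mxE. Qed.

Lemma emb_inj : injective emb.
Proof.
move=> A B AB.
have h1 i : kxi A.1 i = kxi B.1 i /\ kxi A.2 i = kxi B.2 i.
  have := congr1 (kxi ^~ i) AB; rewrite !emb_xi => /eqP.
  by rewrite eq_complex /= => /andP[/eqP-> /eqP->].
have h2 i a : kx A.1 i 0 a = kx B.1 i 0 a /\ kx A.2 i 0 a = kx B.2 i 0 a.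
  have := congr1 (fun X => kx X i 0 a) AB; rewrite !emb_x => /eqP.
  by rewrite eq_complex /= => /andP[/eqP-> /eqP->].
case: A B {AB} h1 h2 => [a1 a2] [b1 b2] /= h1 h2; congr (_, _); apply: kext => i.
- by have [] := h1 i.
- by apply/rowP => a; have [] := h2 i a.
- by have [] := h1 i.
- by apply/rowP => a; have [] := h2 i a.
Qed.

Lemma emb_jmulC (A B : JC) : emb (jmulC A B) = kmul (emb A) (emb B).
Proof.
have kmapD (X Y : J) : kmap (real_complex R) (X + Y) = kmap (real_complex R) X + kmap (real_complex R) Y.
  by congr (_, _); exact: map_mxD.
have kmapN (X : J) : kmap (real_complex R) (- X) = - kmap (real_complex R) X.
  by congr (_, _); exact: map_mxN.
have key (a b c d : 'rV[C]_3 * 'M[C]_(3, 4 + 4)) :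
    a - d + 'i%C *: (b + c) = a + 'i%C *: b + ('i%C *: c + 'i%C *: ('i%C *: d)).
  rewrite scalerA -expr2 sqr_i scaleN1r scalerDr -!addrA; congr (_ + _).
  by rewrite addrC -addrA.
rewrite /emb /jmulC /bilinC /= !jmulE.
rewrite !(kmulDl, kmulDr, kmulZl, kmulZr) -!kmap_kmul !(kmapD, kmapN).
exact: key.
Qed.

Lemma emb0 : emb 0 = 0.
Proof.
apply: kext => i; first by rewrite emb_xi /kxi !mxE.
by apply/rowP => a; rewrite emb_x /kx !mxE.
Qed.

Lemma ktr_emb A : ktr (emb A) = (jtr A.1 +i* jtr A.2)%C.
Proof.
rewrite /ktr [RHS]complexE /jtr !rmorph_sum /= mulr_sumr -big_split /=.
by apply: eq_bigr => i _; rewrite emb_xi [LHS]complexE.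
Qed.

Lemma EO_tr (A : JC) : jmulC A A = 0 -> jtr A.1 = 0 /\ jtr A.2 = 0.
Proof.
move=> A0; have := @kmul_sq0_tr _ (emb A); rewrite -emb_jmulC A0 emb0 => /(_ erefl).
by rewrite ktr_emb => -[-> ->].
Qed.

End ComplexJordan.

(** * Maps of class C^n on open sets *)

Section Calculus.
Context {R : realType}.
Implicit Types V W U : normedModType R.

Lemma near_eq_is_diff V W (f g df : V -> W) (x : V) :
  (\forall y \near x, f y = g y) -> is_diff x f df -> is_diff x g df.
Proof.
move=> fg [dfx <-].
have gx : g x = f x by rewrite (nbhs_singleton fg).
have H : g \o shift x = cst (g x) + 'd f x +o_ 0 id.
  apply/eqaddoP => e e0; have /eqaddoP/(_ e e0) := diff_locally dfx.
  apply: filter_app; rewrite gx.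
  have : \forall y \near (0 : V), f (y + x) = g (y + x).
    by have := fg; rewrite (near_shift 0) subr0.
  by apply: filterS => y /= + /=; rewrite !fctE /= => ->.
have dE : 'd g x = 'd f x :> (V -> W) by exact: diff_unique (diff_continuous dfx) H.
by split=> //; apply/diff_locallyP; rewrite dE; split=> //; exact: diff_continuous.
Qed.

(** It allows a derivative to be replaced on the open set [U] by the formula
    that computes it there. *)
Lemma Ck_eq V W n (U : set V) (f g : V -> W) : open U ->
  (forall x, U x -> f x = g x) -> Ck n U f -> Ck n U g.
Proof.
move=> oU; elim: n f g => [|n IH] f g fg /=.
  move=> fc x Ux; have := fc x Ux; rewrite /prop_for /continuous_at -(fg _ Ux).
  move=> fl; apply: cvg_trans fl; apply: near_eq_cvg.
  by near=> y; apply: fg; near: y; exact: open_nbhs_nbhs.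
move=> [fd fD]; have nfg x : U x -> \forall y \near x, f y = g y.
  by move=> Ux; near=> y; apply: fg; near: y; exact: open_nbhs_nbhs.
split=> [x Ux|v].
  by have [] := near_eq_is_diff (nfg _ Ux) (differentiableP (fd _ Ux)).
by apply: IH (fD v) => x Ux; exact: near_eq_derive (nfg _ Ux).
Unshelve. all: by end_near. Qed.

Lemma Ck_pred V W n (U : set V) (f : V -> W) : Ck n.+1 U f -> Ck n U f.
Proof.
elim: n f => [|n IH] f /= [fd fD]; last by split=> // v; exact: IH (fD v).
by move=> x Ux; apply: differentiable_continuous (fd x Ux).
Qed.

Lemma is_diff_bilin V W1 W2 W (B : W1 -> W2 -> W) :
  (forall z, linear (B ^~ z)) -> (forall z, linear (B z)) ->
  continuous (fun p : W1 * W2 => B p.1 p.2) ->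
  forall (f : V -> W1) (g : V -> W2) x df dg, is_diff x f df -> is_diff x g dg ->
  is_diff x (fun y => B (f y) (g y)) (fun h => B (f x) (dg h) + B (df h) (g x)).
Proof.
move=> Bl Br Bc f g x df dg fd gd.
have Bb : bilinear_for (GRing.Scale.Law.clone _ _ *:%R _) (GRing.Scale.Law.clone _ _ *:%R _) B.
  by split=> z a u v /=; rewrite ?Bl ?Br.
pose BM := bilinear_isBilinear.Build R W1 W2 W _ _ B Bb.
pose BL : {bilinear W1 -> W2 -> W} := HB.pack B BM.
have BLd : is_diff (f x, g x) (fun p => BL p.1 p.2)
    (fun q => BL (f x) q.2 + BL q.1 (g x)).
  by split; [exact: differentiable_bilin|exact: diff_bilin].
have pd := is_diff_pair fd gd.
exact: (@is_diff_comp _ _ _ _ _ _ _ _ _ pd BLd).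
Qed.

Lemma is_diff_linear V W (L : V -> W) x : linear L -> continuous L -> is_diff x L L.
Proof.
move=> Ll Lc; pose LM := GRing.isLinear.Build _ _ _ _ _ Ll.
pose LL : {linear V -> W} := HB.pack L LM.
by split; [exact: (@linear_differentiable _ _ _ LL)|exact: (@diff_lin _ _ _ LL)].
Qed.

Lemma is_diff_deriveE V W (f df : V -> W) x v : is_diff x f df -> 'D_v f x = df v.
Proof. by move=> [fd fE]; rewrite deriveE// fE. Qed.

Lemma Ck_cst V W n (U : set V) (w : W) : Ck n U (cst w).
Proof.
elim: n w => [|n IH] w /=; first by move=> x _; exact: cst_continuous.
split=> [x _|v]; first exact: differentiable_cst.
by have -> : 'D_v (cst w) = cst 0 :> (V -> W) by apply/funext => x; rewrite derive_cst.
Qed.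

Lemma Ck_linear V W n (U : set V) (L : V -> W) : linear L -> continuous L -> Ck n U L.
Proof.
move=> Ll Lc; case: n => [|n] /=; first by move=> x _; exact: Lc.
split=> [x _|v]; first by have [] := is_diff_linear x Ll Lc.
have -> : 'D_v L = cst (L v) by apply/funext => x; rewrite (is_diff_deriveE _ (is_diff_linear x Ll Lc)).
exact: Ck_cst.
Qed.

Lemma Ck_id V n (U : set V) : Ck n U (id : V -> V).
Proof. by apply: Ck_linear => // x; exact: cvg_id. Qed.

Lemma CkD V W n (U : set V) (f g : V -> W) : open U ->
  Ck n U f -> Ck n U g -> Ck n U (f \+ g).
Proof.
move=> oU; elim: n f g => [|n IH] f g /=.
  by move=> fc gc x Ux; apply: continuousD; [exact: fc|exact: gc].
move=> [fd fD] [gd gD]; split=> [x Ux|v].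
  by apply: differentiableD; [exact: fd|exact: gd].
apply: (Ck_eq oU) (IH _ _ (fD v) (gD v)) => x Ux /=.
by rewrite deriveD//; apply: diff_derivable; [exact: fd|exact: gd].
Qed.

Lemma Ck_complin V W W' n (U : set V) (f : V -> W) (L : W -> W') : open U ->
  linear L -> continuous L -> Ck n U f -> Ck n U (L \o f).
Proof.
move=> oU Ll Lc; elim: n f => [|n IH] f /=.
  by move=> fc x Ux; apply: continuous_comp; [exact: fc|exact: Lc].
move=> [fd fD]; have Ld x : U x -> is_diff x (L \o f) (L \o 'd f x).
  move=> Ux; have fxd := differentiableP (fd x Ux).
  exact: (@is_diff_comp _ _ _ _ _ _ _ _ _ fxd (is_diff_linear (f x) Ll Lc)).
split=> [x Ux|v]; first by have [] := Ld x Ux.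
apply: (Ck_eq oU) (IH _ (fD v)) => x Ux /=.
by rewrite (is_diff_deriveE _ (Ld x Ux)) /= deriveE//; exact: fd.
Qed.

Lemma Ck_bilin V W1 W2 W (B : W1 -> W2 -> W) :
  (forall z, linear (B ^~ z)) -> (forall z, linear (B z)) ->
  continuous (fun p : W1 * W2 => B p.1 p.2) ->
  forall n (U : set V) (f : V -> W1) (g : V -> W2), open U ->
  Ck n U f -> Ck n U g -> Ck n U (fun y => B (f y) (g y)).
Proof.
move=> Bl Br Bc n U f g oU; elim: n f g => [|n IH] f g.
  move=> /= fc gc x Ux.
  apply: (@continuous_comp _ _ _ (fun y => (f y, g y)) (fun p => B p.1 p.2)); last exact: Bc.
  by apply: cvg_pair; [exact: fc|exact: gc].
move=> Cf Cg; have [fd fD] := Cf; have [gd gD] := Cg.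
have Bd x : U x -> is_diff x (fun y => B (f y) (g y))
    (fun h => B (f x) ('d g x h) + B ('d f x h) (g x)).
  by move=> Ux; apply: is_diff_bilin => //; apply: differentiableP; [exact: fd|exact: gd].
split=> [x Ux|v]; first by have [] := Bd x Ux.
apply: (Ck_eq oU) (CkD oU (IH _ _ (Ck_pred Cf) (gD v)) (IH _ _ (fD v) (Ck_pred Cg))) => x Ux /=.
by rewrite (is_diff_deriveE _ (Bd x Ux)) !deriveE//; [exact: fd|exact: gd].
Qed.

Lemma Ck_fst V W1 W2 n (U : set V) (f : V -> W1 * W2) : open U -> Ck n U f ->
  Ck n U (fun x => (f x).1).
Proof. by move=> oU; apply: (@Ck_complin _ _ _ _ _ f fst) => // x; exact: cvg_fst. Qed.

Lemma Ck_snd V W1 W2 n (U : set V) (f : V -> W1 * W2) : open U -> Ck n U f ->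
  Ck n U (fun x => (f x).2).
Proof. by move=> oU; apply: (@Ck_complin _ _ _ _ _ f snd) => // x; exact: cvg_snd. Qed.

Lemma Ck_pair V W1 W2 n (U : set V) (f : V -> W1) (g : V -> W2) : open U ->
  Ck n U f -> Ck n U g -> Ck n U (fun x => (f x, g x)).
Proof.
move=> oU fn gn.
have l1 : linear (fun x : W1 => (x, 0 : W2)).
  by move=> a x y; congr (_, _); rewrite /= ?scaler0 ?addr0.
have l2 : linear (fun x : W2 => (0 : W1, x)).
  by move=> a x y; congr (_, _); rewrite /= ?scaler0 ?addr0.
have c1 : continuous (fun x : W1 => (x, 0 : W2)).
  by move=> x; apply: cvg_pair; [exact: cvg_id|exact: cvg_cst].
have c2 : continuous (fun x : W2 => (0 : W1, x)).
  by move=> x; apply: cvg_pair; [exact: cvg_cst|exact: cvg_id].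
apply: (Ck_eq oU) (CkD oU (Ck_complin oU l1 c1 fn) (Ck_complin oU l2 c2 gn)) => x _.
by congr (_, _) => /=; rewrite ?addr0 ?add0r.
Qed.

Lemma Ck_sum V W n (U : set V) I (r : seq I) (F : I -> V -> W) : open U ->
  (forall i, Ck n U (F i)) -> Ck n U (fun x => \sum_(i <- r) F i x).
Proof.
move=> oU Fn; elim: r => [|i r IH].
  by apply: (Ck_eq oU) (@Ck_cst _ _ n U 0) => x _; rewrite big_nil.
by apply: (Ck_eq oU) (CkD oU (Fn i) IH) => x _; rewrite big_cons.
Qed.

Lemma Ck_coord V n (U : set V) m k (f : V -> 'M[R]_(m, k)) i j : open U ->
  Ck n U f -> Ck n U (fun x => f x i j).
Proof.
move=> oU; apply: (@Ck_complin _ _ R _ _ f (fun M : 'M[R]_(m, k) => M i j)) => //.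
  by move=> a x y; rewrite !mxE.
exact: coord_continuous.
Qed.

Lemma CkZ V W n (U : set V) (f : V -> R) (g : V -> W) : open U ->
  Ck n U f -> Ck n U g -> Ck n U (fun x => f x *: g x).
Proof.
apply: Ck_bilin => [z a x y|z a x y|].
- by rewrite scalerDl scalerA.
- by rewrite scalerDr !scalerA mulrC.
- exact: scale_continuous.
Qed.

Lemma CkM V n (U : set V) (f g : V -> R) : open U ->
  Ck n U f -> Ck n U g -> Ck n U (fun x => f x * g x).
Proof. exact: (@CkZ V R). Qed.

Lemma CkN V W n (U : set V) (f : V -> W) : open U ->
  Ck n U f -> Ck n U (fun x => - f x).
Proof.
move=> oU fn; apply: (Ck_eq oU) (CkZ oU (@Ck_cst V R n U (-1)) fn) => x _.
by rewrite scaleN1r.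
Qed.

(** The derivative of [1 / f] involves [1 / f] itself, one order lower, so the
    induction hypothesis and the product rule apply. *)
Lemma Ck_inv V n (U : set V) (f : V -> R) : open U -> (forall x, U x -> f x != 0) ->
  Ck n U f -> Ck n U (fun x => (f x)^-1).
Proof.
move=> oU f0; elim: n => [|n IH].
  by move=> /= fc x Ux; apply: continuousV; [exact: f0|exact: fc].
move=> fn; have {}IH := IH (Ck_pred fn); have [fd fD] := fn.
split=> [x Ux|v]; first by apply: differentiableV; [exact: fd|exact: f0].
apply: (Ck_eq oU) (CkM oU (CkN oU (CkM oU IH IH)) (fD v)) => x Ux.
have fxd := fd x Ux; have Vd := differentiableV fxd (f0 x Ux).
rewrite (deriveE _ fxd) (deriveE _ Vd).
transitivity (- (f x) ^- 2 * 'd f x v); first by rewrite /= -invfM expr2.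
exact: (esym (congr1 (fun F : V -> R => F v) (diffV fxd (f0 x Ux)))).
Qed.

Lemma is_diff_sqrt (x : R) : 0 < x ->
  is_diff x Num.sqrt (fun h => h * (2 * Num.sqrt x)^-1).
Proof.
move=> x0; have [dx dE] := is_derive1_sqrt x0.
split; first exact/derivable1_diffP.
by rewrite deriv1E// derive1E dE.
Qed.

Lemma Ck_sqrt V n (U : set V) (f : V -> R) : open U -> (forall x, U x -> 0 < f x) ->
  Ck n U f -> Ck n U (fun x => Num.sqrt (f x)).
Proof.
move=> oU f0; elim: n => [|n IH].
  move=> /= fc x Ux; apply: (@continuous_comp _ _ _ f Num.sqrt); first exact: fc.
  exact: sqrt_continuous.
move=> fn; have {}IH := IH (Ck_pred fn); have [fd fD] := fn.
have Sd x : U x -> is_diff x (Num.sqrt \o f) ((fun h => h * (2 * Num.sqrt (f x))^-1) \o 'd f x).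
  move=> Ux; have fxd := differentiableP (fd x Ux).
  exact: (@is_diff_comp _ _ _ _ _ _ _ _ _ fxd (is_diff_sqrt (f0 x Ux))).
split=> [x Ux|v]; first by have [] := Sd _ Ux.
have s0 x : U x -> 2 * Num.sqrt (f x) != 0.
  by move=> Ux; rewrite mulf_neq0 ?pnatr_eq0// sqrtr_eq0 -ltNge f0.
apply: (Ck_eq oU) (CkM oU (fD v) (Ck_inv oU s0 (CkM oU (Ck_cst n U (2 : R)) IH))) => x Ux.
by rewrite (is_diff_deriveE _ (Sd _ Ux)) /= deriveE//; exact: fd.
Qed.

Lemma continuous_open_set V (f : V -> R) (P : set R) : open P -> continuous f ->
  open [set x | P (f x)].
Proof. by move=> oP fc; apply: (@open_comp _ _ f P) => // x _; exact: fc. Qed.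

End Calculus.

(** * Calculus on the Jordan algebra *)

Section JordanAnalysis.
Context {R : realType}.
Local Notation J := (jordan R).
Implicit Types X Y Z : J.

Lemma jipE' X Y : jip X Y = kip X Y.
Proof. exact: jipE. Qed.

Definition jbasis_xi (i : 'I_3) : J := (delta_mx 0 i, 0).
Definition jbasis_x (i : 'I_3) (a : 'I_(4 + 4)) : J := (0, delta_mx i a).

Lemma jbasisE X : X = \sum_i X.1 0 i *: jbasis_xi i + \sum_i \sum_a X.2 i a *: jbasis_x i a.
Proof.
have fst_sum I (r : seq I) (F : I -> J) : (\sum_(i <- r) F i).1 = \sum_(i <- r) (F i).1.
  exact: (big_morph fst).
have snd_sum I (r : seq I) (F : I -> J) : (\sum_(i <- r) F i).2 = \sum_(i <- r) (F i).2.
  exact: (big_morph snd).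
case: X => [x M]; congr (_, _) => /=.
  rewrite fst_sum /= [X in _ = _ + X]fst_sum [X in _ = _ + X]big1 ?addr0.
    by rewrite {1}[x]row_sum_delta.
  by move=> i _; rewrite fst_sum big1// => a _; rewrite /= scaler0.
rewrite snd_sum big1 ?add0r => [|i _]; last by rewrite /= scaler0.
rewrite snd_sum {1}[M]matrix_sum_delta; apply: eq_bigr => i _.
by rewrite snd_sum.
Qed.

Lemma Ck_jxi (V : normedModType R) n (U : set V) (f : V -> J) i : open U -> Ck n U f ->
  Ck n U (fun x => (f x).1 0 i).
Proof. by move=> oU fn; apply: Ck_coord => //; apply: Ck_fst. Qed.
Lemma Ck_jx (V : normedModType R) n (U : set V) (f : V -> J) i a : open U -> Ck n U f ->
  Ck n U (fun x => (f x).2 i a).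
Proof. by move=> oU fn; apply: Ck_coord => //; apply: Ck_snd. Qed.

(** Finite dimensionality, in the form that yields continuity of linear and
    bilinear maps. *)
Lemma jlinearE (W : lmodType R) (L : J -> W) : linear L -> forall X,
  L X = \sum_i X.1 0 i *: L (jbasis_xi i) + \sum_i \sum_a X.2 i a *: L (jbasis_x i a).
Proof.
move=> Ll X; pose LM := GRing.isLinear.Build _ _ _ _ _ Ll.
pose LL : {linear J -> W} := HB.pack L LM.
rewrite -[L]/(LL : J -> W) {1}[X]jbasisE linearD !linear_sum; congr (_ + _).
  by apply: eq_bigr => i _; rewrite linearZ.
by apply: eq_bigr => i _; rewrite linear_sum; apply: eq_bigr => a _; rewrite linearZ.
Qed.

Lemma jlinear_continuous (W : normedModType R) (L : J -> W) : linear L -> continuous L.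
Proof.
move=> Ll X; suff : Ck 0 setT L by apply.
apply: (Ck_eq openT) => [x _|]; first by rewrite [RHS](jlinearE Ll).
apply: CkD; [exact: openT|apply: Ck_sum; [exact: openT|move=> i]|].
  by apply: CkZ; [exact: openT|apply: Ck_jxi; [exact: openT|exact: Ck_id]|exact: Ck_cst].
apply: Ck_sum => [|i]; first exact: openT.
apply: Ck_sum => [|a]; first exact: openT.
by apply: CkZ; [exact: openT|apply: Ck_jx; [exact: openT|exact: Ck_id]|exact: Ck_cst].
Qed.

Lemma jbilinear_continuous (W : normedModType R) (B : J -> J -> W) :
  (forall Z, linear (B ^~ Z)) -> (forall Z, linear (B Z)) ->
  continuous (fun p : J * J => B p.1 p.2).
Proof.
move=> Bl Br X; suff : Ck 0 setT (fun p : J * J => B p.1 p.2) by apply.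
have snd_n : Ck 0 setT (fun p : J * J => p.2).
  by apply: Ck_snd; [exact: openT|exact: Ck_id].
have fst_n : Ck 0 setT (fun p : J * J => p.1).
  by apply: Ck_fst; [exact: openT|exact: Ck_id].
have B1 Z : Ck 0 setT (fun p : J * J => B Z p.2).
  by apply: (Ck_complin openT (Br Z)) snd_n; exact: jlinear_continuous.
apply: (Ck_eq openT) => [x _|]; first by rewrite [RHS](jlinearE (Bl x.2)).
apply: CkD; [exact: openT|apply: Ck_sum; [exact: openT|move=> i]|].
  by apply: CkZ; [exact: openT|apply: Ck_jxi; [exact: openT|exact: fst_n]|exact: B1].
apply: Ck_sum => [|i]; first exact: openT.
apply: Ck_sum => [|a]; first exact: openT.
by apply: CkZ; [exact: openT|apply: Ck_jx; [exact: openT|exact: fst_n]|exact: B1].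
Qed.

Lemma jmul_linl Z : linear (fun X => jmul X Z).
Proof. by move=> a x y; rewrite !jmulE kmulDl kmulZl. Qed.
Lemma jmul_linr Z : linear (jmul Z).
Proof. by move=> a x y; rewrite !jmulE kmulDr kmulZr. Qed.
Lemma jip_linl Z : linear (fun X => jip X Z : R).
Proof. by move=> a x y; rewrite !jipE' kipDl kipZl. Qed.
Lemma jip_linr Z : linear (fun X => jip Z X : R).
Proof. by move=> a x y; rewrite !jipE' kipDr kipZr. Qed.

Lemma jmul_continuous : continuous (fun p : J * J => jmul p.1 p.2).
Proof. by apply: jbilinear_continuous; [exact: jmul_linl|exact: jmul_linr]. Qed.
Lemma jip_continuous : continuous (fun p : J * J => jip p.1 p.2 : R).
Proof. by apply: jbilinear_continuous; [exact: jip_linl|exact: jip_linr]. Qed.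

Lemma oip_ge0 (x : octo R) : 0 <= oip x x.
Proof. by rewrite /oip; apply: sumr_ge0 => a _; rewrite -expr2 sqr_ge0. Qed.

Lemma jip_term_ge0 X i : 0 <= jxi X i * jxi X i /\ 0 <= 2 * oip (jx X i) (jx X i).
Proof. by rewrite -expr2 sqr_ge0 mulr_ge0// oip_ge0. Qed.

Lemma jip_ge0 X : 0 <= jip X X.
Proof.
by rewrite jipE; apply: sumr_ge0 => i _; have [? ?] := jip_term_ge0 X i; exact: addr_ge0.
Qed.

Lemma jip_eq0 X : jip X X = 0 -> X = 0.
Proof.
rewrite jipE => /eqP; rewrite psumr_eq0 => [/allP H|i _]; last first.
  by have [? ?] := jip_term_ge0 X i; exact: addr_ge0.
have {}H i : jxi X i = 0 /\ oip (jx X i) (jx X i) = 0.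
  have [h1 h2] := jip_term_ge0 X i.
  have := H i (mem_index_enum i); rewrite paddr_eq0//= !mulf_eq0 orbb pnatr_eq0 /=.
  by move=> /andP[/eqP -> /eqP ->].
apply: jext => [i|i a]; first by have [h _] := H i; rewrite mxE; exact: h.
have [_ /eqP] := H i; rewrite /oip psumr_eq0 => [/allP/(_ a (mem_index_enum a))|b _].
  by rewrite !mxE /= mulf_eq0 orbb => /eqP.
by rewrite -expr2 sqr_ge0.
Qed.

Lemma jip_gt0 X : X <> 0 -> 0 < jip X X.
Proof.
by move=> X0; rewrite lt_neqAle jip_ge0 andbT eq_sym; apply/eqP => /jip_eq0.
Qed.

Lemma jnorm_sq X : jnorm X ^+ 2 = jip X X.
Proof. by rewrite sqr_sqrtr ?jip_ge0. Qed.

Lemma jnorm_gt0 X : X <> 0 -> 0 < jnorm X.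
Proof. by move=> X0; rewrite sqrtr_gt0 jip_gt0. Qed.

Definition qC (A : J * J) : R := jip A.1 A.1 + jip A.2 A.2.

Lemma jnormCE A : jnormC A = Num.sqrt (qC A).
Proof.
have jipN X Y : jip X (- Y) = - jip X Y.
  by rewrite !jipE' -[in LHS]scaleN1r kipZr mulN1r.
by rewrite /jnormC /jhermC /formC /conjV /= /qC !jipN opprK.
Qed.

Lemma qC_gt0 A : A <> 0 -> 0 < qC A.
Proof.
move=> A0; rewrite lt_neqAle addr_ge0 ?jip_ge0// andbT eq_sym paddr_eq0 ?jip_ge0//.
apply/negP => /andP[/eqP/jip_eq0 a0 /eqP/jip_eq0 b0]; apply: A0.
by rewrite [A]surjective_pairing a0 b0.
Qed.
End JordanAnalysis.

(** * The diffeomorphism *)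

Section Diffeomorphism.
Context {R : realType}.
Local Notation J := (jordan R).
Local Notation JC := (J * J)%type.

Lemma T0P2OP (p : J * J) : @T0P2O R p ->
  [/\ kmul p.1 p.1 = p.1, ktr p.1 = 1, kmul p.1 p.2 = 2^-1 *: p.2 & p.2 <> 0].
Proof. by case=> -[[h1 h2] h3] h4; split=> //; rewrite -jmulE. Qed.

Lemma EOP (A : JC) : @EO R A ->
  [/\ kmul A.1 A.1 = kmul A.2 A.2, kmul A.1 A.2 = 0, ktr A.1 = 0, ktr A.2 = 0 & A <> 0].
Proof.
case=> A0 An0; have [T1 T2] := EO_tr A0.
split; [| |exact: T1|exact: T2|exact: An0].
  by apply/subr0_eq; rewrite -!jmulE; exact: (congr1 fst A0).
have : kmul A.1 A.2 + kmul A.2 A.1 = 0 by rewrite -!jmulE; exact: (congr1 snd A0).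
rewrite [kmul A.2 _]kmulC -[X in X + X]scale1r -scalerDl => h.
have := congr1 (fun X => 2^-1 *: X) h.
by rewrite scaler0 scalerA mulVf ?scale1r// ?pnatr_eq0.
Qed.

Lemma sqrt2_sq : Num.sqrt 2 * Num.sqrt 2 = 2 :> R.
Proof. by rewrite -expr2 sqr_sqrtr. Qed.
Lemma sqrt2_gt0 : 0 < Num.sqrt 2 :> R.
Proof. by rewrite sqrtr_gt0. Qed.

Lemma tauOE (p : J * J) :
  tauO p = (kip p.2 p.2 *: p.1 - kmul p.2 p.2, ((Num.sqrt 2)^-1 * jnorm p.2) *: p.2).
Proof. by case: p => X Y; rewrite /tauO /= jnorm_sq jipE' jmulE. Qed.

Lemma tauO_norm (p : J * J) : @T0P2O R p -> qC (tauO p) = jip p.2 p.2 ^+ 2.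
Proof.
move=> /T0P2OP[XX TX XY Y0]; rewrite tauOE /qC /=.
have nE : jnorm p.2 ^+ 2 = kip p.2 p.2 by rewrite jnorm_sq jipE'.
rewrite !jipE' !(kipDl, kipDr, kipZl, kipZr).
have kipNl (X Y : J) : kip (- X) Y = - kip X Y by rewrite -scaleN1r kipZl mulN1r.
have kipNr (X Y : J) : kip X (- Y) = - kip X Y by rewrite -scaleN1r kipZr mulN1r.
rewrite !(kipNl, kipNr) [kip (kmul _ _) p.1]kipC (tan_ipX XX TX) (tan_ipXY2 XY).
rewrite -[kip (kmul p.2 p.2) _]ktr_kmul (tan_Y4 XX TX XY) ktrZ ktr_kmul /khalf -nE.
have s2 := sqrt2_sq; have s0 := sqrt2_gt0; move: (Num.sqrt 2) s2 s0 => s s2 s0.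
move: (jnorm _) => n; have -> : s^-1 * n * (s^-1 * n * n ^+ 2) = n ^+ 4 / (s * s).
  by field; rewrite gt_eqF.
by rewrite s2; field.
Qed.

Lemma tauO_EO (p : J * J) : @T0P2O R p -> @EO R (tauO p).
Proof.
move=> pT; have [XX TX XY Y0] := T0P2OP pT; split; last first.
  have := tauO_norm pT; move=> + t0; rewrite t0 /qC !jipE' !kip0l addr0 => /esym/eqP.
  by rewrite sqrf_eq0 -jipE' gt_eqF// jip_gt0.
rewrite tauOE /jmulC /bilinC /= !jmulE.
have kmulNl (X Y : J) : kmul (- X) Y = - kmul X Y by rewrite -scaleN1r kmulZl scaleN1r.
have kmulNr (X Y : J) : kmul X (- Y) = - kmul X Y by rewrite -scaleN1r kmulZr scaleN1r.
have nE : jnorm p.2 ^+ 2 = kip p.2 p.2 by rewrite jnorm_sq jipE'.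
rewrite !(kmulDl, kmulDr, kmulZl, kmulZr, kmulNl, kmulNr).
rewrite [kmul (kmul _ _) p.1]kmulC [kmul (kmul _ _) p.2]kmulC [kmul p.2 p.1]kmulC.
rewrite (tan_mulXY2 XX TX XY) (tan_cube XX TX XY) (tan_Y4 XX TX XY) XX XY.
rewrite /khalf -nE; move: (kmul _ _) => Y2.
have s2 := sqrt2_sq; have s0 := sqrt2_gt0; move: (Num.sqrt 2) s2 s0 => s s2 s0.
move: (jnorm _) => n; congr (_, _).
  rewrite scalerA (_ : s^-1 * n * (s^-1 * n) = n ^+ 2 / (s * s)); last by field; rewrite gt_eqF.
  by rewrite s2; jlin.
by move: (s^-1) => t; jlin.
Qed.

(** At [A = tauO (X, Y)] one has [|Y|^2 = jnormC A]; this gives [Y] from the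
    imaginary part of [A], and then [X = (A.1 + Y^2) / |Y|^2]. *)
Definition tauO_inv (A : JC) : J * J :=
  ((jnormC A)^-1 *: A.1 + (2 * (jnormC A)^-1 ^+ 2) *: jmul A.2 A.2,
   ((Num.sqrt (2 : R) : R) * (Num.sqrt (jnormC A))^-1) *: A.2).

Lemma jnormC_gt0 (A : JC) : A <> 0 -> 0 < jnormC A.
Proof. by move=> A0; rewrite jnormCE sqrtr_gt0 qC_gt0. Qed.

Lemma tauOK (p : J * J) : @T0P2O R p -> tauO_inv (tauO p) = p.
Proof.
move=> pT; have [XX TX XY Y0] := T0P2OP pT; rewrite /tauO_inv.
have nE : jnorm p.2 ^+ 2 = kip p.2 p.2 by rewrite jnorm_sq jipE'.
have n0 := jnorm_gt0 Y0.
have -> : jnormC (tauO p) = jnorm p.2 ^+ 2.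
  by rewrite jnormCE tauO_norm// jnorm_sq sqrtr_sqr ger0_norm// jip_ge0.
rewrite sqrtr_sqr ger0_norm ?(ltW n0)// tauOE jmulE /= kmulZl kmulZr -nE.
rewrite [RHS]surjective_pairing; move: (jnorm p.2) n0 {nE} => n n0; move: (p.1) (p.2) (kmul _ _) => X Y Y2.
have s2 := sqrt2_sq; have s0 := sqrt2_gt0; move: (Num.sqrt 2) s2 s0 => s s2 s0.
congr (_, _); last first.
  by rewrite scalerA -[RHS]scale1r; congr (_ *: _); field; rewrite !gt_eqF.
transitivity (n^-1 ^+ 2 *: (n ^+ 2 *: X - Y2) + (2 / (s * s) * n^-1 ^+ 2) *: Y2).
  congr (_ + _); first by congr (_ *: _); field; rewrite gt_eqF.
  by rewrite !scalerA; congr (_ *: _); field; rewrite !gt_eqF.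
by rewrite s2; apply: jext => [?|? ?]; rewrite /= !mxE; field; rewrite gt_eqF.
Qed.

Lemma tauO_invK (A : JC) : @EO R A -> @T0P2O R (tauO_inv A) /\ tauO (tauO_inv A) = A.
Proof.
move=> AE; have [aabb ab Ta Tb A0] := EOP AE; have N0 := jnormC_gt0 A0.
have N2 : jnormC A ^+ 2 = 2 * kip A.1 A.1.
  rewrite jnormCE sqr_sqrtr ?(ltW (qC_gt0 A0))// /qC !jipE' -(cone_norm aabb).
  by rewrite mulrDl mul1r.
have ha : khalf A.1 = jnormC A ^+ 2 / 4 by rewrite N2 /khalf; field.
have hb : khalf A.2 = jnormC A ^+ 2 / 4 by rewrite N2 /khalf (cone_norm aabb); field.
have a3 := cone_cube aabb ab Ta Tb.
have ba : kmul A.2 A.1 = 0 by rewrite kmulC.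
have b3 := cone_cube (esym aabb) ba Tb Ta.
have a4 : kmul (kmul A.1 A.1) (kmul A.1 A.1) = khalf A.1 *: kmul A.1 A.1.
  by apply: kmul_sq_sq => //; rewrite /khalf; field.
rewrite ha in a3 a4; rewrite hb in b3.
have ab2 : kmul A.1 (kmul A.2 A.2) = (jnormC A ^+ 2 / 4) *: A.1 by rewrite -aabb.
set N := jnormC A in N0 N2 ha hb a3 b3 a4 ab2 *.
set c := Num.sqrt 2 * (Num.sqrt N)^-1.
have c2 : c ^+ 2 = 2 / N.
  by rewrite /c exprMn exprVn !sqr_sqrtr ?ltW.
have YY : kip (tauO_inv A).2 (tauO_inv A).2 = N.
  rewrite /tauO_inv /= kipZl kipZr mulrA -expr2 c2 -(cone_norm aabb).
  have -> : kip A.1 A.1 = N ^+ 2 / 2 by rewrite N2; field.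
  by field; rewrite gt_eqF.
have nY : jnorm (tauO_inv A).2 = Num.sqrt N by rewrite /jnorm jipE' YY.
split.
  split; last by move=> Y0; move: YY N0; rewrite Y0 kip0l => ->; rewrite ltxx.
  rewrite /tauO_inv -/N -/c /=; split; last first.
    rewrite !jmulE kmulDl !(kmulZl, kmulZr) ab [kmul _ A.2]kmulC b3 !scaler0 add0r.
    by rewrite !scalerA; congr (_ *: _); field; rewrite gt_eqF.
  split; last first.
    rewrite -[LHS]/(ktr _) jmulE ktrD !ktrZ ktr_kmul Ta -(cone_norm aabb).
    have -> : kip A.1 A.1 = N ^+ 2 / 2 by rewrite N2; field.
    by rewrite mulr0 add0r; field; rewrite gt_eqF.
  rewrite !jmulE !(kmulDl, kmulDr) !(kmulZl, kmulZr) [kmul (kmul _ _) A.1]kmulC ab2 -aabb a4.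
  move: (A.1) (kmul A.1 A.1) => a a2.
  by apply: jext => [?|? ?]; rewrite /= !mxE; field; rewrite gt_eqF.
rewrite tauOE nY YY /tauO_inv /= -/N -/c jmulE kmulZl kmulZr scalerA -expr2 c2.
rewrite [RHS]surjective_pairing; congr (_, _).
  move: (A.1) (kmul A.2 A.2) => a a2.
  by apply: jext => [?|? ?]; rewrite /= !mxE; field; rewrite gt_eqF.
rewrite scalerA -[RHS]scale1r /c; congr (_ *: _).
by field; rewrite !gt_eqF //; first [exact: sqrt2_gt0|rewrite sqrtr_gt0].
Qed.

Lemma tauO_diffeomorphism : diffeomorphism (@T0P2O R) (@EO R) (@tauO R).
Proof.
have ip1 n (U : set (J * J)) f g : open U -> Ck n U f -> Ck n U g ->
    Ck n U (fun p => jip (f p) (g p) : R).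
  exact: (@Ck_bilin R _ _ _ _ (@jip R) jip_linl jip_linr jip_continuous).
have mu1 n (U : set (J * J)) f g : open U -> Ck n U f -> Ck n U g ->
    Ck n U (fun p => jmul (f p) (g p)).
  exact: (@Ck_bilin R _ _ _ _ (@jmul R) jmul_linl jmul_linr jmul_continuous).
have fs n (U : set (J * J)) : open U -> Ck n U (fun p => p.1).
  by move=> Uo; apply: Ck_fst => //; exact: Ck_id.
have sn n (U : set (J * J)) : open U -> Ck n U (fun p => p.2).
  by move=> Uo; apply: Ck_snd => //; exact: Ck_id.
have oU (f : J * J -> R) : Ck 0 setT f -> open [set p | 0 < f p].
  by move=> fc; apply: (@continuous_open_set _ _ f [set x | 0 < x]);
    [exact: open_gt|move=> x; exact: fc].
split.
- split; first by move=> p; exact: tauO_EO.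
    move=> p q; rewrite !inE => pT qT pq.
    by rewrite -(tauOK pT) -(tauOK qT) pq.
  by move=> A AE; exists (tauO_inv A); have [] := tauO_invK AE.
- move=> p pT; exists [set q | 0 < jip q.2 q.2], (@tauO R).
  have oV : open [set q : J * J | 0 < jip q.2 q.2].
    by apply: oU; apply: ip1; [exact: openT|exact/sn/openT|exact/sn/openT].
  split=> //; first by apply: jip_gt0; case: pT.
  move=> n; have nY : Ck n [set q : J * J | 0 < jip q.2 q.2] (fun q => jnorm q.2 : R).
    by apply: Ck_sqrt => //; apply: ip1 => //; exact: sn.
  apply: (Ck_eq oV (f := fun q => (jnorm q.2 ^+ 2 *: q.1 - jmul q.2 q.2,
     ((Num.sqrt 2)^-1 * jnorm q.2) *: q.2))); first by case.
  apply: Ck_pair => //.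
    apply: CkD => //; last by apply: CkN => //; apply: mu1 => //; exact: sn.
    by apply: CkZ => //; [apply: CkM|exact: fs].
  by apply: CkZ => //; [apply: CkM => //; exact: Ck_cst|exact: sn].
exists tauO_inv; split; first by move=> p; exact: tauOK.
move=> A AE; exists [set B | 0 < qC B], tauO_inv.
have qCn n (U : set (J * J)) : open U -> Ck n U (fun B => qC B : R).
  by move=> oV; apply: CkD => //; apply: ip1 => //; [exact: fs|exact: fs|exact: sn|exact: sn].
have oV : open [set B : JC | 0 < qC B] by apply: oU; apply: qCn; exact: openT.
split=> //; first by apply: qC_gt0; case: AE.
move=> n; have Nn : Ck n [set B : JC | 0 < qC B] (fun B => jnormC B : R).
  apply: (Ck_eq oV (f := fun B => Num.sqrt (qC B))); first by move=> x _; rewrite jnormCE.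
  by apply: Ck_sqrt => //; exact: qCn.
have N0 B : 0 < qC B -> 0 < jnormC B by rewrite jnormCE sqrtr_gt0.
have Vn : Ck n [set B : JC | 0 < qC B] (fun B => (jnormC B)^-1 : R).
  by apply: Ck_inv => // B B0; rewrite gt_eqF// N0.
have Sn : Ck n [set B : JC | 0 < qC B] (fun B => (Num.sqrt (jnormC B))^-1 : R).
  apply: Ck_inv => // [B B0|]; first by rewrite gt_eqF// sqrtr_gt0 N0.
  by apply: Ck_sqrt => // B B0; exact: N0.
apply: Ck_pair => //.
  apply: CkD => //; first by apply: CkZ => //; exact: fs.
  apply: CkZ => //; last by apply: mu1 => //; exact: sn.
  by apply: CkM => //; [exact: Ck_cst|apply: CkM].
by apply: CkZ => //; [apply: CkM => //; exact: Ck_cst|exact: sn].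
Qed.

End Diffeomorphism.

(** * The form defined by the square root of the norm *)

Section DifferentialRules.
Context {R : realType}.

Lemma is_diff_const (V W : normedModType R) (w : W) (x : V) :
  is_diff x (fun=> w) (fun=> 0).
Proof. exact: is_diff_cst. Qed.

Lemma is_diff_fst (V W : normedModType R) (x : V * W) : is_diff x fst fst.
Proof. by apply: is_diff_linear => // y; exact: cvg_fst. Qed.
Lemma is_diff_snd (V W : normedModType R) (x : V * W) : is_diff x snd snd.
Proof. by apply: is_diff_linear => // y; exact: cvg_snd. Qed.

Lemma is_diff_scale (V W : normedModType R) (f df : V -> R) (g dg : V -> W) x :
  is_diff x f df -> is_diff x g dg ->
  is_diff x (fun y => f y *: g y) (fun h => f x *: dg h + df h *: g x).
Proof.
apply: (@is_diff_bilin R V R W W (fun a b => a *: b)).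
- by move=> z a u v; rewrite scalerDl scalerA.
- by move=> z a u v; rewrite scalerDr !scalerA mulrC.
- exact: scale_continuous.
Qed.

Lemma is_diff_mul (V : normedModType R) (f df g dg : V -> R) x :
  is_diff x f df -> is_diff x g dg ->
  is_diff x (fun y => f y * g y) (fun h => f x * dg h + df h * g x).
Proof. exact: (@is_diff_scale V R). Qed.

Lemma is_diff_add (V W : normedModType R) (f df g dg : V -> W) x :
  is_diff x f df -> is_diff x g dg ->
  is_diff x (fun y => f y + g y) (fun h => df h + dg h).
Proof. exact: is_diffD. Qed.

Lemma is_diff_opp (V W : normedModType R) (f df : V -> W) x :
  is_diff x f df -> is_diff x (fun y => - f y) (fun h => - df h).
Proof. exact: is_diffN. Qed.

Lemma is_diff_comp_sqrt (V : normedModType R) (f df : V -> R) x : 0 < f x ->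
  is_diff x f df ->
  is_diff x (fun y => Num.sqrt (f y)) (fun h => df h * (2 * Num.sqrt (f x))^-1).
Proof.
by move=> f0 fd; exact: (@is_diff_comp _ _ _ _ _ _ _ _ _ fd (is_diff_sqrt f0)).
Qed.

Lemma is_diff_inv (V : normedModType R) (f df : V -> R) x : f x != 0 ->
  is_diff x f df -> is_diff x (fun y => (f y)^-1) (fun h => - (f x) ^- 2 * df h).
Proof.
move=> f0 [fd fE]; split; first exact: differentiableV.
by apply/funext => h; rewrite -fE; exact: (congr1 (fun F : V -> R => F h) (diffV fd f0)).
Qed.

End DifferentialRules.

Section Potential.
Context {R : realType} {V : normedModType R} (b : V -> V -> R).
Hypotheses (b_linl : forall z, linear (fun x => b x z : R))
  (b_linr : forall z, linear (fun x => b z x : R))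
  (b_cont : continuous (fun p : V * V => b p.1 p.2 : R))
  (bC : forall x y, b x y = b y x)
  (b_gt0 : forall x, x <> 0 -> 0 < b x x).
Implicit Types A B H K : V * V.

(** [ipR] and [wR] are the real and imaginary parts of the Hermitian product of
    [A] and [H]. *)
Definition ipR A H : R := b A.1 H.1 + b A.2 H.2.
Definition wR A H : R := b A.2 H.1 - b A.1 H.2.

Lemma form0l z : b 0 z = 0.
Proof.
have := b_linl z 1 0 0; rewrite !scale1r addr0 -[LHS]addr0.
by move/addrI/esym.
Qed.
Lemma formNr x y : b x (- y) = - b x y.
Proof.
by have := b_linr x (-1) y 0; rewrite addr0 (bC x 0) form0l addr0 !scaleN1r.
Qed.

Lemma is_diff_form (U : normedModType R) (f g : U -> V) x df dg :
  is_diff x f df -> is_diff x g dg ->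
  is_diff x (fun y => b (f y) (g y) : R) (fun h => b (f x) (dg h) + b (df h) (g x)).
Proof. exact: (@is_diff_bilin R U _ _ _ b b_linl b_linr b_cont). Qed.

Lemma is_diff_ipRR A : is_diff A (fun B => ipR B B) (fun H => 2 * ipR A H).
Proof.
have d1 := is_diff_form (is_diff_fst A) (is_diff_fst A).
have d2 := is_diff_form (is_diff_snd A) (is_diff_snd A).
apply: is_diff_eq (is_diff_add d1 d2) _; apply/funext => H.
by rewrite /ipR (bC H.1) (bC H.2); ring.
Qed.

Lemma is_diff_ipRl A K : is_diff A (ipR ^~ K) (ipR ^~ K).
Proof.
have cK1 := is_diff_const K.1 A; have cK2 := is_diff_const K.2 A.
have d1 := is_diff_form (is_diff_fst A) cK1.
have d2 := is_diff_form (is_diff_snd A) cK2.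
apply: is_diff_eq (is_diff_add d1 d2) _; apply/funext => H /=.
by rewrite /ipR /= !(bC _ 0) !form0l !add0r.
Qed.

Lemma is_diff_wRl A K : is_diff A (wR ^~ K) (wR ^~ K).
Proof.
have cK1 := is_diff_const K.1 A; have cK2 := is_diff_const K.2 A.
have d1 := is_diff_form (is_diff_fst A) cK2.
have d2 := is_diff_form (is_diff_snd A) cK1.
apply: is_diff_eq (is_diff_add d2 (is_diff_opp d1)) _; apply/funext => H /=.
by rewrite /wR /= !(bC _ 0) !form0l !add0r.
Qed.

Definition formnorm A : R := Num.sqrt (complex.Re (Defs.formC b A (conjV A))).

Lemma formnormE A : formnorm A = Num.sqrt (ipR A A).
Proof. by rewrite /formnorm /= formNr opprK. Qed.

Lemma ipR_gt0 A : A <> 0 -> 0 < ipR A A.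
Proof.
have b_ge0 x : 0 <= b x x.
  by have [->|/eqP /b_gt0 /ltW//] := eqVneq x 0; rewrite form0l.
move=> A0; rewrite /ipR; have [a0|/eqP a0] := eqVneq A.1 0.
  rewrite a0 form0l add0r; apply: b_gt0 => b0; apply: A0.
  by rewrite [A]surjective_pairing a0 b0.
by rewrite ltr_pwDl// b_gt0.
Qed.

Definition potential A : R := Num.sqrt (formnorm A).

Lemma potential_gt0 A : A <> 0 -> 0 < potential A.
Proof. by move=> A0; rewrite sqrtr_gt0 formnormE sqrtr_gt0 ipR_gt0. Qed.

Lemma potential_sq A : potential A ^+ 2 = formnorm A.
Proof. by rewrite sqr_sqrtr// sqrtr_ge0. Qed.

Lemma is_diff_potential A : A <> 0 ->
  is_diff A potential (fun H => ipR A H / (2 * potential A ^+ 3)).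
Proof.
move=> A0; have q0 := ipR_gt0 A0; have n0 := potential_gt0 A0.
have d1 := is_diff_comp_sqrt (f := fun B => ipR B B) q0 (is_diff_ipRR A).
have N0 : 0 < Num.sqrt (ipR A A) by rewrite sqrtr_gt0.
have d2 := is_diff_comp_sqrt (f := fun B => Num.sqrt (ipR B B)) N0 d1.
have pE : potential = fun B => Num.sqrt (Num.sqrt (ipR B B)).
  by apply/funext => B; rewrite /potential formnormE.
rewrite {1}pE; apply: is_diff_eq d2 _.
apply/funext => H; rewrite -formnormE -[Num.sqrt (formnorm A)]/(potential A) -potential_sq.
by move: (potential A) n0 => n n0; field; rewrite gt_eqF.
Qed.

Lemma near_neq0 A : A <> 0 -> \forall B \near A, B <> 0.
Proof.
move=> A0; have qc : continuous (fun B => ipR B B : R).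
  by move=> B; apply: differentiable_continuous; have [] := is_diff_ipRR B.
have : \forall B \near A, 0 < ipR B B.
  apply: (qc A [set y | 0 < y]); apply: open_nbhs_nbhs; split; last exact: ipR_gt0.
  exact: open_gt.
by apply: filterS => B q0 B0; move: q0; rewrite B0 /ipR !form0l addr0 ltxx.
Qed.

Let pot B : R[i] := (potential B)%:C%C.

Lemma derivC_potential A H : A <> 0 ->
  Defs.derivC pot A H = (ipR A H / (2 * potential A ^+ 3))%:C%C.
Proof.
move=> A0; rewrite /Defs.derivC /pot /=.
by rewrite (is_diff_deriveE _ (is_diff_potential A0)) derive_cst.
Qed.

Lemma ipR_mulI A H : ipR A (mulI H) = wR A H.
Proof. by rewrite /ipR /wR /= formNr addrC. Qed.
Lemma wR_mulI A H : wR A (mulI H) = - ipR A H.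
Proof. by rewrite /ipR /wR /= formNr; ring. Qed.
Lemma ipRC A H : ipR A H = ipR H A.
Proof. by rewrite /ipR (bC A.1) (bC A.2). Qed.
Lemma wRC A H : wR A H = - wR H A.
Proof. by rewrite /wR (bC A.2) (bC A.1) opprB. Qed.

Lemma del_potential A H : A <> 0 ->
  del pot A H = ((4 * potential A ^+ 3)^-1 * ipR A H
                 +i* - ((4 * potential A ^+ 3)^-1 * wR A H))%C.
Proof.
move=> A0; have n0 := potential_gt0 A0.
rewrite /del !derivC_potential// ipR_mulI.
move: (ipR A H) (wR A H) (potential A) n0 => r w n n0.
by apply/eqP; rewrite eq_complex /=; apply/andP; split; apply/eqP; field; rewrite gt_eqF.
Qed.

(** The factor by which [del] of the potential at [A] differs from the
    Hermitian product with [A]. *)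
Definition invcube A : R := (4 * potential A ^+ 3)^-1.

Lemma is_diff_invcube A : A <> 0 -> is_diff A invcube
  (fun H => - (3 / 8) * ipR A H / potential A ^+ 7).
Proof.
move=> A0; have n0 := potential_gt0 A0; have d := is_diff_potential A0.
have d3 := is_diff_mul (is_diff_const (4 : R) A) (is_diff_mul d (is_diff_mul d d)).
have iE : invcube = fun B => (4 * (potential B * (potential B * potential B)))^-1.
  by apply/funext => B; rewrite /invcube !exprS expr0 mulr1.
have N0 : 4 * (potential A * (potential A * potential A)) != 0 :> R.
  by rewrite !mulf_neq0 ?gt_eqF//= pnatr_eq0.
rewrite iE; apply: is_diff_eq (is_diff_inv (f := fun B => 4 *
   (potential B * (potential B * potential B))) N0 d3) _.
apply/funext => H /=; move: (ipR A H) (potential A) n0 => r n n0.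
by field; rewrite gt_eqF.
Qed.

Lemma derivC_del_potential A H K : A <> 0 ->
  Defs.derivC (del pot ^~ K) A H =
  ((- (3 / 8) * ipR A H / potential A ^+ 7 * ipR A K + invcube A * ipR H K)
   +i* - (- (3 / 8) * ipR A H / potential A ^+ 7 * wR A K + invcube A * wR H K))%C.
Proof.
move=> A0; rewrite /Defs.derivC.
have dc := is_diff_invcube A0.
have nR : \forall B \near A, invcube B * ipR B K = complex.Re (del pot B K).
  by apply: filterS (near_neq0 A0) => B B0; rewrite del_potential.
have nI : \forall B \near A, - (invcube B * wR B K) = complex.Im (del pot B K).
  by apply: filterS (near_neq0 A0) => B B0; rewrite del_potential.
have dR := near_eq_is_diff nR (is_diff_mul dc (is_diff_ipRl A K)).
have dI := near_eq_is_diff nI (is_diff_opp (is_diff_mul dc (is_diff_wRl A K))).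
rewrite (is_diff_deriveE _ dR) (is_diff_deriveE _ dI).
congr (_ +i* _)%C; first exact: addrC.
by congr (- _); exact: addrC.
Qed.

Lemma delbar_del_potential A H K : A <> 0 ->
  delbar (del pot ^~ K) A H =
  ((invcube A * ipR H K
     - 3 / 16 * (ipR A H * ipR A K + wR A H * wR A K) / potential A ^+ 7)
   +i* (3 / 16 * (ipR A H * wR A K - wR A H * ipR A K) / potential A ^+ 7
     - invcube A * wR H K))%C.
Proof.
move=> A0; have n0 := potential_gt0 A0.
have E1 := derivC_del_potential H K A0; have E2 := derivC_del_potential (mulI H) K A0.
have key (d1 d2 e1 e2 : R[i]) : d1 = e1 -> d2 = e2 ->
    (d1 + 'i%C * d2) / 2%:R = (e1 + 'i%C * e2) / 2%:R by move=> -> ->.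
rewrite /delbar (key _ _ _ _ E1 E2) {E1 E2 key} !ipR_mulI [ipR (mulI _) _]ipRC [wR (mulI _) _]wRC ipR_mulI wR_mulI.
rewrite (ipRC K H) (wRC K H).
move: (ipR A H) (ipR A K) (ipR H K) (wR A H) (wR A K) (wR H K) (invcube A) => a c d e f g h.
move: (potential A) n0 => n n0.
by apply/eqP; rewrite eq_complex /=; apply/andP; split; apply/eqP; field; rewrite gt_eqF.
Qed.

(** The real part of [delbar_del_potential] is symmetric in [H] and [K] and
    cancels in [delbar1]. *)
Lemma delbar1_del_potential A H K : A <> 0 ->
  'i%C * delbar1 (del pot) A H K =
  (2^-1 * wR H K / potential A ^+ 3
   + 3 / 8 * (wR A H * ipR A K - wR A K * ipR A H) / potential A ^+ 7)%:C%C.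
Proof.
move=> A0; have n0 := potential_gt0 A0.
have E1 := delbar_del_potential H K A0; have E2 := delbar_del_potential K H A0.
have key (d1 d2 e1 e2 : R[i]) : d1 = e1 -> d2 = e2 ->
    'i%C * (d1 - d2) = 'i%C * (e1 - e2) by move=> -> ->.
rewrite /delbar1 (key _ _ _ _ E1 E2) {E1 E2 key} (ipRC K H) (wRC K H) /invcube.
move: (ipR A H) (ipR A K) (ipR H K) (wR A H) (wR A K) (wR H K) (potential A) n0.
move=> a c d e f g n n0.
by apply/eqP; rewrite eq_complex /=; apply/andP; split; apply/eqP; field; rewrite gt_eqF.
Qed.
End Potential.

(** * Complex differentiability *)

Section HolomorphicFunctions.
Context {R : realType} {V : normedModType R}.
Local Notation C := R[i].
Implicit Types (f g : V * V -> C) (A H : V * V).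

Definition holo f A := exists L : V * V -> C,
  [/\ is_diff A (fun B => complex.Re (f B)) (fun H => complex.Re (L H)),
      is_diff A (fun B => complex.Im (f B)) (fun H => complex.Im (L H)) &
      forall H, L (mulI H) = 'i%C * L H].

Lemma holo_cst (c : C) A : holo (fun=> c) A.
Proof.
exists (fun=> 0); split; [exact: is_diff_const|exact: is_diff_const|].
by move=> H; rewrite mulr0.
Qed.

Lemma ReD (x y : C) : complex.Re (x + y) = complex.Re x + complex.Re y.
Proof. by case: x y => [a b] [c d]. Qed.
Lemma ImD (x y : C) : complex.Im (x + y) = complex.Im x + complex.Im y.
Proof. by case: x y => [a b] [c d]. Qed.
Lemma ReM (x y : C) : complex.Re (x * y) = complex.Re x * complex.Re y - complex.Im x * complex.Im y.
Proof. by case: x y => [a b] [c d]. Qed.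
Lemma ImM (x y : C) : complex.Im (x * y) = complex.Re x * complex.Im y + complex.Im x * complex.Re y.
Proof. by case: x y => [a b] [c d]. Qed.

Lemma is_diff_ext (U W : normedModType R) (f g df dg : U -> W) x :
  f =1 g -> df =1 dg -> is_diff x f df -> is_diff x g dg.
Proof. by move=> /funext -> /funext ->. Qed.

Lemma holoD f g A : holo f A -> holo g A -> holo (fun B => f B + g B) A.
Proof.
move=> [L [fR fI Li]] [M [gR gI Mi]]; exists (fun H => L H + M H); split.
- by apply: is_diff_ext (is_diff_add fR gR) => B; rewrite ReD.
- by apply: is_diff_ext (is_diff_add fI gI) => B; rewrite ImD.
- by move=> H; rewrite Li Mi mulrDr.
Qed.

Lemma holoM f g A : holo f A -> holo g A -> holo (fun B => f B * g B) A.
Proof.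
move=> [L [fR fI Li]] [M [gR gI Mi]].
exists (fun H => f A * M H + L H * g A); split.
- apply: is_diff_ext (is_diff_add (is_diff_mul fR gR) (is_diff_opp (is_diff_mul fI gI))) => B.
    by rewrite ReM.
  by rewrite ReD !ReM; ring.
- apply: is_diff_ext (is_diff_add (is_diff_mul fR gI) (is_diff_mul fI gR)) => B.
    by rewrite ImM.
  by rewrite ImD !ImM; ring.
- by move=> H; rewrite Li Mi; ring.
Qed.

Lemma holo_ext f g A : f =1 g -> holo f A -> holo g A.
Proof. by move=> /funext ->. Qed.

Lemma holoN f A : holo f A -> holo (fun B => - f B) A.
Proof.
move=> fh; apply: holo_ext (holoM (holo_cst (-1) A) fh) => B.
by rewrite mulN1r.
Qed.

Lemma holoB f g A : holo f A -> holo g A -> holo (fun B => f B - g B) A.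
Proof. by move=> fh gh; apply: holoD => //; exact: holoN. Qed.

(** The quotient is written with the real denominator [|f|^2]. *)
Lemma holoV f A : f A != 0 -> holo f A -> holo (fun B => (f B)^-1) A.
Proof.
move=> fA0 [L [fR fI Li]].
pose q B := complex.Re (f B) ^+ 2 + complex.Im (f B) ^+ 2.
have q0 : q A != 0.
  rewrite /q paddr_eq0 ?sqr_ge0// !sqrf_eq0; apply: contra fA0 => /andP[/eqP a /eqP b].
  by rewrite eq_complex a b /= eqxx.
have qd : is_diff A q (fun H => 2 * (complex.Re (f A) * complex.Re (L H)
    + complex.Im (f A) * complex.Im (L H))).
  apply: is_diff_ext (is_diff_add (is_diff_mul fR fR) (is_diff_mul fI fI)) => B.
    by rewrite /q !expr2.
  by ring.
have qid := is_diff_inv q0 qd.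
exists (fun H => - (f A)^-1 ^+ 2 * L H); split.
- apply: is_diff_ext (is_diff_mul fR qid) => B.
    by rewrite /q; case: (f B).
  move: q0; rewrite /q; case: (f A) (L B) => [a b] [c d] /= q0.
  by field.
- apply: is_diff_ext (is_diff_opp (is_diff_mul fI qid)) => B.
    by rewrite /q; case: (f B).
  move: q0; rewrite /q; case: (f A) (L B) => [a b] [c d] /= q0.
  by field.
- by move=> H; rewrite Li; ring.
Qed.

Lemma holo_sum I (r : seq I) (F : I -> V * V -> C) A :
  (forall i, holo (F i) A) -> holo (fun B => \sum_(i <- r) F i B) A.
Proof.
move=> Fh; elim: r => [|i r IH].
  by apply: holo_ext (holo_cst 0 A) => B; rewrite big_nil.
by apply: holo_ext (holoD (Fh i) IH) => B; rewrite big_cons.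
Qed.

Lemma holo_linear f A : linear (fun B => complex.Re (f B) : R) ->
  linear (fun B => complex.Im (f B) : R) ->
  continuous (fun B => complex.Re (f B) : R) -> continuous (fun B => complex.Im (f B) : R) ->
  (forall H, f (mulI H) = 'i%C * f H) -> holo f A.
Proof.
by move=> rl il rc ic fi; exists f; split=> //; exact: is_diff_linear.
Qed.

Lemma holo_continuous f A : holo f A ->
  {for A, continuous (fun B => complex.Re (f B) : R)} /\
  {for A, continuous (fun B => complex.Im (f B) : R)}.
Proof.
by move=> [L [[fR _] [fI _] _]]; split; exact: differentiable_continuous.
Qed.

Lemma holo_open_neq0 f : (forall A, holo f A) -> open [set A | f A != 0].
Proof.
move=> fh; have -> : [set A | f A != 0] =
    [set A | 0 < complex.Re (f A) ^+ 2 + complex.Im (f A) ^+ 2].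
  apply/seteqP; split=> A /=.
    move=> f0; rewrite lt_neqAle eq_sym addr_ge0 ?sqr_ge0// andbT.
    rewrite paddr_eq0 ?sqr_ge0// !sqrf_eq0; apply: contra f0 => /andP[/eqP a /eqP b].
    by rewrite eq_complex a b /= eqxx.
  by apply: contraTneq => ->; rewrite /= expr0n /= addr0 ltxx.
apply: (@continuous_open_set _ _ (fun A => complex.Re (f A) ^+ 2 + complex.Im (f A) ^+ 2) [set x | 0 < x]).
  exact: open_gt.
move=> A; have [cR cI] := holo_continuous (fh A).
by apply: cvgD; rewrite !expr2; apply: cvgM.
Qed.

End HolomorphicFunctions.

Section HolomorphicMaps.
Context {R : realType} {V : normedModType R}.
Local Notation C := R[i].

Lemma is_diff_sum (U W : normedModType R) I (r : seq I) (F dF : I -> U -> W) x :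
  (forall i, is_diff x (F i) (dF i)) ->
  is_diff x (fun y => \sum_(i <- r) F i y) (fun h => \sum_(i <- r) dF i h).
Proof.
move=> Fd; elim: r => [|i r IH].
  by apply: is_diff_ext (is_diff_const 0 x) => y; rewrite big_nil.
by apply: is_diff_ext (is_diff_add (Fd i) IH) => y; rewrite big_cons.
Qed.

Lemma is_diff_mx (U : normedModType R) m n (F dF : U -> 'M[R]_(m, n)) x :
  (forall i j, is_diff x (fun y => F y i j) (fun h => dF h i j)) -> is_diff x F dF.
Proof.
move=> Fd.
apply: (@is_diff_ext _ _ _ (fun y => \sum_i \sum_j F y i j *: delta_mx i j) _
  (fun h => \sum_i \sum_j dF h i j *: delta_mx i j)) => [y|h|].
- by rewrite -matrix_sum_delta.
- by rewrite -matrix_sum_delta.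
apply: is_diff_sum => i; apply: is_diff_sum => j.
apply: is_diff_ext (is_diff_scale (Fd i j) (is_diff_const (delta_mx i j) x)) => //.
by move=> h /=; rewrite scaler0 add0r.
Qed.

Definition ReIm_mx m n (M : 'M[C]_(m, n)) : 'M[R]_(m, n) * 'M[R]_(m, n) :=
  (map_mx (@complex.Re R) M, map_mx (@complex.Im R) M).

Lemma holomorphic_mx m n (U : set (V * V)) (F : V * V -> 'M[C]_(m, n)) :
  (forall A, U A -> forall i j, holo (fun B => F B i j) A) ->
  holomorphic U (fun B => ReIm_mx (F B)).
Proof.
move=> Fh A UA.
have := fun i j => Fh A UA i j.
move=> /(_ _ _)/cid => L.
pose M H := \matrix_(i, j) sval (L i j) H.
have d : is_diff A (fun B => ReIm_mx (F B)) (fun H => ReIm_mx (M H)).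
  apply: is_diff_pair; apply: is_diff_mx => i j; have [dR dI _] := svalP (L i j).
    by apply: is_diff_ext dR => y; rewrite !mxE.
  by apply: is_diff_ext dI => y; rewrite !mxE.
split; first by have [] := d.
move=> H; have [_ ->] := d; rewrite /ReIm_mx /mulI /=; congr (_, _);
  apply/matrixP => i j; rewrite !mxE; have [_ _ ->] := svalP (L i j).
  by rewrite ReM /=; ring.
by rewrite ImM /=; ring.
Qed.
End HolomorphicMaps.

(** * A rational chart of the cone *)

Section AlgebraicChart.
Context {K : numFieldType}.
Local Notation O := 'rV[K]_(4 + 4).
Local Notation JK := ('rV[K]_3 * 'M[K]_(3, 4 + 4))%type.
Variable e : K.
Hypothesis ee : e * e = -1.

Definition i8 (j : nat) : 'I_(4 + 4) := @inord 7 j.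

Lemma i8K (a : 'I_(4 + 4)) : i8 a = a.
Proof. by apply: val_inj; rewrite /= inordK. Qed.

Definition chart_u (X : JK) : K := kxi X 0 + e * kx X 1 0 0.

(** Coordinates 0 to 15 are free on the cone and coordinates 16 to 26 are its
    equations.  Coordinate 0 is one of the two factors of [xi_0^2 + y_0^2],
    because [e^2 = -1]; the other factor can be recovered from coordinate 16. *)
Definition chart (X : JK) (j : nat) : K :=
  if j == 0%N then chart_u X
  else if (j < 8)%N then kx X 1 0 (i8 j)
  else if (j < 16)%N then kx X 2 0 (i8 (j - 8))
  else if j == 16 then kxi X 0 ^+ 2 + gip (kx X 1) (kx X 1) + gip (kx X 2) (kx X 2)
  else if j == 17 then kxi X 0 * kxi X 1 - gip (kx X 2) (kx X 2)
  else if j == 18 then kxi X 0 * kxi X 2 - gip (kx X 1) (kx X 1)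
  else kxi X 0 * kx X 0 0 (i8 (j - 19)) - gconj (gmul (kx X 1) (kx X 2)) 0 (i8 (j - 19)).

Definition cz (c : nat -> K) : O := \row_(a < 4 + 4) c (8 + a)%N.
Definition cy0 (c : nat -> K) : O := \row_(a < 4 + 4) (if a == 0 then 0 else c a).
(** Let [u = p + e y_0] and let [r] be the sum of the squares of the other
    coordinates of [x_1] and [x_2].  If [p^2 + y_0^2 + r] is [c 16], then
    [2 u p = u^2 + c 16 - r]. *)
Definition cP (c : nat -> K) : K := c 0%N ^+ 2 + c 16 - (gip (cy0 c) (cy0 c) + gip (cz c) (cz c)).
Definition cp (c : nat -> K) : K := cP c / (2 * c 0%N).
Definition cy (c : nat -> K) : O :=
  \row_(a < 4 + 4) (if a == 0 then (c 0%N - cp c) / e else c a).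
Definition cx (c : nat -> K) : O := \row_(a < 4 + 4) c (19 + a)%N.

Definition unchart (c : nat -> K) : JK :=
  kpair (fun i => [:: cp c; (c 17 + gip (cz c) (cz c)) / cp c; (c 18 + gip (cy c) (cy c)) / cp c]`_i)
        (fun i => [:: (cp c)^-1 *: (cx c + gconj (gmul (cy c) (cz c))); cy c; cz c]`_i).

Let e0 : e != 0.
Proof.
by apply: contra_eqN ee => /eqP ->; rewrite mul0r eq_sym oppr_eq0 oner_eq0.
Qed.

Lemma gip_head (y : O) (y0 : O) : (forall a, y0 0 a = if a == 0 then 0 else y 0 a) ->
  gip y y = y 0 0 ^+ 2 + gip y0 y0.
Proof.
move=> yE; rewrite /gip (bigD1 0)//= [in RHS](bigD1 0)//= yE eqxx mul0r add0r -expr2.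
by congr (_ + _); apply: eq_bigr => i /negPf i0; rewrite yE i0.
Qed.

Lemma chart_y X (a : 'I_(4 + 4)) : a != 0 -> chart X a = kx X 1 0 a.
Proof.
move=> a0; rewrite /chart i8K ltn_ord; case: eqP => // a0'.
by move: a0; rewrite -val_eqE /= a0'.
Qed.

Lemma chart_z X (a : 'I_(4 + 4)) : chart X (8 + a) = kx X 2 0 a.
Proof.
have a16 : (8 + a < 16)%N by have : (a < 8)%N := ltn_ord a; lia.
by rewrite /chart /= a16 addKn i8K.
Qed.

Lemma chart_x X (a : 'I_(4 + 4)) : chart X (19 + a) =
  kxi X 0 * kx X 0 0 a - gconj (gmul (kx X 1) (kx X 2)) 0 a.
Proof. by rewrite /chart [(19 + a - 19)%N]addKn i8K. Qed.

Lemma chartK X : kxi X 0 != 0 -> chart_u X != 0 -> unchart (chart X) = X.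
Proof.
move=> p0 u0.
have zE : cz (chart X) = kx X 2 by apply/rowP => a; rewrite mxE chart_z.
have y0E a : cy0 (chart X) 0 a = if a == 0 then 0 else kx X 1 0 a.
  by rewrite mxE; case: ifP => // /negbT a0; rewrite chart_y.
have pE : cp (chart X) = kxi X 0.
  rewrite /cp /cP zE; have -> : chart X 0 = chart_u X by [].
  have -> : chart X 16 = kxi X 0 ^+ 2 + gip (kx X 1) (kx X 1) + gip (kx X 2) (kx X 2) by [].
  rewrite (gip_head y0E).
  move: u0; rewrite /chart_u; move: (gip _ _) (gip _ _) (kxi X 0) (kx X 1 0 0) p0 => g h p y p0 u0.
  (* the defect from [2 p u] is a multiple of [e * e + 1] *)
  transitivity ((2 * p * (p + e * y) + (e * e + 1) * y ^+ 2) / (2 * (p + e * y))).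
    by congr (_ / _); ring.
  rewrite ee addNr mul0r addr0; field; by rewrite u0 ?pnatr_eq0.
have yE : cy (chart X) = kx X 1.
  apply/rowP => a; rewrite mxE pE; case: eqP => [->|/eqP a0]; last exact: chart_y.
  have -> : chart X 0 = chart_u X by [].
  by rewrite /chart_u; move: (kx X 1 0 0) (kxi X 0) => y p; field; exact: e0.
apply: kext; elim/I3P; rewrite ?kpair_xi ?kpair_x /= ?pE ?zE ?yE //.
- have -> : chart X 17 = kxi X 0 * kxi X 1 - gip (kx X 2) (kx X 2) by [].
  by rewrite subrK mulrC mulKf.
- have -> : chart X 18 = kxi X 0 * kxi X 2 - gip (kx X 1) (kx X 1) by [].
  by rewrite subrK mulrC mulKf.
have -> : cx (chart X) = kxi X 0 *: kx X 0 - gconj (gmul (kx X 1) (kx X 2)).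
  by apply/rowP => a; rewrite mxE chart_x [RHS]mxE; congr (_ + _); rewrite [RHS]mxE.
by rewrite subrK scalerA mulVf// scale1r.
Qed.

Lemma unchart_xi c : kxi (unchart c) 0 = cp c.
Proof. by rewrite kpair_xi. Qed.

Lemma unchart_u c : chart_u (unchart c) = c 0%N.
Proof.
rewrite /chart_u unchart_xi kpair_x /= mxE eqxx; move: (cp c) (c 0%N) => p u; field.
exact: e0.
Qed.

Lemma unchartK c : c 0%N != 0 -> cP c != 0 -> forall j, (j < 27)%N -> chart (unchart c) j = c j.
Proof.
move=> u0 P0; have p0 : cp c != 0 by rewrite mulf_neq0// invr_neq0// mulf_neq0// pnatr_eq0.
have x0 : kx (unchart c) 0 = (cp c)^-1 *: (cx c + gconj (gmul (cy c) (cz c))) by rewrite kpair_x.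
have x1 : kx (unchart c) 1 = cy c by rewrite kpair_x.
have x2 : kx (unchart c) 2 = cz c by rewrite kpair_x.
have xi1 : kxi (unchart c) 1 = (c 17 + gip (cz c) (cz c)) / cp c by rewrite kpair_xi.
have xi2 : kxi (unchart c) 2 = (c 18 + gip (cy c) (cy c)) / cp c by rewrite kpair_xi.
move=> j j27; have [j8|j8] := ltnP j 8.
  have [->|j0] := eqVneq j 0%N; first exact: unchart_u.
  have -> : j = Ordinal (j8 : (j < 4 + 4)%N) by [].
  by rewrite chart_y// x1 mxE; case: eqP => // /(congr1 val) /= j00; rewrite j00 in j0.
have [j16|j16] := ltnP j 16.
  have j8' : (j - 8 < 4 + 4)%N by lia.
  have -> : j = (8 + Ordinal j8')%N by rewrite /= subnKC.
  by rewrite chart_z x2 mxE.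
have [->|j16'] := eqVneq j 16.
  have -> : forall Y, chart Y 16 = kxi Y 0 ^+ 2 + gip (kx Y 1) (kx Y 1) + gip (kx Y 2) (kx Y 2) by [].
  rewrite unchart_xi x1 x2.
  have yE a : cy0 c 0 a = if a == 0 then 0 else cy c 0 a by rewrite !mxE; case: ifP.
  rewrite (gip_head yE) mxE eqxx.
  have -> : c 16 = cP c - c 0%N ^+ 2 + (gip (cy0 c) (cy0 c) + gip (cz c) (cz c)) by rewrite /cP; ring.
  have PE : cP c = cp c * (2 * c 0%N) by rewrite /cp mulfVK// mulf_neq0// pnatr_eq0.
  rewrite PE; move: (cp c) (c 0%N) (gip _ _) (gip _ _) => p u g h.
  (* as [e * e = -1], the first two squares add up to [2 p u - u ^+ 2] *)
  transitivity (p ^+ 2 + (u - p) ^+ 2 / (e * e) + g + h); last first.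
    by rewrite ee; field.
  by field; exact: e0.
have [->|j17] := eqVneq j 17.
  have -> : forall Y, chart Y 17 = kxi Y 0 * kxi Y 1 - gip (kx Y 2) (kx Y 2) by [].
  by rewrite unchart_xi xi1 x2 mulrC mulfVK// addrK.
have [->|j18] := eqVneq j 18.
  have -> : forall Y, chart Y 18 = kxi Y 0 * kxi Y 2 - gip (kx Y 1) (kx Y 1) by [].
  by rewrite unchart_xi xi2 x1 mulrC mulfVK// addrK.
have j19 : (19 <= j)%N by lia.
have j19' : (j - 19 < 4 + 4)%N by lia.
have -> : j = (19 + Ordinal j19')%N by rewrite /= subnKC.
rewrite chart_x unchart_xi x0 x1 x2 [X in _ * X]mxE mulrA mulfV// mul1r mxE addrK.
by rewrite mxE.
Qed.

Lemma kmul_sq0_chartP X : kxi X 0 != 0 ->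
  kmul X X = 0 <-> forall j, (16 <= j < 27)%N -> chart X j = 0.
Proof.
move=> p0; split=> [/(kmul_sq0_chart p0)[h0 h1 h2 h3] j /andP[j16 j27]|h].
  have [->//|j16'] := eqVneq j 16.
  have [->//|j17] := eqVneq j 17.
  have [->//|j18] := eqVneq j 18.
  have j19 : (19 <= j)%N by lia.
  have j19' : (j - 19 < 4 + 4)%N by lia.
  have -> : j = (19 + Ordinal j19')%N by rewrite /= subnKC.
  rewrite chart_x; move/rowP/(_ (Ordinal j19')): h3; rewrite [RHS]mxE => <-.
  by rewrite [RHS]mxE; congr (_ + _); rewrite [RHS]mxE.
apply/kmul_sq0_chart => //; split.
- exact: (h 16).
- exact: (h 17).
- exact: (h 18).
apply/rowP => a; have a8 := ltn_ord a.
have := h (19 + a)%N; rewrite chart_x /= => /(_ _) h'; rewrite [RHS]mxE -h'.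
  by rewrite [LHS]mxE; congr (_ + _); rewrite [LHS]mxE.
by have : (a < 8)%N := ltn_ord a; lia.
Qed.
End AlgebraicChart.

(** * The cone is a complex submanifold *)

Section LocalChart.
Context {R : realType}.
Local Notation J := (jordan R).
Local Notation JC := (J * J)%type.
Local Notation C := R[i].
Local Notation W27 := ('rV[R]_27 * 'rV[R]_27)%type.

Lemma unchart_eq (e : C) (c c' : nat -> C) : (forall j, (j < 27)%N -> c j = c' j) ->
  unchart e c = unchart e c'.
Proof.
move=> cc; have a8 (a : 'I_(4 + 4)) : (a < 8)%N := ltn_ord a.
have zE : cz c = cz c' by apply/rowP => a; rewrite !mxE cc//; have := a8 a; lia.
have xE : cx c = cx c' by apply/rowP => a; rewrite !mxE cc//; have := a8 a; lia.
have y0E : cy0 c = cy0 c'.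
  by apply/rowP => a; rewrite !mxE cc//; have := a8 a; lia.
have pE : cp c = cp c' by rewrite /cp /cP zE y0E !cc.
have yE : cy e c = cy e c'.
  by apply/rowP => a; rewrite !mxE pE !cc//; have := a8 a; lia.
by rewrite /unchart zE xE pE yE !cc.
Qed.

Definition unemb (X : 'rV[C]_3 * 'M[C]_(3, 4 + 4)) : JC :=
  (((ReIm_mx X.1).1, (ReIm_mx X.2).1), ((ReIm_mx X.1).2, (ReIm_mx X.2).2)).

Lemma unembK X : emb (unemb X) = X.
Proof.
apply: kext => i.
  by rewrite emb_xi /kxi !mxE; case: (X.1 0 i).
by apply/rowP => a; rewrite emb_x /kx !mxE; case: (X.2 i a).
Qed.

Lemma embK A : unemb (emb A) = A.
Proof. by apply: emb_inj; rewrite unembK. Qed.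

Definition toC (w : W27) (j : nat) : C := (w.1 0 (@inord 26 j) +i* w.2 0 (@inord 26 j))%C.

Lemma toC_ReIm (M : 'rV[C]_27) (f : nat -> C) : (forall j : 'I_27, M 0 j = f j) ->
  forall j, (j < 27)%N -> toC (ReIm_mx M) j = f j.
Proof.
move=> Mf j j27; rewrite /toC /ReIm_mx /= !mxE Mf inordK//; by case: (f j).
Qed.

Definition phi (e : C) (A : JC) : W27 := ReIm_mx (\row_(j < 27) chart e (emb A) j).
Definition psi (e : C) (w : W27) : JC := unemb (unchart e (toC w)).

Definition phi_dom (e : C) : set JC := [set A | kxi (emb A) 0 != 0 /\ chart_u e (emb A) != 0].

Lemma toC_phi e A j : (j < 27)%N -> toC (phi e A) j = chart e (emb A) j.
Proof. by apply: toC_ReIm => i; rewrite mxE. Qed.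

Lemma phiK e A : e * e = -1 -> phi_dom e A -> psi e (phi e A) = A.
Proof.
move=> ee [p0 u0]; rewrite /psi (unchart_eq e (c' := chart e (emb A))); last exact: toC_phi.
by rewrite chartK// embK.
Qed.

Definition psi_dom : set W27 := [set w | toC w 0 != 0 /\ cP (toC w) != 0].

Lemma phi_image e : e * e = -1 -> phi e @` phi_dom e = psi_dom.
Proof.
move=> ee; apply/seteqP; split=> [_ [A [p0 u0] <-]|w [u0 P0]].
  split; first by rewrite toC_phi.
  have PE : cp (toC (phi e A)) = kxi (emb A) 0.
    rewrite -(unchart_xi e) (unchart_eq e (c' := chart e (emb A))) ?chartK//.
    exact: toC_phi.
  by apply: contra p0 => /eqP P0; rewrite -PE /cp P0 mul0r.
have c27 := unchartK ee u0 P0.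
exists (psi e w).
  rewrite /phi_dom /= /psi unembK unchart_xi unchart_u//; split=> //.
  by rewrite mulf_neq0// invr_neq0// mulf_neq0// pnatr_eq0.
rewrite /phi /psi unembK [RHS]surjective_pairing /ReIm_mx; congr (_, _);
  by apply/rowP => j; rewrite !mxE c27 // /toC /= inord_val.
Qed.

Lemma holo_emb (U : normedModType R) (l : U -> R) (A : U * U) : linear l -> continuous l ->
  holo (fun B : U * U => (l B.1 +i* l B.2)%C) A.
Proof.
move=> ll lc; apply: holo_linear => /=.
- by move=> a x y; rewrite /= ll.
- by move=> a x y; rewrite /= ll.
- by move=> x; apply: (@continuous_comp _ _ _ fst l); [exact: cvg_fst|exact: lc].
- by move=> x; apply: (@continuous_comp _ _ _ snd l); [exact: cvg_snd|exact: lc].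
move=> H /=; have lN x : l (- x) = - l x.
  have l0 : l 0 = 0.
    have := ll 1 0 0; rewrite !scale1r addr0 -[LHS]addr0.
    by move/addrI/esym.
  have := ll (-1) x 0; rewrite addr0 l0 scaleN1r => ->.
  by transitivity (-1 * l x + 0) => //; rewrite mulN1r addr0.
by apply/eqP; rewrite eq_complex /= lN !mul0r !mul1r sub0r add0r !eqxx.
Qed.

Lemma holo_xi i A : holo (fun B : JC => kxi (emb B) i) A.
Proof.
apply: (holo_ext (f := fun B : JC => (kxi B.1 i +i* kxi B.2 i)%C)); first by move=> B; rewrite emb_xi.
have l : linear (fun X : J => kxi X i : R) by move=> a x y; rewrite kxiD kxiZ.
by apply: (holo_emb (l := fun X : J => kxi X i)) => //; exact: jlinear_continuous.
Qed.

Lemma holo_x i a A : holo (fun B : JC => kx (emb B) i 0 a) A.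
Proof.
apply: (holo_ext (f := fun B : JC => (kx B.1 i 0 a +i* kx B.2 i 0 a)%C)); first by move=> B; rewrite emb_x.
have l : linear (fun X : J => kx X i 0 a : R) by move=> c x y; rewrite kxD kxZ !mxE.
by apply: (holo_emb (l := fun X : J => kx X i 0 a)) => //; exact: jlinear_continuous.
Qed.

Lemma holo_toC j (w : W27) : holo (fun v : W27 => toC v j) w.
Proof.
apply: (holo_emb (l := fun v : 'rV[R]_27 => v 0 (@inord 26 j))).
  by move=> a x y; rewrite !mxE.
exact: coord_continuous.
Qed.

Section HoloOctonions.
Context {V : normedModType R}.
Implicit Types (f g : V * V -> 'rV[C]_(4 + 4)) (A : V * V).

Lemma holo_gip f g A : (forall a, holo (fun B => f B 0 a) A) ->
  (forall a, holo (fun B => g B 0 a) A) -> holo (fun B => gip (f B) (g B)) A.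
Proof. by move=> fh gh; apply: holo_sum => a; apply: holoM. Qed.

Lemma gmul_expand (x y : 'rV[C]_(4 + 4)) a : gmul x y 0 a =
  \sum_b \sum_c x 0 b * y 0 c * gmul (delta_mx 0 b) (delta_mx 0 c) 0 a.
Proof.
have gl (z : 'rV[C]_(4 + 4)) : {morph (fun u => gmul u z) : u v / u + v} by move=> u v; exact: gmulDl.
have gr (z : 'rV[C]_(4 + 4)) : {morph (gmul z) : u v / u + v} by move=> u v; exact: gmulDr.
have g0 (z : 'rV[C]_(4 + 4)) : gmul 0 z = 0 by rewrite -[X in gmul X _](scale0r 0) gmulZl scale0r.
have g0' (z : 'rV[C]_(4 + 4)) : gmul z 0 = 0 by rewrite -[X in gmul _ X](scale0r 0) gmulZr scale0r.
rewrite {1}[x]row_sum_delta (big_morph _ (gl y) (g0 y)) summxE.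
apply: eq_bigr => b _; rewrite gmulZl mxE {1}[y]row_sum_delta.
rewrite (big_morph _ (gr _) (g0' _)) summxE mulr_sumr; apply: eq_bigr => c _.
by rewrite gmulZr mxE mulrA.
Qed.

Lemma holo_gmul f g A : (forall a, holo (fun B => f B 0 a) A) ->
  (forall a, holo (fun B => g B 0 a) A) -> forall a, holo (fun B => gmul (f B) (g B) 0 a) A.
Proof.
move=> fh gh a.
apply: (holo_ext (fun B => esym (gmul_expand (f B) (g B) a))).
apply: holo_sum => b; apply: holo_sum => c.
by apply: holoM; [exact: holoM|exact: holo_cst].
Qed.

Lemma holo_gconj f A : (forall a, holo (fun B => f B 0 a) A) ->
  forall a, holo (fun B => gconj (f B) 0 a) A.
Proof.
move=> fh a; have [a0|a0] := eqVneq a 0.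
  by apply: holo_ext (fh a) => B; rewrite mxE a0 eqxx.
by apply: holo_ext (holoN (fh a)) => B; rewrite mxE (negPf a0).
Qed.
End HoloOctonions.

Lemma holo_sq (V : normedModType R) (f : V * V -> C) A : holo f A -> holo (fun B => f B ^+ 2) A.
Proof. by move=> fh; apply: holo_ext (holoM fh fh) => B; rewrite expr2. Qed.

Lemma holo_if (V : normedModType R) (b : bool) (f g : V * V -> C) A :
  holo f A -> holo g A -> holo (fun B => if b then f B else g B) A.
Proof. by case: b. Qed.

Lemma holo_chart e j A : holo (fun B : JC => chart e (emb B) j) A.
Proof.
rewrite /chart /chart_u; do 6?[apply: holo_if].
- by apply: holoD; [exact: holo_xi|apply: holoM; [exact: holo_cst|exact: holo_x]].
- exact: holo_x.
- exact: holo_x.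
- apply: holoD; last by apply: holo_gip => a; exact: holo_x.
  by apply: holoD; [apply: holo_sq; exact: holo_xi|apply: holo_gip => a; exact: holo_x].
- apply: holoB; first by apply: holoM; exact: holo_xi.
  by apply: holo_gip => a; exact: holo_x.
- apply: holoB; first by apply: holoM; exact: holo_xi.
  by apply: holo_gip => a; exact: holo_x.
apply: holoB; first by apply: holoM; [exact: holo_xi|exact: holo_x].
by apply: holo_gconj; apply: holo_gmul => a; exact: holo_x.
Qed.

Lemma holo_cz w a : holo (fun v : W27 => cz (toC v) 0 a) w.
Proof. by apply: holo_ext (holo_toC (8 + a) w) => v; rewrite mxE. Qed.

Lemma holo_cx w a : holo (fun v : W27 => cx (toC v) 0 a) w.
Proof. by apply: holo_ext (holo_toC (19 + a) w) => v; rewrite mxE. Qed.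

Lemma holo_cy0 w a : holo (fun v : W27 => cy0 (toC v) 0 a) w.
Proof.
have [a0|a0] := eqVneq a 0.
  by apply: holo_ext (holo_cst 0 w) => v; rewrite mxE a0 eqxx.
by apply: holo_ext (holo_toC a w) => v; rewrite mxE (negPf a0).
Qed.

Lemma holo_cP w : holo (fun v : W27 => cP (toC v)) w.
Proof.
apply: holoB; first by apply: holoD; [apply: holo_sq|]; exact: holo_toC.
apply: holoD; last by apply: holo_gip => a; exact: holo_cz.
by apply: holo_gip => a; exact: holo_cy0.
Qed.

Lemma holo_cp w : psi_dom w -> holo (fun v : W27 => cp (toC v)) w.
Proof.
move=> [u0 P0]; apply: holoM; first exact: holo_cP.
apply: holoV; first by rewrite mulf_neq0// pnatr_eq0.
by apply: holoM; [exact: holo_cst|exact: holo_toC].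
Qed.

Lemma holo_cy e w a : psi_dom w -> holo (fun v : W27 => cy e (toC v) 0 a) w.
Proof.
move=> wd; have [a0|a0] := eqVneq a 0; last first.
  by apply: holo_ext (holo_toC a w) => v; rewrite mxE (negPf a0).
apply: (holo_ext (f := fun v => (toC v 0 - cp (toC v)) / e)).
  by move=> v; rewrite mxE a0 eqxx.
by apply: holoM; [apply: holoB; [exact: holo_toC|exact: holo_cp]|exact: holo_cst].
Qed.

Lemma cp_neq0 w : psi_dom w -> cp (toC w) != 0.
Proof. by move=> [u0 P0]; rewrite mulf_neq0// invr_neq0// mulf_neq0// pnatr_eq0. Qed.

Lemma holo_unchart_xi e w i : psi_dom w -> holo (fun v : W27 => kxi (unchart e (toC v)) i) w.
Proof.
move=> wd; have pV : holo (fun v : W27 => (cp (toC v))^-1) w.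
  by apply: holoV; [exact: cp_neq0|exact: holo_cp].
elim/I3P: i.
- by apply: holo_ext (holo_cp wd) => v; rewrite kpair_xi.
- apply: (holo_ext (f := fun v => (toC v 17 + gip (cz (toC v)) (cz (toC v))) / cp (toC v))).
    by move=> v; rewrite kpair_xi.
  apply: holoM => //; apply: holoD; first exact: holo_toC.
  by apply: holo_gip => a; exact: holo_cz.
- apply: (holo_ext (f := fun v => (toC v 18 + gip (cy e (toC v)) (cy e (toC v))) / cp (toC v))).
    by move=> v; rewrite kpair_xi.
  apply: holoM => //; apply: holoD; first exact: holo_toC.
  by apply: holo_gip => a; exact: holo_cy.
Qed.

Lemma holo_unchart_x e w i a : psi_dom w -> holo (fun v : W27 => kx (unchart e (toC v)) i 0 a) w.
Proof.
move=> wd; have pV : holo (fun v : W27 => (cp (toC v))^-1) w.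
  by apply: holoV; [exact: cp_neq0|exact: holo_cp].
elim/I3P: i.
- apply: (holo_ext (f := fun v => (cp (toC v))^-1 *
     (cx (toC v) 0 a + gconj (gmul (cy e (toC v)) (cz (toC v))) 0 a))).
    by move=> v; rewrite kpair_x /= [RHS]mxE [in RHS]mxE.
  apply: holoM => //; apply: holoD; first exact: holo_cx.
  by apply: holo_gconj; apply: holo_gmul => b; [exact: holo_cy|exact: holo_cz].
- by apply: holo_ext (holo_cy e a wd) => v; rewrite kpair_x.
- by apply: holo_ext (holo_cz w a) => v; rewrite kpair_x.
Qed.

Lemma holomorphic_phi e : holomorphic (phi_dom e) (phi e).
Proof.
apply: (holomorphic_mx (F := fun A => \row_(j < 27) chart e (emb A) j)) => A _ i j.
by apply: holo_ext (holo_chart e j A) => B; rewrite mxE.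
Qed.

Lemma holomorphic_pair (V W1 W2 : normedModType R) (U : set (V * V))
    (f : V * V -> W1 * W1) (g : V * V -> W2 * W2) :
  holomorphic U f -> holomorphic U g ->
  holomorphic U (fun B => (((f B).1, (g B).1), ((f B).2, (g B).2))).
Proof.
move=> fh gh A UA; have [fd fi] := fh A UA; have [gd gi] := gh A UA.
have fd' := differentiableP fd; have gd' := differentiableP gd.
have f1 := @is_diff_comp _ _ _ _ _ _ _ _ _ fd' (is_diff_fst (f A)).
have f2 := @is_diff_comp _ _ _ _ _ _ _ _ _ fd' (is_diff_snd (f A)).
have g1 := @is_diff_comp _ _ _ _ _ _ _ _ _ gd' (is_diff_fst (g A)).
have g2 := @is_diff_comp _ _ _ _ _ _ _ _ _ gd' (is_diff_snd (g A)).
have [d dE] := is_diff_pair (is_diff_pair f1 g1) (is_diff_pair f2 g2).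
split; first exact: d.
by move=> H; rewrite dE /= fi gi.
Qed.

Lemma holomorphic_psi e : holomorphic psi_dom (psi e).
Proof.
apply: holomorphic_pair; apply: holomorphic_mx => w wd i j.
  apply: holo_ext (holo_unchart_xi e j wd) => v; by rewrite /kxi (ord1 i).
by apply: holo_ext (holo_unchart_x e i j wd) => v; rewrite /kx mxE.
Qed.

Lemma psi_dom_open : open psi_dom.
Proof.
apply: openI; first by apply: holo_open_neq0 => w; exact: holo_toC.
by apply: holo_open_neq0 => w; exact: holo_cP.
Qed.

Lemma phi_dom_open e : open (phi_dom e).
Proof.
apply: openI; first by apply: holo_open_neq0 => A; exact: holo_xi.
by apply: holo_open_neq0 => A; exact: (holo_chart e 0).
Qed.

Lemma EO_intro (A : JC) : kmul A.1 A.1 = kmul A.2 A.2 -> kmul A.1 A.2 = 0 ->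
  A <> 0 -> @EO R A.
Proof.
move=> aabb ab A0; split=> //; rewrite /jmulC /bilinC !jmulE.
by rewrite [kmul A.2 A.1]kmulC aabb ab subrr addr0.
Qed.

Lemma EO_phi e A : e * e = -1 -> phi_dom e A -> @EO R A <->
  forall j : 'I_27, (16 <= j)%N -> (phi e A).1 0 j = 0 /\ (phi e A).2 0 j = 0.
Proof.
move=> ee [p0 u0].
have E : @EO R A <-> kmul (emb A) (emb A) = 0.
  rewrite -emb_jmulC; split=> [[-> _]|A0]; first exact: emb0.
  split; first by apply: emb_inj; rewrite A0 emb0.
  by move=> A00; move: p0; rewrite A00 emb0 /kxi mxE eqxx.
apply: (iff_trans E); apply: (iff_trans (kmul_sq0_chartP ee p0)); split=> [h j j16|h j /andP[j16 j27]].
  by rewrite !mxE h// j16 /=.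
have [] := h (Ordinal j27) j16; rewrite !mxE /= => h1 h2.
by apply/eqP; rewrite eq_complex h1 h2 /= eqxx.
Qed.

Definition has_chart (A : JC) := exists (U : set JC) (f : JC -> W27) (g : W27 -> JC),
    [/\ open U /\ U A, open (f @` U),
        holomorphic U f /\ holomorphic (f @` U) g,
        (forall B, U B -> g (f B) = B) &
        forall B, U B -> (@EO R B <->
          forall j : 'I_27, (16 <= j)%N ->
            (f B).1 0 j = 0 /\ (f B).2 0 j = 0)].

Lemma has_chart_dom e A : e * e = -1 -> phi_dom e A -> has_chart A.
Proof.
move=> ee Ad; exists (phi_dom e), (phi e), (psi e).
rewrite phi_image//; split.
- by split=> //; exact: phi_dom_open.
- exact: psi_dom_open.
- by split; [exact: holomorphic_phi|exact: holomorphic_psi].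
- by move=> B; exact: phiK.
- by move=> B; exact: EO_phi ee.
Qed.

(** The factors [xi_0 + i y_0] and [xi_0 - i y_0] add up to [2 xi_0], so one
    of them is nonzero. *)
Lemma has_chart_xi0 A : kxi (emb A) 0 != 0 -> has_chart A.
Proof.
move=> p0; have ii : 'i%C * 'i%C = -1 :> C by rewrite -expr2 sqr_i.
have nini : (- 'i%C) * (- 'i%C) = -1 :> C by rewrite mulrNN.
have [u0|u0] := eqVneq (chart_u 'i%C (emb A)) 0; last exact: (has_chart_dom ii).
apply: (has_chart_dom nini); split=> //; apply: contra p0 => /eqP v0.
have : 2 * kxi (emb A) 0 = chart_u 'i%C (emb A) + chart_u (- 'i%C) (emb A).
  by rewrite /chart_u; ring.
by rewrite u0 v0 addr0 => /eqP; rewrite mulf_eq0 pnatr_eq0.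
Qed.

(** A real automorphism extends to a complex linear map that preserves the
    cone. *)
Lemma has_chart_transport (g gi : J -> J) A : jaut g gi ->
  has_chart (g A.1, g A.2) -> has_chart A.
Proof.
move=> ga; have gia := jaut_inv ga.
have [gl gil gK giK _] := ga.
pose G (B : JC) : JC := (g B.1, g B.2); pose Gi (B : JC) : JC := (gi B.1, gi B.2).
have GK B : Gi (G B) = B by rewrite /G /Gi /= !gK; case: B.
have GiK B : G (Gi B) = B by rewrite /G /Gi /= !giK; case: B.
have gc := jlinear_continuous gl; have gic := jlinear_continuous gil.
have dG (h : J -> J) (B : JC) : linear h -> continuous h ->
    is_diff B (fun B : JC => (h B.1, h B.2)) (fun H : JC => (h H.1, h H.2)).
  move=> hl hc; apply: is_diff_pair.
    exact: (@is_diff_comp _ _ _ _ _ _ _ _ _ (is_diff_fst B) (is_diff_linear B.1 hl hc)).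
  exact: (@is_diff_comp _ _ _ _ _ _ _ _ _ (is_diff_snd B) (is_diff_linear B.2 hl hc)).
have hN (h : J -> J) : linear h -> forall X, h (- X) = - h X.
  move=> hl X; have h0 : h 0 = 0.
    by have := hl 1 0 0; rewrite !scale1r addr0 -[LHS]addr0 => /addrI/esym.
  by have := hl (-1) X 0; rewrite !scaleN1r h0 !addr0.
have EG B : @EO R B <-> @EO R (G B).
  have imp (h hi : J -> J) C' : jaut h hi -> @EO R C' -> @EO R (h C'.1, h C'.2).
    move=> ha [C0 Cn0]; have [hl _ hK _ _] := ha.
    have h0 : h 0 = 0.
      by have := hl 1 0 0; rewrite !scale1r addr0 -[LHS]addr0 => /addrI/esym.
    have [aabb ab _ _ _] := EOP (conj C0 Cn0).
    apply: EO_intro => /=; rewrite ?(jaut_mul ha) ?aabb ?ab// => hC.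
    have hC1 : h C'.1 = 0 := congr1 fst hC.
    have hC2 : h C'.2 = 0 := congr1 snd hC.
    apply: Cn0; rewrite [C']surjective_pairing.
    have hi0 : hi 0 = 0 by rewrite -[X in hi X]h0 hK.
    by rewrite -(hK C'.1) -(hK C'.2) hC1 hC2 hi0.
  split; first exact: (imp g gi B ga).
  by move=> /(imp gi g (G B) gia); rewrite -[(_, _)]/(Gi (G B)) GK.
move=> [U [f [k [[oU UA] ofU [fh kh] kf fE]]]].
exists (G @^-1` U), (f \o G), (Gi \o k).
have img : (f \o G) @` (G @^-1` U) = f @` U.
  apply/seteqP; split=> [_ [B UB <-]|_ [B UB <-]]; first by exists (G B).
  by exists (Gi B) => //=; rewrite GiK.
rewrite img; split.
- split=> //; apply: open_comp oU => B _.
  by apply: differentiable_continuous; have [] := dG g B gl gc.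
- exact: ofU.
- split=> B UB.
    have [fd fi] := fh _ UB.
    have [d dE] := @is_diff_comp _ _ _ _ _ _ _ _ _ (dG g B gl gc) (differentiableP fd).
    split; first exact: d.
    by move=> H; rewrite dE /= -fi /mulI /= (hN g gl).
  have [kd ki] := kh _ UB.
  have [d dE] := @is_diff_comp _ _ _ _ _ _ _ _ _ (differentiableP kd) (dG gi (k B) gil gic).
  split; first exact: d.
  by move=> H; rewrite dE /= ki /mulI /= (hN gi gil).
- by move=> B UB /=; rewrite kf// GK.
- by move=> B UB; apply: (iff_trans (EG B)); exact: fE.
Qed.

Lemma EO_complex_submanifold : complex_submanifold 27 16 (@EO R).
Proof.
split=> // A [_ A0].
suff : has_chart A by [].
have [g [gi [ga gA]]] : exists g gi : J -> J, jaut g gi /\ (kxi (g A.1) 0 <> 0 \/ kxi (g A.2) 0 <> 0).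
  have [a0|a0] := pselect (A.1 = 0).
    have b0 : A.2 <> 0 by move=> b0; apply: A0; rewrite [A]surjective_pairing a0 b0.
    by have [g [gi [ga gA]]] := exists_jaut b0; exists g, gi; split=> //; right.
  by have [g [gi [ga gA]]] := exists_jaut a0; exists g, gi; split=> //; left.
apply: (has_chart_transport ga); apply: has_chart_xi0.
rewrite emb_xi eq_complex /= negb_and.
by case: gA => /eqP ->; rewrite ?orbT.
Qed.
End LocalChart.

(** * Pull-back of the form to the bundle *)

Section TangentVectors.
Context {R : realType} {V : normedModType R}.

Lemma tangent_const (S : set V) (x v : V) (phi dphi : V -> R) (c : R) :
  tangent S x v -> is_diff x phi dphi -> (forall y, S y -> phi y = c) -> dphi v = 0.
Proof.
move=> [I [g [oI I0 gs gS [g0 g'0]]]] pd phiS.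
have [gd _] := gs 1%N; have {}gd := gd 0 I0.
rewrite -g0 in pd.
have cd := @is_diff_comp _ _ _ _ _ _ _ _ _ (differentiableP gd) pd.
have near_c : \forall t \near (0 : R), cst c t = (phi \o g) t.
  have : \forall t \near (0 : R), I t by exact: open_nbhs_nbhs.
  by apply: filterS => t It; rewrite /= phiS//; exact: gS.
have cd' := near_eq_is_diff near_c (is_diff_const c (0 : R)).
have := is_diff_deriveE (1 : R) cd; rewrite (is_diff_deriveE (1 : R) cd') /=.
by rewrite -(derive1E' gd) g'0 => <-.
Qed.

End TangentVectors.

Section Pullback.
Context {R : realType}.
Local Notation J := (jordan R).
Implicit Types p u v : J * J.

Lemma is_diff_kip (V : normedModType R) (f g : V -> J) x df dg :
  is_diff x f df -> is_diff x g dg ->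
  is_diff x (fun y => kip (f y) (g y) : R) (fun h => kip (f x) (dg h) + kip (df h) (g x)).
Proof.
have e : @kip R = @jip R by apply/funext => X; apply/funext => Y; rewrite jipE'.
rewrite e.
exact: (@is_diff_bilin R V _ _ _ (@jip R) jip_linl jip_linr jip_continuous).
Qed.

Lemma is_diff_kmul (V : normedModType R) (f g : V -> J) x df dg :
  is_diff x f df -> is_diff x g dg ->
  is_diff x (fun y => kmul (f y) (g y)) (fun h => kmul (f x) (dg h) + kmul (df h) (g x)).
Proof.
have e : @kmul R = @jmul R by apply/funext => X; apply/funext => Y; rewrite jmulE.
rewrite e.
exact: (@is_diff_bilin R V _ _ _ (@jmul R) jmul_linl jmul_linr jmul_continuous).
Qed.

Opaque jip jmul kip kmul.

(** These are the differentials of [(X, Y)], [(Y^2, Y)], [(X, X)] and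
    [2 (X, Y^2) - (Y, Y)], all constant on the bundle. *)
Lemma tangent_T0P2O p u : @T0P2O R p -> tangent (@T0P2O R) p u ->
  [/\ kip p.1 u.2 = - kip p.2 u.1,
      kip (kmul p.2 p.2) u.2 = 0,
      kip p.1 u.1 = 0 &
      kip (kmul p.2 p.2) u.1 = 0].
Proof.
move=> pT tu; have [XX TX XY Y0] := T0P2OP pT.
have d1 := is_diff_fst p; have d2 := is_diff_snd p.
have c1 y : @T0P2O R y -> kip y.1 y.2 = 0.
  by case/T0P2OP => h1 h2 h3 h4; exact: tan_ip.
have c2 y : @T0P2O R y -> kip (kmul y.2 y.2) y.2 = 0.
  by case/T0P2OP => h1 h2 h3 h4; exact: tan_Y2Y h1 h2 h3.
have c3 y : @T0P2O R y -> kip y.1 y.1 = 1.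
  by case/T0P2OP => h1 h2 h3 h4; exact: tan_ipX.
have c4 y : @T0P2O R y -> 2 * kip y.1 (kmul y.2 y.2) - kip y.2 y.2 = 0.
  by case/T0P2OP => h1 h2 h3 h4; rewrite (tan_ipXY2 h3) /khalf mulrA mulfV ?pnatr_eq0// mul1r subrr.
have e1 := tangent_const tu (is_diff_kip d1 d2) c1.
have e2 := tangent_const tu (is_diff_kip (is_diff_kmul d2 d2) d2) c2.
have e3 := tangent_const tu (is_diff_kip d1 d1) c3.
have e4 := tangent_const tu (is_diff_add (is_diff_mul (is_diff_const (2 : R) p) (is_diff_kip d1 (is_diff_kmul d2 d2)))
  (is_diff_opp (is_diff_kip d2 d2))) c4.
move: {c1 c2 c3 c4 d1 d2 pT tu Y0} XX TX XY e1 e2 e3 e4; rewrite /=.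
move: p.1 p.2 u.1 u.2 => X Y X' Y'.
move=> XX TX XY; rewrite mul0r addr0.
have kd (Z : J) : Z + Z = 2 *: Z by rewrite scaler_nat mulr2n.
rewrite [kmul Y' Y]kmulC kd kipZl kipZr [kip X' X]kipC [kip X' Y]kipC [kip Y' Y]kipC.
rewrite [kip (kmul Y Y') Y]kipC [kip X' _]kipC -kip_assoc -[kip X (kmul Y Y')]kip_assoc XY kipZl.
move: (kip X Y') (kip Y X') (kip (kmul Y Y) Y') (kip X X') (kip (kmul Y Y) X') (kip Y Y').
move=> a b c d e f h1 h2 h3 h4; split; lra.
Qed.

End Pullback.

Section PullbackScalar.
Context {R : realType} {V : lmodType R} (b : V -> V -> R).
Hypotheses (b_linl : forall z, linear (fun x => b x z : R))
  (bC : forall x y, b x y = b y x).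
Variables (X Y W : V) (n s : R).
Hypotheses (n0 : 0 < n) (s0 : 0 < s) (s2 : s * s = 2).
Hypotheses (bXX : b X X = 1) (bXY : b X Y = 0) (bYY : b Y Y = n ^+ 2)
  (bXW : b X W = n ^+ 2 / 2) (bYW : b Y W = 0).

(** Here [W], [Z1] and [Z2] stand for [Y^2], [Y o Y1] and [Y o Y2], [n] for the
    norm of [Y] and [s] for [sqrt 2]; then [A] is the image of [(X, Y)] under
    [tauO] and [dA] the differential of [tauO]. *)
Let A : V * V := (n ^+ 2 *: X - W, (s^-1 * n) *: Y).
Let dA (X1 Y1 Z1 : V) : V * V :=
  ((2 * b Y Y1) *: X + n ^+ 2 *: X1 - 2 *: Z1,
   (s^-1 * (b Y Y1 / n)) *: Y + (s^-1 * n) *: Y1).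

Let bDl x y z : b (x + y) z = b x z + b y z.
Proof. by have := b_linl z 1 x y; rewrite !scale1r. Qed.
Let bZl c x z : b (c *: x) z = c * b x z.
Proof.
have b0 : b 0 z = 0 by apply: (addrI (b 0 z)); rewrite addr0 -bDl addr0.
by have := b_linl z c x 0; rewrite !addr0 b0 addr0.
Qed.
Let bNl x z : b (- x) z = - b x z.
Proof. by rewrite -scaleN1r bZl mulN1r. Qed.
Let bDr x y z : b z (x + y) = b z x + b z y.
Proof. by rewrite !(bC z) bDl. Qed.
Let bZr c x z : b z (c *: x) = c * b z x.
Proof. by rewrite !(bC z) bZl. Qed.
Let bNr x z : b z (- x) = - b z x.
Proof. by rewrite !(bC z) bNl. Qed.
Let bE := (bDl, bDr, bNl, bNr, bZl, bZr).
Let bs := (bXX, bXY, bYY, bXW, bYW).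

Section OneVector.
Variables X1 Y1 Z1 : V.
Hypotheses (bXX1 : b X X1 = 0) (bWX1 : b W X1 = 0) (bWY1 : b W Y1 = 0)
  (bXY1 : b X Y1 = - b Y X1) (bXZ1 : b X Z1 = b Y Y1 / 2) (bYZ1 : b Y Z1 = 0)
  (bWZ1 : b W Z1 = n ^+ 2 / 2 * b Y Y1).
Let H := dA X1 Y1 Z1.

Lemma pullback_ipR : b A.1 H.1 + b A.2 H.2 = 2 * n ^+ 2 * b Y Y1.
Proof.
rewrite /A /H /dA /= !bE (bC W X) !bs bXX1 bWX1 bXZ1 bWZ1.
have s'0 : s != 0 by rewrite gt_eqF.
have si : s^-1 * s^-1 = 2^-1 by rewrite -invfM s2.
transitivity (n ^+ 2 * (b Y Y1) + s^-1 * s^-1 * (2 * n ^+ 2 * b Y Y1)).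
  by move: (b Y Y1) => y; field; rewrite s'0 gt_eqF.
by rewrite si; field.
Qed.

Lemma pullback_wR : b A.2 H.1 - b A.1 H.2 = 2 * s^-1 * n ^+ 3 * b Y X1.
Proof.
rewrite /A /H /dA /= !bE (bC Y X) (bC W Y) !bs bYZ1 bXY1 bWY1.
by move: (b Y X1) => y; field; rewrite !gt_eqF.
Qed.
End OneVector.

Variables (X1 Y1 Z1 X2 Y2 Z2 : V).
Hypotheses (bXX1 : b X X1 = 0) (bWX1 : b W X1 = 0) (bWY1 : b W Y1 = 0)
  (bXY1 : b X Y1 = - b Y X1) (bXZ1 : b X Z1 = b Y Y1 / 2) (bYZ1 : b Y Z1 = 0)
  (bWZ1 : b W Z1 = n ^+ 2 / 2 * b Y Y1).
Hypotheses (bXX2 : b X X2 = 0) (bWX2 : b W X2 = 0) (bWY2 : b W Y2 = 0)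
  (bXY2 : b X Y2 = - b Y X2) (bXZ2 : b X Z2 = b Y Y2 / 2) (bYZ2 : b Y Z2 = 0)
  (bWZ2 : b W Z2 = n ^+ 2 / 2 * b Y Y2).
Hypothesis (bYZ : b Y1 Z2 = b Y2 Z1).
Let H := dA X1 Y1 Z1.
Let K := dA X2 Y2 Z2.

Lemma pullback_wR12 : b H.2 K.1 - b H.1 K.2 =
  s^-1 * (3 * n * (b Y Y1 * b Y X2 - b Y Y2 * b Y X1)
          + n ^+ 3 * (b Y1 X2 - b Y2 X1)).
Proof.
rewrite /H /K /dA /= !bE (bC Y X) (bC Y1 X) (bC X1 Y) (bC X1 Y2) (bC Z1 Y) (bC Z1 Y2).
rewrite !bs bYZ1 bYZ2 bXY1 bXY2 bYZ.
move: (b Y Y1) (b Y Y2) (b Y X1) (b Y X2) (b Y1 X2) (b Y2 X1) (b Y2 Z1) => *.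
by field; rewrite !gt_eqF.
Qed.

(** The terms with [b Y Y1] or [b Y Y2], the derivatives of the norm, cancel
    between the two summands of the form. *)
Lemma pullback_scalar :
  2^-1 * (b H.2 K.1 - b H.1 K.2) / n ^+ 3
   + 3 / 8 * ((b A.2 H.1 - b A.1 H.2) * (b A.1 K.1 + b A.2 K.2)
              - (b A.2 K.1 - b A.1 K.2) * (b A.1 H.1 + b A.2 H.2)) / n ^+ 7
  = s^-1 * (2^-1 * (b Y1 X2 - b Y2 X1)).
Proof.
rewrite pullback_wR12 /H /K.
rewrite (pullback_wR bWY1 bXY1 bYZ1) (pullback_wR bWY2 bXY2 bYZ2).
rewrite (pullback_ipR bXX1 bWX1 bXZ1 bWZ1) (pullback_ipR bXX2 bWX2 bXZ2 bWZ2).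
move: (b Y Y1) (b Y Y2) (b Y X1) (b Y X2) (b Y1 X2) (b Y2 X1) => *.
by field; rewrite !gt_eqF.
Qed.
End PullbackScalar.

Section PullbackForm.
Context {R : realType}.
Local Notation J := (jordan R).

Lemma omegaO_kip (u v : J * J) : omegaO u v = 2^-1 * (kip u.2 v.1 - kip v.2 u.1).
Proof.
rewrite /omegaO; congr (_ * _).
have E (a c d e : J) : \sum_(i < 3) (jxi a i * jxi c i - jxi d i * jxi e i)
   + 2 * \sum_(i < 3) \sum_(k < 4 + 4) (jx a i 0 k * jx c i 0 k - jx d i 0 k * jx e i 0 k)
   = kip a c - kip d e.
  rewrite /kip -sumrB mulr_sumr -big_split /=; apply: eq_bigr => i _.
  have gE x y : \sum_(k < 4 + 4) jx x i 0 k * jx y i 0 k = gip (kx x i) (kx y i) by [].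
  rewrite sumrB !gE; move: (gip _ _) (gip _ _) => g g'.
  by rewrite /jxi /kxi; ring.
exact: E.
Qed.

Lemma is_diff_tauO (p : J * J) : p.2 <> 0 ->
  is_diff p (@tauO R) (fun u =>
   ((2 * kip p.2 u.2) *: p.1 + (jnorm p.2 ^+ 2) *: u.1 - 2 *: kmul p.2 u.2,
    ((Num.sqrt 2)^-1 * (kip p.2 u.2 / jnorm p.2)) *: p.2
      + ((Num.sqrt 2)^-1 * jnorm p.2) *: u.2)).
Proof.
move=> Y0; have n0 := jnorm_gt0 Y0.
have nE (X : J) : jnorm X = Num.sqrt (kip X X) by rewrite /jnorm jipE'.
have d1 := is_diff_fst p; have d2 := is_diff_snd p.
have q0 : 0 < kip p.2 p.2 by rewrite -jipE' jip_gt0.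
have dq := is_diff_kip d2 d2.
have dn := is_diff_comp_sqrt (f := fun q : J * J => kip q.2 q.2) q0 dq.
have dA := is_diff_add (is_diff_scale dq d1) (is_diff_opp (is_diff_kmul d2 d2)).
have dB := is_diff_scale (is_diff_mul (is_diff_const (Num.sqrt 2)^-1 p) dn) d2.
have tE : @tauO R = fun q => (kip q.2 q.2 *: q.1 - kmul q.2 q.2,
     ((Num.sqrt 2)^-1 * Num.sqrt (kip q.2 q.2)) *: q.2).
  by apply/funext => q; rewrite tauOE nE.
rewrite tE; apply: is_diff_eq (is_diff_pair dA dB) _.
apply/funext => u /=; rewrite -nE.
have n2 : kip p.2 p.2 = jnorm p.2 ^+ 2 by rewrite jnorm_sq jipE'.
rewrite (kipC u.2) (kmulC u.2) n2.
move: (kip p.2 u.2) (kmul p.2 u.2) (jnorm p.2) n0 => y Z n n0.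
congr (_, _).
  have -> : y + y = 2 * y by ring.
  have -> : Z + Z = 2 *: Z by rewrite scaler_nat mulr2n.
  by congr (_ - _); exact: addrC.
rewrite addrC; congr (_ *: _ + _).
by rewrite mul0r addr0; congr (_ * _); field; rewrite gt_eqF.
Qed.

Lemma tauO_pullback (p u v : J * J) :
  @T0P2O R p -> tangent (@T0P2O R) p u -> tangent (@T0P2O R) p v ->
  pullback2 (@tauO R)
    (fun A H K =>
       'i%C * delbar1 (del (fun B => (Num.sqrt (jnormC B))%:C%C)) A H K)
    p u v
  = ((Num.sqrt 2)^-1 * omegaO u v)%:C%C.
Proof.
move=> pT tu tv; have [XX TX XY Y0] := T0P2OP pT.
have [u1 u2 u3 u4] := tangent_T0P2O pT tu; have [v1 v2 v3 v4] := tangent_T0P2O pT tv.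
have [_ tN0] := tauO_EO pT.
have n0 := jnorm_gt0 Y0.
have jk : @jip R = @kip R by apply/funext => X; apply/funext => Y; rewrite jipE'.
have jC (X Y : J) : jip X Y = jip Y X by rewrite !jipE' kipC.
have b_gt0 (X : J) : X <> 0 -> 0 < jip X X by exact: jip_gt0.
have dE := is_diff_tauO Y0; have {}dE := @diff_val _ _ _ _ _ _ _ dE.
rewrite /pullback2 dE.
rewrite (delbar1_del_potential jip_linl jip_linr jip_continuous jC b_gt0 _ _ tN0).
congr (_%:C)%C.
have -> : potential (@jip R) (tauO p) = jnorm p.2.
  rewrite /potential -[formnorm _ _]/(jnormC (tauO p)) jnormCE tauO_norm//.
  by rewrite sqrtr_sqr ger0_norm ?jip_ge0.
rewrite /wR /ipR omegaO_kip tauOE.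
have n2 : kip p.2 p.2 = jnorm p.2 ^+ 2 by rewrite jnorm_sq jipE'.
rewrite jk [X in (X *: p.1 - _, _)]n2.
have s0 : 0 < Num.sqrt (2 : R) by rewrite sqrtr_gt0.
have kl (z : J) : linear (fun x => kip x z : R) by move=> a x y; rewrite kipDl kipZl.
have hY : khalf p.2 = jnorm p.2 ^+ 2 / 2 by rewrite /khalf n2 mulrC.
have bXW : kip p.1 (kmul p.2 p.2) = jnorm p.2 ^+ 2 / 2 by rewrite (tan_ipXY2 XY).
have bYW : kip p.2 (kmul p.2 p.2) = 0 by rewrite kipC (tan_Y2Y XX TX XY).
have bXZ w : kip p.1 (kmul p.2 w) = kip p.2 w / 2.
  by rewrite -kip_assoc XY kipZl mulrC.
have bYZ w : kip p.2 (kmul p.2 w) = kip (kmul p.2 p.2) w by rewrite -kip_assoc.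
have bWZ w : kip (kmul p.2 p.2) (kmul p.2 w) = jnorm p.2 ^+ 2 / 2 * kip p.2 w.
  by rewrite -kip_assoc [kmul (kmul _ _) _]kmulC (tan_cube XX TX XY) kipZl hY.
have sym : kip u.2 (kmul p.2 v.2) = kip v.2 (kmul p.2 u.2).
  by rewrite -kip_assoc kipC [kmul u.2 _]kmulC.
exact: (pullback_scalar kl (@kipC R) n0 s0 sqrt2_sq (tan_ipX XX TX) (tan_ip XX XY) n2
  bXW bYW u3 u4 u2 u1 (bXZ u.2) (etrans (bYZ u.2) u2) (bWZ u.2)
  v3 v4 v2 v1 (bXZ v.2) (etrans (bYZ v.2) v2) (bWZ v.2) sym).
Qed.
End PullbackForm.

Theorem theorem2p1 (R : realType) :
  [/\ exists k : nat, complex_submanifold 27 k (@EO R),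
      diffeomorphism (@T0P2O R) (@EO R) (@tauO R) &
      forall p u v : jordan R * jordan R,
        @T0P2O R p -> tangent (@T0P2O R) p u -> tangent (@T0P2O R) p v ->
        pullback2 (@tauO R)
          (fun A H K =>
             'i%C * delbar1 (del (fun B => (Num.sqrt (jnormC B))%:C%C)) A H K)
          p u v
        = ((Num.sqrt 2)^-1 * omegaO u v)%:C%C].
Proof.
split; first by exists 16; exact: EO_complex_submanifold.
  exact: tauO_diffeomorphism.
by move=> p u v; exact: tauO_pullback.
Qed.
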